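(* Let $k$ be a field and let $P,Q$ be reduced $\mathfrak{S}$-bimodules over $k$. For all integers $m,n\geqslant1$ there is an isomorphism of $\mathfrak{S}_m\times\mathfrak{S}_n^{\mathrm{op}}$-modules $$\big(P\boxtimes^b_cQ\big)(\{1,\dots,m\},\{1,\dots,n\})\;\cong\;\big(P\boxtimes_c^{\mathrm{Val}}Q\big)(m,n).$$
   Context: $\mathrm{Ch}_k$ is the category of $\mathbb{Z}$-graded chain complexes over $k$ with Koszul symmetry; $\mathrm{Fin}$ is the category of finite sets and bijections. A reduced $\mathfrak{S}$-bimodule is a functor $P:\mathrm{Fin}\times\mathrm{Fin}^{\mathrm{op}}\to\mathrm{Ch}_k$ with $P(\varnothing,S)=0=P(S,\varnothing)$ for all $S$; write $P(m,n)=P(\{1,\dots,m\},\{1,\dots,n\})$, which has a left $\mathfrak{S}_m$-action and a right $\mathfrak{S}_n$-action. Definition of $\boxtimes_c^b$: for finite sets $S,E$, $$(P\boxtimes_c^{b}Q)(S,E)=\bigoplus_{N\ge1}\Big(\bigoplus\ \bigotimes_\alpha P(I_\alpha,K'_\alpha)\otimes\bigotimes_\beta Q(K''_\beta,J_\beta)\Big)_{\mathfrak{S}_N},$$ where the inner sum runs over unordered families of pairs $\{(I_\alpha,K'_\alpha)\}_\alpha$ and $\{(K''_\beta,J_\beta)\}_\beta$ of non-empty sets such that $(I_\alpha)$ partitions $S$, $(K'_\alpha)$ and $(K''_\beta)$ partition $\{1,\dots,N\}$, $(J_\beta)$ partitions $E$, and the join (finest common coarsening) of the partitions $K'$ and $K''$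 is the one-block partition of $\{1,\dots,N\}$; unordered tensor products are used, $\mathfrak{S}_N$ acts by relabelling $\{1,\dots,N\}$, and $(-)_{\mathfrak{S}_N}$ denotes coinvariants. Definition of Vallette's product $\boxtimes_c^{\mathrm{Val}}$: for a tuple $\bar k=(k_1,\dots,k_r)$ of positive integers let $|\bar k|=\sum k_a$ and $\mathfrak{S}_{\bar k}=\mathfrak{S}_{k_1}\times\dots\times\mathfrak{S}_{k_r}\subset\mathfrak{S}_{|\bar k|}$, corresponding to the division of $\{1,\dots,|\bar k|\}$ into consecutive blocks of sizes $k_1,\dots,k_r$. For $|\bar k|=N=|\bar j|$, $S_c^{\bar k,\bar j}\subset\mathfrak{S}_N$ is the set of connected permutations: those $\sigma$ for which the bipartite graph, with vertices the blocks of $\bar j$ (inputs) and the blocks of $\bar k$ (outputs), and with one edge for each $i\in\{1,\dots,N\}$ joining the $\bar j$-block of $i$ to the $\bar k$-block of $\sigma(i)$, is connected. Put $P(\bar l,\bar k)=P(l_1,k_1)\otimes\dots\otimes P(l_r,k_r)$ and similarly for $Q$. Then $$(P\boxtimes_c^{\mathrm{Val}}Q)(m,n)=\bigoplus_{N\ge1}\ \bigoplus_{r,s\ge1}\Big(\bigoplus_{\bar l,\bar k,\bar j,\bar i}k[\mathfrak{S}_m]\otimes_{\mathfrak{S}_{\bar l}}P(\bar l,\bar k)\otimes_{\mathfrak{S}_{\bar k}}k[S_c^{\bar k,\bar j}]\otimes_{\mathfrak{S}_{\bar j}}Q(\bar j,\bar i)\otimes_{\mathfrak{S}_{\bar i}}k[\mathfrak{S}_n]\Big)_{\mathfrak{S}_r\times\mathfrak{S}_s},$$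 the sum being over $\bar l,\bar k\in(\mathbb{N}^* )^r$, $\bar j,\bar i\in(\mathbb{N}^* )^s$ with $|\bar l|=m$, $|\bar k|=N=|\bar j|$, $|\bar i|=n$. The coinvariants are for the action permuting the factors (with Koszul signs) together with the corresponding block permutations: for $\tau\in\mathfrak{S}_r$, $\theta\otimes(p_1\otimes\dots\otimes p_r)\otimes\sigma\otimes\cdots$ is identified with $\pm\,\theta\tau_{\bar l}^{-1}\otimes(p_{\tau^{-1}(1)}\otimes\dots\otimes p_{\tau^{-1}(r)})\otimes\tau_{\bar k}\sigma\otimes\cdots$, where $\tau_{\bar l},\tau_{\bar k}$ are the block permutations induced by $\tau$; similarly for $\mathfrak{S}_s$ on the $Q$ side. *)

(* Defs.v *)
From HB Require Import structures.
From mathcomp Require Import all_boot all_order all_algebra all_fingroup.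
From mathcomp Require Import boolp.

Set Implicit Arguments.
Unset Strict Implicit.
Unset Printing Implicit Defensive.

Import GRing.Theory.
Local Open Scope ring_scope.
Local Open Scope quotient_scope.

Inductive lexp (k : fieldType) (X : Type) : Type :=
| LVar of X
| LZero
| LAdd of lexp k X & lexp k X
| LScale of k & lexp k X.
Arguments LVar {k X}.
Arguments LZero {k X}.

HB.instance Definition _ k X := gen_eqMixin (lexp k X).
HB.instance Definition _ k X := gen_choiceMixin (lexp k X).

Section Presentation.
Variables (k : fieldType) (X : Type) (R : lexp k X -> lexp k X -> Prop).

(* The congruence generated by the equations [R] and the module axioms. *)
Inductive leq : lexp k X -> lexp k X -> Prop :=
| leq_ax e f : R e f -> leq e f
| leq_refl e : leq e e
| leq_sym e f : leq e f -> leq f e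
| leq_trans e f g : leq e f -> leq f g -> leq e g
| leq_cAdd e e' f f' : leq e e' -> leq f f' -> leq (LAdd e f) (LAdd e' f')
| leq_cScale c e e' : leq e e' -> leq (LScale c e) (LScale c e')
| leq_addA e f g : leq (LAdd e (LAdd f g)) (LAdd (LAdd e f) g)
| leq_addC e f : leq (LAdd e f) (LAdd f e)
| leq_add0 e : leq (LAdd LZero e) e
| leq_addN e : leq (LAdd (LScale (-1) e) e) LZero
| leq_scaleA a b e : leq (LScale a (LScale b e)) (LScale (a * b) e)
| leq_scale1 e : leq (LScale 1 e) e
| leq_scaleDr c e f :
    leq (LScale c (LAdd e f)) (LAdd (LScale c e) (LScale c f))
| leq_scaleDl a b e :
    leq (LScale (a + b) e) (LAdd (LScale a e) (LScale b e)).

Definition leqb (e f : lexp k X) : bool := `[< leq e f >].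

Lemma leqb_refl : reflexive leqb.
Proof. by move=> e; apply/asboolP; apply: leq_refl. Qed.

Lemma leqb_sym : symmetric leqb.
Proof. by move=> e f; apply/asbool_equiv_eq; split; apply: leq_sym. Qed.

Lemma leqb_trans : transitive leqb.
Proof.
by move=> f e g /asboolP ef /asboolP fg; apply/asboolP; apply: leq_trans ef fg.
Qed.

Canonical leq_equiv : equiv_rel (lexp k X) :=
  EquivRel leqb leqb_refl leqb_sym leqb_trans.

(* The k-module with generators [X] and relations [R]; see [plift]. *)
Definition pmod : Type := {eq_quot leq_equiv}.

HB.instance Definition _ := Choice.on pmod.

Definition pclass (e : lexp k X) : pmod := \pi_({eq_quot leq_equiv}) e.
Definition pexp (q : pmod) : lexp k X :=
  generic_quotient.repr (q : {eq_quot leq_equiv}).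
Definition pgen (x : X) : pmod := pclass (LVar x).

Lemma pexpK q : pclass (pexp q) = q.
Proof. exact: reprK. Qed.

Lemma pclassP e f : pclass e = pclass f <-> leq e f.
Proof. by split=> [/eqmodP/asboolP|ef] //; apply/eqmodP/asboolP. Qed.

Lemma leq_pexp e : leq (pexp (pclass e)) e.
Proof. by apply/pclassP; rewrite pexpK. Qed.

Definition padd (p q : pmod) := pclass (LAdd (pexp p) (pexp q)).
Definition pscale (c : k) (p : pmod) := pclass (LScale c (pexp p)).

Lemma paddE e f : padd (pclass e) (pclass f) = pclass (LAdd e f).
Proof. by apply/pclassP/leq_cAdd; apply: leq_pexp. Qed.

Lemma pscaleE c e : pscale c (pclass e) = pclass (LScale c e).
Proof. by apply/pclassP/leq_cScale; apply: leq_pexp. Qed.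

Lemma pmodW (T : pmod -> Prop) : (forall e, T (pclass e)) -> forall q, T q.
Proof. by move=> h q; rewrite -(pexpK q). Qed.

Lemma paddA : associative padd.
Proof.
elim/pmodW=> e; elim/pmodW=> f; elim/pmodW=> g.
by rewrite !paddE; apply/pclassP/leq_addA.
Qed.

Lemma paddC : commutative padd.
Proof.
by elim/pmodW=> e; elim/pmodW=> f; rewrite !paddE; apply/pclassP/leq_addC.
Qed.

Lemma padd0 : left_id (pclass LZero) padd.
Proof. by elim/pmodW=> e; rewrite !paddE; apply/pclassP/leq_add0. Qed.

Lemma paddN : left_inverse (pclass LZero) (pscale (-1)) padd.
Proof. by elim/pmodW=> e; rewrite pscaleE paddE; apply/pclassP/leq_addN. Qed.

HB.instance Definition _ :=
  GRing.isZmodule.Build pmod paddA paddC padd0 paddN.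

Lemma pscaleA a b p : pscale a (pscale b p) = pscale (a * b) p.
Proof. by elim/pmodW: p => e; rewrite !pscaleE; apply/pclassP/leq_scaleA. Qed.

Lemma pscale1 : left_id 1 pscale.
Proof. by elim/pmodW=> e; rewrite !pscaleE; apply/pclassP/leq_scale1. Qed.

Lemma pscaleDr : right_distributive pscale +%R.
Proof.
move=> c; elim/pmodW=> e; elim/pmodW=> f.
by rewrite /GRing.add /= paddE !pscaleE paddE; apply/pclassP/leq_scaleDr.
Qed.

Lemma pscaleDl p : {morph pscale^~ p : a b / a + b}.
Proof.
elim/pmodW: p => e a b.
by rewrite [RHS]/GRing.add /= !pscaleE paddE; apply/pclassP/leq_scaleDl.
Qed.

HB.instance Definition _ :=
  GRing.Zmodule_isLmodule.Build k pmod pscaleA pscale1 pscaleDr pscaleDl.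

Fixpoint leval (M : lmodType k) (f : X -> M) (e : lexp k X) : M :=
  match e with
  | LVar x => f x
  | LZero => 0
  | LAdd e1 e2 => leval f e1 + leval f e2
  | LScale c e1 => c *: leval f e1
  end.

Lemma pclassE e : pclass e = leval pgen e.
Proof.
by elim: e => [x||e IHe f IHf|c e IHe] //=; rewrite -?IHe -?IHf -?paddE -?pscaleE.
Qed.

Lemma pgen_rel e f : R e f -> leval pgen e = leval pgen f.
Proof. by move=> ef; rewrite -!pclassE; apply/pclassP/leq_ax. Qed.

Section Lift.
Variables (M : lmodType k) (f : X -> M).
Hypothesis fR : forall e e', R e e' -> leval f e = leval f e'.

Lemma leval_leq e e' : leq e e' -> leval f e = leval f e'.
Proof.
elim=> //= {e e'}.
- by move=> e f0 g _ -> _ ->.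
- by move=> e e' g g' _ -> _ ->.
- by move=> c e e' _ ->.
- by move=> e g h; rewrite addrA.
- by move=> e g; rewrite addrC.
- by move=> e; rewrite add0r.
- by move=> e; rewrite scaleN1r addNr.
- by move=> a b e; rewrite scalerA.
- by move=> e; rewrite scale1r.
- by move=> c e g; rewrite scalerDr.
- by move=> a b e; rewrite scalerDl.
Qed.

Definition plift_fun of (forall e e', R e e' -> leval f e = leval f e') :=
  fun q : pmod => leval f (pexp q).

Lemma plift_class e : plift_fun fR (pclass e) = leval f e.
Proof. exact/leval_leq/leq_pexp. Qed.

Lemma plift_linear : linear (plift_fun fR).
Proof.
move=> c; elim/pmodW=> e; elim/pmodW=> g.
rewrite {1}/GRing.scale /= pscaleE {1}/GRing.add /= paddE.
by rewrite !plift_class.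
Qed.

HB.instance Definition _ :=
  GRing.isLinear.Build k pmod M *:%R (plift_fun fR) plift_linear.

Definition plift : {linear pmod -> M} := plift_fun fR.

Lemma plift_gen x : plift (pgen x) = f x.
Proof. exact: plift_class. Qed.

End Lift.

Lemma pmod_ind (T : pmod -> Prop) :
    T 0 -> (forall c p q, T p -> T q -> T (c *: p + q)) ->
    (forall x, T (pgen x)) -> forall q, T q.
Proof.
move=> T0 TD Tg; elim/pmodW=> e; rewrite pclassE.
elim: e => [x||e IHe f IHf|c e IHe] //=.
- by have := TD 1 _ _ IHe IHf; rewrite scale1r.
- by have := TD c _ _ IHe T0; rewrite addr0.
Qed.

Lemma pmod_ext (M : lmodType k) (f g : {linear pmod -> M}) :
  (forall x, f (pgen x) = g (pgen x)) -> f =1 g.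
Proof.
move=> fg; elim/pmod_ind=> [|c p q Ip Iq|x] //; first by rewrite !raddf0.
by rewrite !linearP Ip Iq.
Qed.

End Presentation.

Record complex (k : fieldType) := Complex {
  cobj :> int -> lmodType k;
  cdiff : forall n, {linear cobj n -> cobj (n - 1)};
  cdiffK : forall n (x : cobj n), cdiff (n - 1) (cdiff n x) = 0 }.
Arguments cdiff {k} c n.

Record chmap (k : fieldType) (C D : complex k) := Chmap {
  cmap :> forall n, {linear C n -> D n};
  cmap_diff : forall n (x : C n), cmap (n - 1) (cdiff C n x) = cdiff D n (cmap n x) }.
Arguments cmap {k C D} _ n.

Lemma chmapB (k : fieldType) (C D : complex k) (f : chmap C D) n (x y : C n) :
  f n (x - y) = f n x - f n y.
Proof. exact: linearB. Qed.

Lemma chmapZ (k : fieldType) (C D : complex k) (f : chmap C D) n c (x : C n) :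
  f n (c *: x) = c *: f n x.
Proof. exact: linearZ. Qed.

Definition chmap_id (k : fieldType) (C : complex k) : chmap C C :=
  @Chmap k C C (fun n => idfun : {linear C n -> C n}) (fun n x => erefl).

Section ChComp.
Variables (k : fieldType) (C D E : complex k) (g : chmap D E) (f : chmap C D).

Lemma chmap_comp_diff n (x : C n) :
  (g (n - 1) \o f (n - 1)) (cdiff C n x) = cdiff E n ((g n \o f n) x).
Proof. by rewrite /= !cmap_diff. Qed.

Definition chmap_comp : chmap C E :=
  @Chmap k C E (fun n => g n \o f n : {linear C n -> E n}) chmap_comp_diff.

Lemma chmap_compE n (x : C n) : chmap_comp n x = g n (f n x).
Proof. by []. Qed.
End ChComp.

(* Homogeneous elements, tagged with their degree. *)
Definition helt (k : fieldType) (C : complex k) : Type := {n : int & C n}.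
Definition hel (k : fieldType) (C : complex k) n (x : C n) : helt C :=
  existT (fun n => C n) n x.
Definition hdiff (k : fieldType) (C : complex k) (x : helt C) : helt C :=
  hel (cdiff C (tag x) (tagged x)).
Definition hmap (k : fieldType) (C D : complex k) (f : chmap C D) (x : helt C) :
  helt D := hel (f (tag x) (tagged x)).

Section DirectSum.
Variables (k : fieldType) (I : Type) (C : I -> complex k).

Inductive dsum_rel (n : int) :
    lexp k {i : I & C i n} -> lexp k {i : I & C i n} -> Prop :=
| DsumLin i c (u v : C i n) :
    dsum_rel (LVar (existT _ i (c *: u + v)))
      (LAdd (LScale c (LVar (existT _ i u))) (LVar (existT _ i v))).

Definition dsum_obj (n : int) : lmodType k := pmod (@dsum_rel n).

Definition din_fun n i (x : C i n) : dsum_obj n :=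
  pgen (@dsum_rel n) (existT _ i x).

Lemma din_linear n i : linear (@din_fun n i).
Proof. by move=> c u v; have := pgen_rel (DsumLin c u v). Qed.

HB.instance Definition _ n i :=
  GRing.isLinear.Build k (C i n) (dsum_obj n) *:%R (@din_fun n i) (@din_linear n i).

Section Lift.
Variables (n : int) (M : lmodType k) (F : forall i, {linear C i n -> M}).

Lemma dsum_lift_rel e e' : dsum_rel e e' ->
  leval (fun x => F (tag x) (tagged x)) e =
  leval (fun x => F (tag x) (tagged x)) e'.
Proof. by case=> i c u v /=; rewrite linearP. Qed.

Definition dsum_lift : {linear dsum_obj n -> M} := plift dsum_lift_rel.

Lemma dsum_liftE i x : dsum_lift (@din_fun n i x) = F i x.
Proof. exact: plift_gen. Qed.
End Lift.

Lemma dsum_ext n (M : lmodType k) (f g : {linear dsum_obj n -> M}) :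
  (forall i x, f (@din_fun n i x) = g (@din_fun n i x)) -> f =1 g.
Proof. by move=> fg; apply: pmod_ext => -[i x]; apply: fg. Qed.

Definition dsum_diff n : {linear dsum_obj n -> dsum_obj (n - 1)} :=
  dsum_lift (fun i => @din_fun (n - 1) i \o cdiff (C i) n).

Lemma dsum_diffE n i x :
  dsum_diff n (@din_fun n i x) = din_fun (cdiff (C i) n x).
Proof. exact: dsum_liftE. Qed.

Lemma dsum_diffK n (x : dsum_obj n) : dsum_diff (n - 1) (dsum_diff n x) = 0.
Proof.
rewrite -[LHS]/((dsum_diff (n - 1) \o dsum_diff n) x) -[RHS]/((\0 : {linear _ -> _}) x).
apply: dsum_ext => i y; rewrite /= dsum_diffE dsum_diffE cdiffK.
exact: (raddf0 (@din_fun (n - 1 - 1) i)).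
Qed.

Definition dsum : complex k := @Complex k dsum_obj dsum_diff dsum_diffK.

Definition din (i : I) : chmap (C i) dsum :=
  @Chmap k (C i) dsum (fun n => @din_fun n i : {linear _ -> _})
    (fun n x => esym (dsum_diffE x)).

Section ChLift.
Variables (D : complex k) (F : forall i, chmap (C i) D).

Lemma dsum_chlift_diff n (x : dsum n) :
  dsum_lift (fun i => F i (n - 1)) (cdiff dsum n x) =
  cdiff D n (dsum_lift (fun i => F i n) x).
Proof.
set f := dsum_lift _; set g := dsum_lift _.
rewrite -[LHS]/((f \o dsum_diff n) x) -[RHS]/((cdiff D n \o g) x).
by apply: dsum_ext => i y; rewrite /= dsum_diffE !dsum_liftE cmap_diff.
Qed.

Definition dsum_chlift : chmap dsum D :=
  @Chmap k dsum D (fun n => dsum_lift (fun i => F i n)) dsum_chlift_diff.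

Lemma dsum_chliftE i n (x : C i n) : dsum_chlift n (din i n x) = F i n x.
Proof. exact: dsum_liftE. Qed.
End ChLift.

Lemma dsum_chext (D : complex k) (f g : chmap dsum D) :
  (forall i n (x : C i n), f n (din i n x) = g n (din i n x)) ->
  forall n, f n =1 g n.
Proof. by move=> fg n; apply: dsum_ext => i x; apply: fg. Qed.

End DirectSum.

Section DsumMap.
Variables (k : fieldType) (I J : Type) (C : I -> complex k) (D : J -> complex k).
Variables (phi : I -> J) (F : forall i, chmap (C i) (D (phi i))).

Definition dsum_map : chmap (dsum C) (dsum D) :=
  dsum_chlift (fun i => chmap_comp (din D (phi i)) (F i)).

Lemma dsum_mapE i n (x : C i n) :
  dsum_map n (din C i n x) = din D (phi i) n (F i n x).
Proof. exact: dsum_chliftE. Qed.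
End DsumMap.

Section Quotient.
Variables (k : fieldType) (C : complex k) (R : forall n, C n -> Prop).

(* Subcomplexes are closed under the differential: for coinvariants the set [R]
   already is, up to linear span. *)
Inductive gensub : forall n, C n -> Prop :=
| GenIn n (x : C n) : R x -> gensub x
| GenDiff n (x : C n) : gensub x -> gensub (cdiff C n x)
| Gen0 n : gensub (0 : C n)
| GenLin n c (x y : C n) : gensub x -> gensub y -> gensub (c *: x + y).

Inductive quot_rel (n : int) : lexp k (C n) -> lexp k (C n) -> Prop :=
| QuotLin c (u v : C n) :
    quot_rel (LVar (c *: u + v)) (LAdd (LScale c (LVar u)) (LVar v))
| QuotSub (u : C n) : gensub u -> quot_rel (LVar u) LZero.

Definition quot_obj (n : int) : lmodType k := pmod (@quot_rel n).

Definition qpi_fun n (x : C n) : quot_obj n := pgen (@quot_rel n) x.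

Lemma qpi_linear n : linear (@qpi_fun n).
Proof. by move=> c u v; have := pgen_rel (QuotLin c u v). Qed.

HB.instance Definition _ n :=
  GRing.isLinear.Build k (C n) (quot_obj n) *:%R (@qpi_fun n) (@qpi_linear n).

Lemma qpi_sub n (x : C n) : gensub x -> qpi_fun x = 0.
Proof. by move=> Rx; have := pgen_rel (QuotSub Rx). Qed.

Section Lift.
Variables (n : int) (M : lmodType k) (F : {linear C n -> M}).
Hypothesis FR : forall x, gensub x -> F x = 0.

Lemma quot_lift_rel e e' : quot_rel e e' -> leval F e = leval F e'.
Proof. by case=> [c u v|u /FR] //=; rewrite linearP. Qed.

Definition quot_lift : {linear quot_obj n -> M} := plift quot_lift_rel.

Lemma quot_liftE x : quot_lift (qpi_fun x) = F x.
Proof. exact: plift_gen. Qed.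
End Lift.

Lemma quot_ext n (M : lmodType k) (f g : {linear quot_obj n -> M}) :
  (forall x, f (qpi_fun x) = g (qpi_fun x)) -> f =1 g.
Proof. exact: pmod_ext. Qed.

Lemma quot_diff_sub n (x : C n) :
  gensub x -> (@qpi_fun (n - 1) \o cdiff C n) x = 0.
Proof. by move=> Rx; apply: qpi_sub; apply: GenDiff. Qed.

Definition quot_diff n : {linear quot_obj n -> quot_obj (n - 1)} :=
  quot_lift (@quot_diff_sub n).

Lemma quot_diffE n (x : C n) : quot_diff n (qpi_fun x) = qpi_fun (cdiff C n x).
Proof. exact: quot_liftE. Qed.

Lemma quot_diffK n (x : quot_obj n) : quot_diff (n - 1) (quot_diff n x) = 0.
Proof.
rewrite -[LHS]/((quot_diff (n - 1) \o quot_diff n) x) -[RHS]/((\0 : {linear _ -> _}) x).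
apply: quot_ext => y; rewrite /= !quot_diffE cdiffK.
exact: (raddf0 (@qpi_fun (n - 1 - 1))).
Qed.

Definition qcomplex : complex k := @Complex k quot_obj quot_diff quot_diffK.

Definition qpi : chmap C qcomplex :=
  @Chmap k C qcomplex (fun n => @qpi_fun n : {linear _ -> _})
    (fun n x => esym (quot_diffE x)).

Lemma qpi_rel n (x : C n) : R x -> qpi n x = 0.
Proof. by move=> Rx; apply/qpi_sub/GenIn. Qed.

Section ChLift.
Variables (D : complex k) (F : chmap C D).
Hypothesis FR : forall n (x : C n), R x -> F n x = 0.

Lemma quot_chlift_sub n (x : C n) : gensub x -> F n x = 0.
Proof.
elim=> {n x} [n x|n x _ IHx|n|n c x y _ IHx _ IHy]; first exact: FR.
- by rewrite cmap_diff IHx raddf0.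
- by rewrite raddf0.
- by rewrite linearP IHx IHy scaler0 addr0.
Qed.

Lemma quot_chlift_diff n (x : qcomplex n) :
  quot_lift (@quot_chlift_sub (n - 1)) (cdiff qcomplex n x) =
  cdiff D n (quot_lift (@quot_chlift_sub n) x).
Proof.
set f := quot_lift _; set g := quot_lift _.
rewrite -[LHS]/((f \o quot_diff n) x) -[RHS]/((cdiff D n \o g) x).
by apply: quot_ext => y; rewrite /= quot_diffE !quot_liftE cmap_diff.
Qed.

Definition quot_chlift : chmap qcomplex D :=
  @Chmap k qcomplex D (fun n => quot_lift (@quot_chlift_sub n)) quot_chlift_diff.

Lemma quot_chliftE n (x : C n) : quot_chlift n (qpi n x) = F n x.
Proof. exact: quot_liftE. Qed.
End ChLift.

Lemma quot_chext (D : complex k) (f g : chmap qcomplex D) :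
  (forall n (x : C n), f n (qpi n x) = g n (qpi n x)) -> forall n, f n =1 g n.
Proof. by move=> fg n; apply: quot_ext => x; apply: fg. Qed.

End Quotient.

Section QuotMap.
Variables (k : fieldType) (C D : complex k).
Variables (R : forall n, C n -> Prop) (S : forall n, D n -> Prop) (F : chmap C D).
Hypothesis FRS : forall n (x : C n), R x -> qpi S n (F n x) = 0.

Definition quot_map : chmap (qcomplex R) (qcomplex S) :=
  quot_chlift (F := chmap_comp (qpi S) F) FRS.

Lemma quot_mapE n (x : C n) : quot_map n (qpi R n x) = qpi S n (F n x).
Proof. exact: quot_chliftE. Qed.
End QuotMap.

Record bij (S T : Type) := Bij {
  bfun :> S -> T;
  binv : T -> S;
  bfunK : cancel bfun binv;
  binvK : cancel binv bfun }.

Lemma bij_ext (S T : Type) (f g : bij S T) : f =1 g -> f = g.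
Proof.
move=> fg; have ef : bfun f = bfun g by apply/funext.
have eg : binv f = binv g.
  by apply/funext => y; apply: (can_inj (bfunK f)); rewrite binvK fg binvK.
case: f g ef eg {fg} => [f f' fK f'K] [g g' gK g'K] /= ef eg.
by subst g g'; congr Bij; apply: Prop_irrelevance.
Qed.

Definition bij_id (S : Type) : bij S S :=
  @Bij S S id id (fun x => erefl) (fun x => erefl).
Definition bij_inv (S T : Type) (f : bij S T) : bij T S :=
  Bij (binvK f) (bfunK f).
Definition bij_comp (S T U : Type) (g : bij T U) (f : bij S T) : bij S U :=
  Bij (can_comp (bfunK g) (bfunK f)) (can_comp (binvK f) (binvK g)).

Record enumeration (A : eqType) := Enumeration {
  eseq :> seq A;
  euniq : uniq eseq;
  efull : forall a, a \in eseq }.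

Section EnumMap.
Variables (A B : eqType) (e : bij A B) (o : enumeration A).

Lemma enum_map_uniq : uniq [seq e a | a <- o].
Proof. by rewrite map_inj_uniq ?euniq //; apply: can_inj (bfunK e). Qed.

Lemma enum_map_full b : b \in [seq e a | a <- o].
Proof. by rewrite -[b](binvK e); apply/map_f/efull. Qed.

Definition enum_map : enumeration B := Enumeration enum_map_uniq enum_map_full.
End EnumMap.

Lemma enumeration_eq (A : eqType) (o o' : enumeration A) :
  eseq o = eseq o' -> o = o'.
Proof.
case: o o' => [s us fs] [s' us' fs'] /= e; subst s'.
by congr Enumeration; apply: Prop_irrelevance.
Qed.

Section Tensor.
Variables (k : fieldType) (A : eqType) (o : enumeration A) (C : A -> complex k).

(* Pure tensors of homogeneous elements, the factors being taken in the order
   given by [o]. *)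
Definition tsym : Type := forall a, helt (C a).
Implicit Types x : tsym.

Definition tset x a (w : helt (C a)) : tsym := dfwith (T := fun a => helt (C a)) x w.

Definition tdeg x : int := \sum_(a <- o) tag (x a).

(* The degree [n] part: pure tensors of another total degree are set to 0. *)
Inductive tens_rel (n : int) : lexp k tsym -> lexp k tsym -> Prop :=
| TensLin x a i c (u v : C a i) :
    tens_rel n (LVar (tset x (hel (c *: u + v))))
      (LAdd (LScale c (LVar (tset x (hel u)))) (LVar (tset x (hel v))))
| TensDeg x : tdeg x <> n -> tens_rel n (LVar x) LZero.

Definition tens_obj (n : int) : lmodType k := pmod (tens_rel n).

Definition tgen n x : tens_obj n := pgen (tens_rel n) x.

Definition tsgn x a : k :=
  (-1) ^ (\sum_(b <- o | (index b o < index a o)%N) tag (x b)).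

Lemma tset_in x a w : @tset x a w a = w.
Proof. exact: dfwith_in. Qed.

Lemma tset_out x a w b : a != b -> @tset x a w b = x b.
Proof. exact: dfwith_out. Qed.

Lemma tset2 x a w w' : @tset (@tset x a w) a w' = tset x w'.
Proof.
apply: functional_extensionality_dep => b.
by have [<-|ab] := eqVneq a b; rewrite ?tset_in ?tset_out.
Qed.

Lemma tsetC x a b w w' : a != b ->
  @tset (@tset x a w) b w' = @tset (@tset x b w') a w.
Proof.
move=> ab; apply: functional_extensionality_dep => c.
have [<-|bc] := eqVneq b c; first by rewrite tset_in tset_out // tset_in.
by rewrite (tset_out _ _ bc); have [<-|ac] := eqVneq a c;
  rewrite ?tset_in // !tset_out.
Qed.

Lemma tgen_lin n x a i c (u v : C a i) :
  tgen n (tset x (hel (c *: u + v))) =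
  c *: tgen n (tset x (hel u)) + tgen n (tset x (hel v)).
Proof. by have := pgen_rel (TensLin n x c u v). Qed.

Lemma tgen_set0 n x a i : tgen n (tset x (hel (0 : C a i))) = 0.
Proof.
have := tgen_lin n x 1 (0 : C a i) 0; rewrite !scale1r addr0.
by move/eqP; rewrite -subr_eq0 opprD addNKr oppr_eq0 => /eqP.
Qed.

Lemma tgen_deg n x : tdeg x <> n -> tgen n x = 0.
Proof. by move=> xn; have := pgen_rel (TensDeg xn). Qed.

Lemma tdeg_set x a (w : helt (C a)) : tdeg (tset x w) = tdeg x - tag (x a) + tag w.
Proof.
rewrite /tdeg !(bigD1_seq a) ?efull ?euniq //= tset_in.
rewrite [X in _ + X](eq_bigr (fun b => tag (x b))) => [|b ba].
  by rewrite addrC [X in X - _]addrC addrK.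
by rewrite tset_out // eq_sym.
Qed.

Section Lift.
Variables (n : int) (M : lmodType k) (F : tsym -> M).
Hypothesis F_lin : forall x a i c (u v : C a i),
  F (tset x (hel (c *: u + v))) = c *: F (tset x (hel u)) + F (tset x (hel v)).
Hypothesis F_deg : forall x, tdeg x <> n -> F x = 0.

Lemma tens_lift_rel e e' : tens_rel n e e' -> leval F e = leval F e'.
Proof. by case=> [x a i c u v|x /F_deg] //=; apply: F_lin. Qed.

Definition tens_lift : {linear tens_obj n -> M} := plift tens_lift_rel.

Lemma tens_liftE x : tens_lift (tgen n x) = F x.
Proof. exact: plift_gen. Qed.
End Lift.

Lemma tens_ext n (M : lmodType k) (f g : {linear tens_obj n -> M}) :
  (forall x, f (tgen n x) = g (tgen n x)) -> f =1 g.
Proof. exact: pmod_ext. Qed.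

Definition tdiff_fun n x : tens_obj (n - 1) :=
  \sum_(a <- o) tsgn x a *: tgen (n - 1) (tset x (hdiff (x a))).

Lemma tsgn_set x a (w : helt (C a)) b :
  tag w = tag (x a) -> tsgn (tset x w) b = tsgn x b.
Proof.
move=> wx; congr (_ ^ _); apply: eq_bigr => c _.
by have [<-|ac] := eqVneq a c; rewrite ?tset_in ?tset_out.
Qed.

Lemma tdiff_lin n x a i c (u v : C a i) :
  tdiff_fun n (tset x (hel (c *: u + v))) =
  c *: tdiff_fun n (tset x (hel u)) + tdiff_fun n (tset x (hel v)).
Proof.
rewrite /tdiff_fun scaler_sumr -big_split /=; apply: eq_bigr => b _.
have sg (w : C a i) : tsgn (tset x (hel w)) b = tsgn (tset x (hel u)) b.
  by rewrite -(tset2 x (hel u) (hel w)) tsgn_set // tset_in.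
rewrite (sg (c *: u + v)) (sg v) scalerA [c * _]mulrC -scalerA -scalerDr.
congr (_ *: _); have [<-|ab] := eqVneq a b.
  by rewrite !tset_in !tset2 /hdiff /= linearP tgen_lin.
by rewrite !(tset_out _ _ ab) !(tsetC _ _ _ ab) tgen_lin.
Qed.

Lemma tdiff_deg n x : tdeg x <> n -> tdiff_fun n x = 0.
Proof.
move=> xn; apply: big1 => a _; rewrite tgen_deg ?scaler0 // tdeg_set /=.
by rewrite addrA subrK => /addIr.
Qed.

Definition tdiff n : {linear tens_obj n -> tens_obj (n - 1)} :=
  tens_lift (@tdiff_lin n) (@tdiff_deg n).

Lemma tdiffE n x : tdiff n (tgen n x) = tdiff_fun n x.
Proof. exact: tens_liftE. Qed.

Lemma signX_neq0 (i : int) : (-1 : k) ^ i != 0.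
Proof. by rewrite expfz_neq0 // oppr_eq0 oner_eq0. Qed.

Lemma tsgn_diff_lt x a b : (index a o < index b o)%N ->
  tsgn (tset x (hdiff (x a))) b = - tsgn x b.
Proof.
move=> ab; rewrite /tsgn.
rewrite [in LHS]big_mkcond [in RHS]big_mkcond !(bigD1_seq a) ?efull ?euniq //=.
rewrite ab tset_in /=.
rewrite [X in _ + X](eq_bigr (fun c =>
    if (index c o < index b o)%N then tag (x c) else 0)) => [|c ca].
  rewrite -addrA [-1 + _]addrC addrA expfzDr ?oppr_eq0 ?oner_eq0 //.
  by rewrite exprN1 invrN1 mulrN1.
by case: ifP => // _; rewrite tset_out // eq_sym.
Qed.

Lemma tsgn_diff_ge x a b : (index b o <= index a o)%N ->
  tsgn (tset x (hdiff (x a))) b = tsgn x b.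
Proof.
move=> ba; congr (_ ^ _); apply: eq_bigr => c cb.
rewrite tset_out //; apply: contraTneq cb => <-; by rewrite -leqNgt.
Qed.

Lemma tdiffK n (x : tens_obj n) : tdiff (n - 1) (tdiff n x) = 0.
Proof.
rewrite -[LHS]/((tdiff (n - 1) \o tdiff n) x) -[RHS]/((\0 : {linear _ -> _}) x).
apply: tens_ext => {}x; rewrite /= tdiffE linear_sum /=.
pose F a b := tsgn x a *: (tsgn (tset x (hdiff (x a))) b *:
  tgen (n - 1 - 1) (tset (tset x (hdiff (x a))) (hdiff (tset x (hdiff (x a)) b)))).
rewrite (eq_bigr (fun a => \sum_(b <- o) F a b)) => [|a _]; last first.
  by rewrite linearZ /= tdiffE scaler_sumr.
have Faa a : F a a = 0.
  rewrite /F tset_in tset2 /hdiff /= cdiffK.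
  by rewrite (tgen_set0 _ _ _ (tag (x a) - 1 - 1)) !scaler0.
have Fab a b : (index a o < index b o)%N -> F a b = - F b a.
  move=> ab; have nab : a != b by apply: contraTneq ab => ->; rewrite ltnn.
  rewrite /F tsgn_diff_lt // tsgn_diff_ge ?(ltnW ab) //.
  rewrite !tset_out // 1?eq_sym // (tsetC _ _ _ nab).
  by rewrite scaleNr scalerN !scalerA mulrC.
rewrite (eq_bigr (fun a => \sum_(b <- o | (index a o < index b o)%N) F a b +
                   \sum_(b <- o | (index b o < index a o)%N) F a b)); last first.
  move=> a _; rewrite (bigID (fun b => index a o < index b o)%N) /=; congr (_ + _).
  rewrite (bigID (fun b => b == a)) /= big1 ?add0r => [|b /andP[_ /eqP->]] //.
  rewrite big_seq_cond [RHS]big_seq_cond; apply: eq_bigl => b.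
  rewrite -leqNgt ltn_neqAle; have [bo|] //= := boolP (b \in _).
  rewrite andbC; congr (~~ _ && _); apply/eqP/eqP => [->//|e].
  by rewrite -(nth_index a bo) e nth_index ?efull.
rewrite big_split /=; set s := (X in X + _); rewrite (exchange_big_dep predT) //=.
rewrite -big_split /=.
apply: big1 => a _; rewrite -big_split /=; apply: big1 => b ab.
by rewrite Fab // addNr.
Qed.

Definition tens : complex k := @Complex k tens_obj tdiff tdiffK.

Lemma tens_chext (D : complex k) (f g : chmap tens D) :
  (forall n x, f n (tgen n x) = g n (tgen n x)) -> forall n, f n =1 g n.
Proof. by move=> fg n; apply: tens_ext => x; apply: fg. Qed.

End Tensor.

Section TensMap.
Variables (k : fieldType) (A B : eqType) (oA : enumeration A) (oB : enumeration B).
Variables (C : A -> complex k) (D : B -> complex k) (e : bij B A).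
Hypothesis eo : [seq e b | b <- oB] = oA.
Variable f : forall b, chmap (C (e b)) (D b).

Definition tsym_map (x : tsym C) : tsym D := fun b => hmap (f b) (x (e b)).

Lemma tsym_map_set x b (w : helt (C (e b))) :
  tsym_map (tset x w) = tset (tsym_map x) (hmap (f b) w).
Proof.
apply: functional_extensionality_dep => c.
have [<-|bc] := eqVneq b c; rewrite /tsym_map ?tset_in // !tset_out //.
by apply: contra_neq bc; apply: can_inj (bfunK e) _ _.
Qed.

Lemma big_enum_bij (T : Type) (idx : T) op P (F : A -> T) :
  \big[op/idx]_(a <- oA | P a) F a = \big[op/idx]_(b <- oB | P (e b)) F (e b).
Proof. by rewrite -eo big_map. Qed.

Lemma tdeg_map x : tdeg oB (tsym_map x) = tdeg oA x.
Proof. by rewrite /tdeg big_enum_bij. Qed.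

Lemma index_map_bij b c :
  (index (e b) oA < index (e c) oA)%N = (index b oB < index c oB)%N.
Proof. by rewrite -eo !index_map //; apply: can_inj (bfunK e). Qed.

Lemma tsgn_map x b : tsgn oB (tsym_map x) b = tsgn oA x (e b).
Proof.
rewrite /tsgn big_enum_bij; congr (_ ^ _); apply: eq_bigl => c.
by rewrite index_map_bij.
Qed.

Lemma tens_map_lin n x a i c (u v : C a i) :
  tgen oB n (tsym_map (tset x (hel (c *: u + v)))) =
  c *: tgen oB n (tsym_map (tset x (hel u))) + tgen oB n (tsym_map (tset x (hel v))).
Proof.
move: u v; rewrite -[a](binvK e) => u v.
by rewrite !tsym_map_set /hmap /= linearP tgen_lin.
Qed.

Lemma tens_map_deg n x : tdeg oA x <> n -> tgen oB n (tsym_map x) = 0.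
Proof. by move=> xn; apply: tgen_deg; rewrite tdeg_map. Qed.

Definition tens_map_n n : {linear tens oA C n -> tens oB D n} :=
  tens_lift (@tens_map_lin n) (@tens_map_deg n).

Lemma tens_map_nE n x : tens_map_n n (tgen oA n x) = tgen oB n (tsym_map x).
Proof. exact: tens_liftE. Qed.

Lemma hmap_diff (E F : complex k) (g : chmap E F) (w : helt E) :
  hmap g (hdiff w) = hdiff (hmap g w).
Proof. by rewrite /hmap /hdiff /= cmap_diff. Qed.

Lemma tens_map_diff n (x : tens oA C n) :
  tens_map_n (n - 1) (cdiff (tens oA C) n x) = cdiff (tens oB D) n (tens_map_n n x).
Proof.
rewrite -[LHS]/((tens_map_n (n - 1) \o tdiff oA C n) x).
rewrite -[RHS]/((tdiff oB D n \o tens_map_n n) x).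
apply: tens_ext => {}x; rewrite /= tens_map_nE !tdiffE linear_sum /=.
rewrite /tdiff_fun big_enum_bij; apply: eq_bigr => b _.
by rewrite linearZ /= tens_map_nE tsym_map_set tsgn_map hmap_diff.
Qed.

Definition tens_map : chmap (tens oA C) (tens oB D) :=
  @Chmap k (tens oA C) (tens oB D) tens_map_n tens_map_diff.

Lemma tens_mapE n x : tens_map n (tgen oA n x) = tgen oB n (tsym_map x).
Proof. exact: tens_map_nE. Qed.

End TensMap.

(* The Koszul sign relating the orders [o] and [o'] of the factors of [x]. *)
Definition koszul (k : fieldType) (A : eqType) (o o' : enumeration A)
    (C : A -> complex k) (x : tsym C) : k :=
  \prod_(a <- o) \prod_(b <- o | (index a o < index b o)%N
                               && (index b o' < index a o')%N)
     (-1) ^ (tag (x a) * tag (x b)).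

Section UnorderedTensor.
Variables (k : fieldType) (A : eqType) (C : A -> complex k).

Definition otens : complex k := dsum (fun o : enumeration A => tens o C).

Definition ogen (o : enumeration A) n (x : tsym C) : otens n :=
  din (fun o => tens o C) o n (tgen o n x).

Inductive utens_rel (n : int) : otens n -> Prop :=
| UtensSwap (o o' : enumeration A) (x : tsym C) :
    utens_rel (ogen o n x - koszul o o' x *: ogen o' n x).

Definition utens : complex k := qcomplex utens_rel.

Definition ugen (o : enumeration A) n (x : tsym C) : utens n :=
  qpi utens_rel n (ogen o n x).

Lemma ugen_swap (o o' : enumeration A) n (x : tsym C) :
  ugen o n x = koszul o o' x *: ugen o' n x.
Proof.
by apply/eqP; rewrite -subr_eq0 -linearZ -raddfB; apply/eqP/qpi_rel.
Qed.

Lemma utens_chext (D : complex k) (f g : chmap utens D) :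
  (forall o n x, f n (ugen o n x) = g n (ugen o n x)) -> forall n, f n =1 g n.
Proof.
move=> fg; apply: quot_chext => n x.
apply: (dsum_chext (f := chmap_comp f (qpi _)) (g := chmap_comp g (qpi _))).
move=> o {}n {}x.
apply: (tens_chext (f := chmap_comp (chmap_comp f (qpi _)) (din _ o))
                   (g := chmap_comp (chmap_comp g (qpi _)) (din _ o))).
by move=> {}n {}x; apply: fg.
Qed.

End UnorderedTensor.

Section UtensMap.
Variables (k : fieldType) (A B : eqType) (C : A -> complex k) (D : B -> complex k).
Variables (e : bij B A) (f : forall b, chmap (C (e b)) (D b)).

Definition enum_pull (o : enumeration A) : enumeration B := enum_map (bij_inv e) o.

Lemma enum_pullK (o : enumeration A) : [seq e b | b <- enum_pull o] = o.
Proof. by rewrite /= -map_comp (eq_map (binvK e)) map_id. Qed.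

Lemma koszul_map (o o' : enumeration A) (x : tsym C) :
  koszul (enum_pull o) (enum_pull o') (tsym_map f x) = koszul o o' x.
Proof.
rewrite /koszul [RHS](big_enum_bij (enum_pullK o)); apply: eq_bigr => b _.
rewrite [RHS](big_enum_bij (enum_pullK o)); apply: eq_bigl => c.
by rewrite !(index_map_bij (enum_pullK _)).
Qed.

Definition otens_map : chmap (otens C) (otens D) :=
  dsum_map (fun o => tens_map (enum_pullK o) f).

Lemma otens_mapE o n x :
  otens_map n (ogen o n x) = ogen (enum_pull o) n (tsym_map f x).
Proof. by rewrite /otens_map dsum_mapE tens_mapE. Qed.

Lemma utens_map_sub n (x : otens C n) :
  utens_rel x -> qpi (@utens_rel _ _ D) n (otens_map n x) = 0.
Proof.
case=> o o' {}x; rewrite linearB /= linearZ /= !otens_mapE -(koszul_map o o').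
exact: (@qpi_rel _ _ (@utens_rel _ _ D) _ _ (UtensSwap n _ _ (tsym_map f x))).
Qed.

Definition utens_map : chmap (utens C) (utens D) := quot_map utens_map_sub.

Lemma utens_mapE o n x :
  utens_map n (ugen o n x) = ugen (enum_pull o) n (tsym_map f x).
Proof. by rewrite /utens_map quot_mapE otens_mapE. Qed.

End UtensMap.

Section Kset.
Variables (k : fieldType) (X : finType).

(* k[X], concentrated in degree 0. *)
Definition kset_obj (n : int) : lmodType k := {ffun {x : X | n == 0} -> k^o}.

Definition kset : complex k :=
  @Complex k kset_obj (fun n => \0 : {linear kset_obj n -> kset_obj (n - 1)})
    (fun n x => erefl).

Definition kdelta (x : X) : helt kset :=
  hel ([ffun y => (val y == x)%:R] : kset 0).

End Kset.

Section KsetMap.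
Variables (k : fieldType) (X : finType) (f : bij X X).

Definition kset_map_fun n (v : kset k X n) : kset k X n :=
  [ffun y => v (exist _ (binv f (val y)) (valP y))].

Lemma kset_map_linear n : linear (@kset_map_fun n).
Proof. by move=> c u v; apply/ffunP => y; rewrite !ffunE. Qed.

HB.instance Definition _ n :=
  GRing.isLinear.Build k (kset k X n) (kset k X n) *:%R (@kset_map_fun n)
    (@kset_map_linear n).

Lemma kset_map_diff n (v : kset k X n) :
  kset_map_fun (cdiff (kset k X) n v) = cdiff (kset k X) n (kset_map_fun v).
Proof. by apply/ffunP => y; rewrite !ffunE. Qed.

Definition kset_map : chmap (kset k X) (kset k X) :=
  @Chmap k _ _ (fun n => @kset_map_fun n : {linear _ -> _}) kset_map_diff.

Lemma kset_mapE x : hmap kset_map (kdelta k x) = kdelta k (f x).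
Proof.
congr hel; apply/ffunP => y; rewrite !ffunE /=.
by rewrite (can2_eq (binvK f) (bfunK f)).
Qed.

End KsetMap.

(* Functors Fin x Fin^op -> Ch_k: [bmap] is contravariant in its second
   argument. *)
Record bimodule (k : fieldType) := Bimodule {
  bobj :> finType -> finType -> complex k;
  bmap : forall S S' E E' : finType, bij S S' -> bij E' E ->
    chmap (bobj S E) (bobj S' E');
  bmap_id : forall (S E : finType) n (x : bobj S E n),
    bmap (bij_id S) (bij_id E) n x = x;
  bmap_comp : forall (S S' S'' E E' E'' : finType) (f : bij S S') (f' : bij S' S'')
      (g : bij E' E) (g' : bij E'' E') n (x : bobj S E n),
    bmap (bij_comp f' f) (bij_comp g g') n x = bmap f' g' n (bmap f g n x) }.

Definition reduced (k : fieldType) (P : bimodule k) : Prop :=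
  forall S E : finType, #|S| = 0%N \/ #|E| = 0%N -> forall n (x : P S E n), x = 0.

Definition sub (S : finType) (I : {set S}) : finType := {x : S | x \in I}.

(* The family [(f a)] indexed by the [a] in [A] is a partition of [T] into
   non-empty sets. *)
Definition ipartition (J T : finType) (A : {set J}) (f : J -> {set T}) : bool :=
  [&& [forall a in A, f a != set0],
      [forall a in A, forall b in A, (a != b) ==> [disjoint f a & f b]]
    & \bigcup_(a in A) f a == setT].

Definition refines (T : finType) (K J : {set {set T}}) : bool :=
  [forall b in K, [exists c in J, b \subset c]].

Definition common_coarsening (T : finType) (K1 K2 J : {set {set T}}) : bool :=
  [&& partition J setT, refines K1 J & refines K2 J].

(* [J] is the finest common coarsening of [K1] and [K2]. *)
Definition is_join (T : finType) (K1 K2 J : {set {set T}}) : bool :=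
  common_coarsening K1 K2 J
  && [forall J' : {set {set T}}, common_coarsening K1 K2 J' ==> refines J J'].

Section SetBij.
Variables (S T : finType) (f : bij S T).

Lemma imset_bijK (I : {set S}) : binv f @: (f @: I) = I.
Proof. by rewrite -imset_comp (eq_imset _ (bfunK f)) imset_id. Qed.

Lemma imset_bijVK (I : {set T}) : f @: (binv f @: I) = I.
Proof. by rewrite -imset_comp (eq_imset _ (binvK f)) imset_id. Qed.

Definition setbij : bij {set S} {set T} :=
  @Bij {set S} {set T} (fun I => f @: I) (fun I => binv f @: I)
    imset_bijK imset_bijVK.

Lemma bij_inj : injective f. Proof. exact: can_inj (bfunK f). Qed.

Section Restrict.
Variables (I : {set S}) (J : {set T}).
Hypothesis fIJ : f @: I = J.

Lemma restr_in (x : sub I) : f (val x) \in J.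
Proof. by rewrite -fIJ imset_f ?(valP x). Qed.

Lemma restr_inv_in (y : sub J) : binv f (val y) \in I.
Proof. by rewrite -(mem_imset _ _ bij_inj) binvK fIJ (valP y). Qed.

Definition restr_fun (x : sub I) : sub J := exist _ (f (val x)) (restr_in x).
Definition restr_inv (y : sub J) : sub I :=
  exist _ (binv f (val y)) (restr_inv_in y).

Lemma restr_funK : cancel restr_fun restr_inv.
Proof. by move=> x; apply: val_inj; rewrite /= bfunK. Qed.

Lemma restr_invK : cancel restr_inv restr_fun.
Proof. by move=> x; apply: val_inj; rewrite /= binvK. Qed.

(* The bijection from [I] onto [J] induced by [f]. *)
Definition restr : bij (sub I) (sub J) := Bij restr_funK restr_invK.
End Restrict.

End SetBij.

Section PairBij.
Variables (S S' T T' : Type) (f : bij S S') (g : bij T T').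

Lemma pair_bijK : cancel (fun a : S * T => (f a.1, g a.2))
                         (fun b : S' * T' => (binv f b.1, binv g b.2)).
Proof. by case=> a b; rewrite /= !bfunK. Qed.

Lemma pair_bijVK : cancel (fun b : S' * T' => (binv f b.1, binv g b.2))
                          (fun a : S * T => (f a.1, g a.2)).
Proof. by case=> a b; rewrite /= !binvK. Qed.

Definition pair_bij : bij (S * T) (S' * T') := Bij pair_bijK pair_bijVK.

Definition sum_fun (a : S + T) : S' + T' :=
  match a with inl x => inl (f x) | inr y => inr (g y) end.
Definition sum_inv (b : S' + T') : S + T :=
  match b with inl x => inl (binv f x) | inr y => inr (binv g y) end.

Lemma sum_bijK : cancel sum_fun sum_inv.
Proof. by case=> a; rewrite /= bfunK. Qed.

Lemma sum_bijVK : cancel sum_inv sum_fun.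
Proof. by case=> a; rewrite /= binvK. Qed.

Definition sum_bij : bij (S + T) (S' + T') := Bij sum_bijK sum_bijVK.
End PairBij.

Definition bij_perm (T : finType) (s : {perm T}) : bij T T :=
  Bij (permK s) (permKV s).

Section PartitionTransport.
Variables (T T' : finType) (h : bij T T').
Let H := setbij h.

Lemma ipartition_bij (J J' : finType) (A : {set J}) (e : bij J J')
    (f : J -> {set T}) (f' : J' -> {set T'}) :
    (forall a, f' (e a) = h @: f a) ->
  ipartition A f -> ipartition (e @: A) f'.
Proof.
move=> ef /and3P[/forall_inP f0 /forall_inP fd /eqP fT]; apply/and3P; split.
- apply/forall_inP => _ /imsetP[a aA ->]; rewrite ef.
  by apply: contra_neq (f0 a aA) => /eqP; rewrite imset_eq0 => /eqP.
- apply/forall_inP => _ /imsetP[a aA ->].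
  apply/forall_inP => _ /imsetP[b bA ->]; apply/implyP => ab.
  have {}ab : a != b by apply: contra_neq ab => ->.
  have := fd a aA => /forall_inP/(_ b bA)/implyP/(_ ab).
  by rewrite !ef -!setI_eq0 -(imsetI (in2W (bij_inj (f := h)))) imset_eq0.
- apply/eqP/setP => y; rewrite in_setT; apply/bigcupP.
  have : binv h y \in \bigcup_(a in A) f a by rewrite fT in_setT.
  case/bigcupP => a aA ya; exists (e a); first exact: imset_f.
  by rewrite ef -[y](binvK h) imset_f.
Qed.

Lemma refines_bij (K J : {set {set T}}) : refines K J -> refines (H @: K) (H @: J).
Proof.
move=> /forall_inP r; apply/forall_inP => _ /imsetP[b bK ->].
have /exists_inP[c cJ bc] := r b bK.
by apply/exists_inP; exists (H c); rewrite ?imset_f //= imsetS.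
Qed.

Lemma partition_bij (J : {set {set T}}) :
  partition J setT -> partition (H @: J) setT.
Proof.
case/and3P => /eqP cJ /trivIsetP tJ J0; apply/and3P; split.
- apply/eqP/setP => y; rewrite in_setT; apply/bigcupP.
  have : binv h y \in cover J by rewrite cJ in_setT.
  case/bigcupP => a aA ya; exists (H a); first exact: imset_f.
  by rewrite /= -[y](binvK h) imset_f.
- apply/trivIsetP => _ _ /imsetP[a aJ ->] /imsetP[b bJ ->] ab.
  have {}ab : a != b by apply: contra_neq ab => ->.
  have := tJ a b aJ bJ ab.
  by rewrite /= -!setI_eq0 -(imsetI (in2W (bij_inj (f := h)))) imset_eq0.
- apply: contra J0 => /imsetP[a aJ] /esym/eqP; rewrite /= imset_eq0 => /eqP a0.
  by rewrite -a0.
Qed.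

Lemma common_coarsening_bij (K1 K2 J : {set {set T}}) :
  common_coarsening K1 K2 J -> common_coarsening (H @: K1) (H @: K2) (H @: J).
Proof.
by case/and3P=> J1 J2 J3; rewrite /common_coarsening partition_bij ?refines_bij.
Qed.

End PartitionTransport.

Lemma is_join_bij (T T' : finType) (h : bij T T') (K1 K2 J : {set {set T}}) :
  is_join K1 K2 J ->
  is_join (setbij h @: K1) (setbij h @: K2) (setbij h @: J).
Proof.
case/andP=> cJ /forallP mJ; apply/andP; split; first exact: common_coarsening_bij.
apply/forallP => J'; apply/implyP => cJ'.
have VK (K : {set {set T}}) : setbij (bij_inv h) @: (setbij h @: K) = K.
  by rewrite -imset_comp (eq_imset _ (bfunK (setbij h))) imset_id.
have KV : setbij h @: (setbij (bij_inv h) @: J') = J'.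
  by rewrite -imset_comp (eq_imset _ (binvK (setbij h))) imset_id.
rewrite -KV; apply: refines_bij; apply: implyP (mJ _) _.
by have := common_coarsening_bij (bij_inv h) cJ'; rewrite !VK.
Qed.

Section Families.
Variables S X E : finType.

Definition pairs : predArgType :=
  ({set {set S} * {set X}} * {set {set X} * {set E}})%type.

(* [F.1] is the family of the (I_a, K'_a), and [F.2] that of the (K''_b, J_b).
   As the blocks are non-empty and disjoint, unordered families of pairs are
   sets of pairs. *)
Definition connected_family (F : pairs) : bool :=
  [&& ipartition F.1 fst, ipartition F.1 snd, ipartition F.2 fst,
      ipartition F.2 snd &
      is_join [set a.2 | a in F.1] [set b.1 | b in F.2] [set setT]].

Definition cfamily : Type := {F : pairs | connected_family F}.

Definition label (F : cfamily) : finType := (sub (val F).1 + sub (val F).2)%type.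

Definition lval (F : cfamily) (a : label F) :
  ({set S} * {set X}) + ({set X} * {set E}) :=
  match a with inl a => inl (val a) | inr b => inr (val b) end.

Lemma lval_inj F : injective (@lval F).
Proof. by move=> [a|a] [b|b] //= [] /val_inj ->. Qed.

End Families.

Section FamilyMap.
Variables (S S' X X' E E' : finType).
Variables (u : bij S S') (h : bij X X') (v : bij E E').

Definition pairsl : bij ({set S} * {set X}) ({set S'} * {set X'}) :=
  pair_bij (setbij u) (setbij h).
Definition pairsr : bij ({set X} * {set E}) ({set X'} * {set E'}) :=
  pair_bij (setbij h) (setbij v).

Definition pairs_map (F : pairs S X E) : pairs S' X' E' :=
  (pairsl @: F.1, pairsr @: F.2).

Lemma pairs_map_connected F : connected_family F -> connected_family (pairs_map F).
Proof.
case/and5P=> p1 p2 p3 p4 p5; apply/and5P; split.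
- exact: ipartition_bij p1.
- exact: ipartition_bij p2.
- exact: ipartition_bij p3.
- exact: ipartition_bij p4.
have := is_join_bij h p5; rewrite imset_set1 -!imset_comp /=.
suff -> : h @: setT = setT by [].
by apply/setP=> y; rewrite in_setT -[y](binvK h) imset_f ?in_setT.
Qed.

Definition family_map (F : cfamily S X E) : cfamily S' X' E' :=
  exist _ (pairs_map (val F)) (pairs_map_connected (valP F)).

Definition label_map (F : cfamily S X E) : bij (label F) (label (family_map F)) :=
  sum_bij (restr (f := pairsl) erefl) (restr (f := pairsr) erefl).

End FamilyMap.

Section Box.
Variables (k : fieldType) (P Q : bimodule k).

Section Factors.
Variables S X E : finType.

Definition factor (F : cfamily S X E) (a : label F) : complex k :=
  match a with
  | inl a => P (sub (val a).1) (sub (val a).2)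
  | inr b => Q (sub (val b).1) (sub (val b).2)
  end.

(* The inner direct sum, for a finite set [X] in place of {1, ..., N}.  The
   tensor product of the P(I_a, K'_a) and of the Q(K''_b, J_b) is a single
   unordered tensor product over all the indices a and b. *)
Definition conn : complex k := dsum (fun F : cfamily S X E => utens (@factor F)).

Definition cgen (F : cfamily S X E) (o : enumeration (label F)) n
    (x : tsym (@factor F)) : conn n :=
  din (fun F : cfamily S X E => utens (@factor F)) F n (ugen o n x).

Lemma conn_chext (D : complex k) (f g : chmap conn D) :
    (forall F o n x, f n (@cgen F o n x) = g n (cgen o n x)) ->
  forall n, f n =1 g n.
Proof.
move=> fg; apply: dsum_chext => F.
apply: (utens_chext (f := chmap_comp f (din _ F)) (g := chmap_comp g (din _ F))).
by move=> o n x; apply: fg.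
Qed.

End Factors.

Section Map.
Variables (S S' X X' E E' : finType).
Variables (u : bij S S') (h : bij X X') (v : bij E E').

Definition factor_map (F : cfamily S X E) (a : label (family_map u h v F)) :
  chmap (factor (bij_inv (label_map u h v F) a)) (factor a) :=
  match a with
  | inl a => bmap P (restr (imset_bijVK u (val a).1))
                    (bij_inv (restr (imset_bijVK h (val a).2)))
  | inr b => bmap Q (restr (imset_bijVK h (val b).1))
                    (bij_inv (restr (imset_bijVK v (val b).2)))
  end.

Definition conn_map : chmap (conn S X E) (conn S' X' E') :=
  dsum_map (fun F => utens_map (@factor_map F)).

Lemma conn_mapE F o n x :
  conn_map n (@cgen S X E F o n x) =
  cgen (enum_pull (bij_inv (label_map u h v F)) o) n (tsym_map (@factor_map F) x).
Proof.
by rewrite /conn_map /cgen dsum_mapE utens_mapE.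
Qed.

End Map.

Lemma hbmap_comp (R : bimodule k) (S S' S'' E E' E'' : finType) (f : bij S S')
    (f' : bij S' S'') (g : bij E' E) (g' : bij E'' E') (w : helt (R S E)) :
  hmap (bmap R f' g') (hmap (bmap R f g) w) =
  hmap (bmap R (bij_comp f' f) (bij_comp g g')) w.
Proof. by rewrite /hmap /= bmap_comp. Qed.

Lemma hbmap_id (R : bimodule k) (S E : finType) (f : bij S S) (g : bij E E)
    (w : helt (R S E)) : f =1 id -> g =1 id -> hmap (bmap R f g) w = w.
Proof.
move=> fi gi; have -> : f = bij_id S by apply: bij_ext.
have -> : g = bij_id E by apply: bij_ext.
by case: w => i w; rewrite /hmap /= bmap_id.
Qed.

(* Two transports of the same factor along bijections inducing the same map on
   the underlying sets agree. *)
Lemma hbmap_eq (R : bimodule k) (S S' X X' : finType) (A : {set {set S} * {set X}})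
    (x : forall a : sub A, helt (R (sub (val a).1) (sub (val a).2)))
    (a b : sub A) (I : {set S'}) (K : {set X'})
    (f : bij (sub (val a).1) (sub I)) (f' : bij (sub (val b).1) (sub I))
    (g : bij (sub K) (sub (val a).2)) (g' : bij (sub K) (sub (val b).2)) :
    val a = val b ->
    (forall y z, val y = val z -> val (f y) = val (f' z)) ->
    (forall y, val (g y) = val (g' y)) ->
  hmap (bmap R f g) (x a) = hmap (bmap R f' g') (x b).
Proof.
move=> /val_inj ab; subst b => ff gg.
have -> : f = f' by apply: bij_ext => y; apply/val_inj/ff.
by have -> : g = g' by apply: bij_ext => y; apply/val_inj/gg.
Qed.

Lemma cgen_eq (S X E : finType) (F F' : cfamily S X E) o o' n
    (x : tsym (@factor S X E F)) (x' : tsym (@factor S X E F')) :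
    val F = val F' ->
    [seq lval a | a <- eseq o] = [seq lval a | a <- eseq o'] ->
    (forall a a' (f : bij (sub (val a).1) (sub (val a').1))
                 (g : bij (sub (val a').2) (sub (val a).2)),
       val a = val a' ->
       (forall y, val (f y) = val y) -> (forall y, val (g y) = val y) ->
       x' (inl a') = hmap (bmap P f g) (x (inl a))) ->
    (forall a a' (f : bij (sub (val a).1) (sub (val a').1))
                 (g : bij (sub (val a').2) (sub (val a).2)),
       val a = val a' ->
       (forall y, val (f y) = val y) -> (forall y, val (g y) = val y) ->
       x' (inr a') = hmap (bmap Q f g) (x (inr a))) ->
  cgen o n x = cgen o' n x'.
Proof.
move=> /val_inj FF; subst F' => /(inj_map (@lval_inj _ _ _ F)) oo xl xr.
have -> : o = o' by apply: enumeration_eq.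
congr cgen; apply: functional_extensionality_dep => -[a|b].
- rewrite (xl a a (bij_id _) (bij_id _)) // hbmap_id //.
- rewrite (xr b b (bij_id _) (bij_id _)) // hbmap_id //.
Qed.

Lemma lval_map (S S' X X' E E' : finType) (u : bij S S') (h : bij X X')
    (v : bij E E') (F : cfamily S X E) (a : label F) :
  lval (label_map u h v F a) = sum_bij (pairsl u h) (pairsr h v) (lval a).
Proof. by case: a. Qed.

Lemma lval_pull (S S' X X' E E' : finType) (u : bij S S') (h : bij X X')
    (v : bij E E') (F : cfamily S X E) (o : enumeration (label F)) :
  [seq lval a | a <- eseq (enum_pull (bij_inv (label_map u h v F)) o)] =
  [seq sum_bij (pairsl u h) (pairsr h v) (lval a) | a <- eseq o].
Proof. by rewrite /= -map_comp; apply: eq_map => a; apply: lval_map. Qed.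

Lemma conn_map_id (S X E : finType) n (x : conn S X E n) :
  conn_map (bij_id S) (bij_id X) (bij_id E) n x = x.
Proof.
move: n x; apply: (conn_chext (g := chmap_id _)) => F o n x; rewrite conn_mapE.
have i1 : pairsl (bij_id S) (bij_id X) =1 id.
  by case=> I K; rewrite /= !imset_id.
have i2 : pairsr (bij_id X) (bij_id E) =1 id.
  by case=> I K; rewrite /= !imset_id.
apply: cgen_eq.
- by rewrite /= /pairs_map /= (eq_imset _ i1) (eq_imset _ i2) !imset_id; case: (sval F).
- rewrite (lval_pull _ _ _ o); apply: eq_map => -[a|a]; rewrite /= !imset_id;
  by case: (val a).
- move=> a a' f g aa' fv gv; rewrite /tsym_map /= hbmap_comp.
  rewrite -[LHS](@hbmap_id P _ _ (bij_id _) (bij_id _)) //.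
  apply: (hbmap_eq (fun a => x (inl a))) => //.
  + by rewrite /= !imset_id -[sval a']/(val a') -aa'; apply: surjective_pairing.
  + by move=> y z yz; apply: (etrans yz);
    exact: (esym (fv (restr (imset_bijVK (bij_id _) _) z))).
  + by move=> y; apply: esym (gv y).
- move=> a a' f g aa' fv gv; rewrite /tsym_map /= hbmap_comp.
  rewrite -[LHS](@hbmap_id Q _ _ (bij_id _) (bij_id _)) //.
  apply: (hbmap_eq (fun a => x (inr a))) => //.
  + by rewrite /= !imset_id -[sval a']/(val a') -aa'; apply: surjective_pairing.
  + by move=> y z yz; apply: (etrans yz);
    exact: (esym (fv (restr (imset_bijVK (bij_id _) _) z))).
  + by move=> y; apply: esym (gv y).
Qed.

Lemma conn_map_comp (S S' S'' X X' X'' E E' E'' : finType) (u : bij S S')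
    (u' : bij S' S'') (h : bij X X') (h' : bij X' X'') (v : bij E E')
    (v' : bij E' E'') n (x : conn S X E n) :
  conn_map u' h' v' n (conn_map u h v n x) =
  conn_map (bij_comp u' u) (bij_comp h' h) (bij_comp v' v) n x.
Proof.
move: n x; apply: (conn_chext
  (f := chmap_comp (conn_map u' h' v') (conn_map u h v))) => F o n x.
rewrite chmap_compE (conn_mapE u h v) (conn_mapE u' h' v').
rewrite (conn_mapE (bij_comp u' u) (bij_comp h' h) (bij_comp v' v)).
have c1 : pairsl u' h' \o pairsl u h =1 pairsl (bij_comp u' u) (bij_comp h' h).
  by case=> I K; rewrite /= -!imset_comp.
have c2 : pairsr h' v' \o pairsr h v =1 pairsr (bij_comp h' h) (bij_comp v' v).
  by case=> I K; rewrite /= -!imset_comp.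
apply: cgen_eq.
- by rewrite /= /pairs_map /= -!imset_comp (eq_imset _ c1) (eq_imset _ c2).
- rewrite (lval_pull _ _ _ o) lval_pull.
  rewrite (map_comp (sum_bij (pairsl u' h') (pairsr h' v')) (@lval _ _ _ _)).
  rewrite (lval_pull u h v o) -map_comp; apply: eq_map => -[a|a] /=.
    by rewrite -!imset_comp.
  by rewrite -!imset_comp.
- move=> a a' f g aa' fv gv; rewrite /tsym_map /= !hbmap_comp.
  apply: (hbmap_eq (fun a => x (inl a))) => //.
  + by rewrite /= -[sval a']/(val a') -aa' /= -!imset_comp.
  + by move=> y z yz; apply: etrans (esym (fv _));
    apply: (congr1 (fun w => u' (u w)) yz).
  + by move=> y; apply: (congr1 (fun w => binv h (binv h' w)) (esym (gv y))).
- move=> a a' f g aa' fv gv; rewrite /tsym_map /= !hbmap_comp.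
  apply: (hbmap_eq (fun a => x (inr a))) => //.
  + by rewrite /= -[sval a']/(val a') -aa' /= -!imset_comp.
  + by move=> y z yz; apply: etrans (esym (fv _));
    apply: (congr1 (fun w => h' (h w)) yz).
  + by move=> y; apply: (congr1 (fun w => binv v (binv v' w)) (esym (gv y))).
Qed.

End Box.

Definition posnat : Type := {N : nat | (0 < N)%N}.

Section BoxB.
Variables (k : fieldType) (P Q : bimodule k).

Section Coinvariants.
Variables (S : finType) (N : nat) (E : finType).

Inductive coinv_rel (n : int) : conn P Q S 'I_N E n -> Prop :=
| Coinv (s : {perm 'I_N}) x :
    coinv_rel (conn_map P Q (bij_id S) (bij_perm s) (bij_id E) n x - x).

Definition conn_coinv : complex k := qcomplex coinv_rel.
End Coinvariants.

Definition boxb_obj (S E : finType) : complex k :=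
  dsum (fun N : posnat => conn_coinv S (val N) E).

Section Map.
Variables (S S' E E' : finType) (u : bij S S') (v : bij E' E).

Lemma coinv_map_rel N n (x : conn P Q S 'I_N E n) : coinv_rel x ->
  qpi (@coinv_rel S' N E') n
    (conn_map P Q u (bij_id 'I_N) (bij_inv v) n x) = 0.
Proof.
case=> s {}x; rewrite chmapB conn_map_comp.
have -> : bij_comp u (bij_id S) = bij_comp (bij_id S') u by apply: bij_ext.
have -> : bij_comp (bij_id 'I_N) (bij_perm s) = bij_comp (bij_perm s) (bij_id 'I_N).
  by apply: bij_ext.
have -> : bij_comp (bij_inv v) (bij_id E) = bij_comp (bij_id E') (bij_inv v).
  by apply: bij_ext.
rewrite -conn_map_comp; exact: (qpi_rel (Coinv s _)).
Qed.

Definition coinv_map N : chmap (conn_coinv S N E) (conn_coinv S' N E') :=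
  quot_map (@coinv_map_rel N).

Definition boxb_map : chmap (boxb_obj S E) (boxb_obj S' E') :=
  dsum_map (phi := id) (fun N => coinv_map (val N)).

Lemma boxb_mapE (N : posnat) n (x : conn P Q S 'I_(val N) E n) :
  boxb_map n (din _ N n (qpi _ n x)) =
  din _ N n (qpi _ n (conn_map P Q u (bij_id _) (bij_inv v) n x)).
Proof. by rewrite /boxb_map dsum_mapE /coinv_map quot_mapE. Qed.

Lemma boxb_chext (D : complex k) (f g : chmap (boxb_obj S E) D) :
    (forall (N : posnat) n (x : conn P Q S 'I_(val N) E n),
      f n (din _ N n (qpi _ n x)) = g n (din _ N n (qpi _ n x))) ->
  forall n, f n =1 g n.
Proof.
move=> fg; apply: dsum_chext => N.
apply: (quot_chext (f := chmap_comp f (din _ N)) (g := chmap_comp g (din _ N))).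
by move=> n x; apply: fg.
Qed.
End Map.

Lemma boxb_map_id (S E : finType) n (x : boxb_obj S E n) :
  boxb_map (bij_id S) (bij_id E) n x = x.
Proof.
move: n x; apply: (boxb_chext (g := chmap_id _)) => N n x.
rewrite boxb_mapE; have -> : bij_inv (bij_id E) = bij_id E by apply: bij_ext.
by rewrite conn_map_id.
Qed.

Lemma boxb_map_comp (S S' S'' E E' E'' : finType) (f : bij S S') (f' : bij S' S'')
    (g : bij E' E) (g' : bij E'' E') n (x : boxb_obj S E n) :
  boxb_map (bij_comp f' f) (bij_comp g g') n x =
  boxb_map f' g' n (boxb_map f g n x).
Proof.
move: n x; apply: (boxb_chext (g := chmap_comp (boxb_map f' g') (boxb_map f g))).
move=> N n x; rewrite chmap_compE !boxb_mapE conn_map_comp.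
have -> : bij_inv (bij_comp g g') = bij_comp (bij_inv g') (bij_inv g).
  by apply: bij_ext.
by have -> : bij_comp (bij_id 'I_(val N)) (bij_id 'I_(val N)) = bij_id _
  by apply: bij_ext.
Qed.

Definition boxb : bimodule k :=
  @Bimodule k boxb_obj boxb_map boxb_map_id boxb_map_comp.

End BoxB.

(* Composition of permutations as functions; note that [(s * t) x = t (s x)]. *)
Definition pcomp (T : finType) (s t : {perm T}) : {perm T} := (t * s)%g.

Lemma pcompE (T : finType) (s t : {perm T}) x : pcomp s t x = s (t x).
Proof. exact: permM. Qed.

(* [smact s t x] is s.x.t, so that a single axiom gives the left action, the
   right action and their commutation. *)
Record smodule (k : fieldType) (m n : nat) := Smodule {
  smcx :> complex k;
  smact : {perm 'I_m} -> {perm 'I_n} -> chmap smcx smcx;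
  smact1 : forall d (x : smcx d), smact 1%g 1%g d x = x;
  smactM : forall s s' t t' d (x : smcx d),
    smact (pcomp s' s) (pcomp t t') d x = smact s' t' d (smact s t d x) }.
Arguments smact {k m n} _ s t.

Definition smodule_iso (k : fieldType) (m n : nat) (M N : smodule k m n) : Prop :=
  exists f : chmap M N,
    (forall d, bijective (f d)) /\
    (forall s t d (x : M d), f d (smact M s t d x) = smact N s t d (f d x)).

Section Arity.
Variables (k : fieldType) (P : bimodule k) (m n : nat).

Definition arity_act (s : {perm 'I_m}) (t : {perm 'I_n}) :
  chmap (P 'I_m 'I_n) (P 'I_m 'I_n) := bmap P (bij_perm s) (bij_perm t).

Lemma arity_act1 d (x : P 'I_m 'I_n d) : arity_act 1 1 d x = x.
Proof.
rewrite /arity_act; have b1 j : bij_perm (1%g : {perm 'I_j}) = bij_id 'I_j.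
  by apply: bij_ext => i; rewrite /= perm1.
by rewrite !b1 bmap_id.
Qed.

Lemma arity_actM s s' t t' d (x : P 'I_m 'I_n d) :
  arity_act (pcomp s' s) (pcomp t t') d x = arity_act s' t' d (arity_act s t d x).
Proof.
rewrite /arity_act -bmap_comp.
have bM j (a b : {perm 'I_j}) :
    bij_perm (pcomp a b) = bij_comp (bij_perm a) (bij_perm b).
  by apply: bij_ext => i; rewrite /= pcompE.
by rewrite !bM.
Qed.

Definition arity : smodule k m n := Smodule arity_act1 arity_actM.
End Arity.

Section Blocks.
Variables (r N : nat) (l : 'I_r -> nat) (lN : (\sum_(a < r) l a)%N = N).

(* The division of 'I_N into consecutive blocks of sizes l_1, ..., l_r:
   [tagnat.rank] is increasing for the lexicographic order. *)
Definition blk (x : 'I_N) : {a : 'I_r & 'I_(l a)} :=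
  tagnat.sig (cast_ord (esym lN) x).
Definition unblk (p : {a : 'I_r & 'I_(l a)}) : 'I_N :=
  cast_ord lN (tagnat.rank p).

Lemma blkK : cancel blk unblk.
Proof. by move=> x; rewrite /unblk /blk tagnat.sigK cast_ordKV. Qed.

Lemma unblkK : cancel unblk blk.
Proof. by move=> p; rewrite /unblk /blk cast_ordK tagnat.rankK. Qed.

Section BlockPerm.
Variable g : forall a, {perm 'I_(l a)}.

Definition block_fun (x : 'I_N) : 'I_N :=
  unblk (existT (fun a => 'I_(l a)) (tag (blk x)) (g (tag (blk x)) (tagged (blk x)))).

Lemma block_fun_inj : injective block_fun.
Proof.
move=> x y /(can_inj unblkK) e; apply: (can_inj blkK); move: e.
case: (blk x) (blk y) => [a i] [b j] /= e.
have ab := congr1 tag e; rewrite /= in ab; subst b.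
by have /eqP := e; rewrite eq_Tagged /= => /eqP/perm_inj ->.
Qed.

(* The image of (g_1, ..., g_r) in S_l. *)
Definition block_perm : {perm 'I_N} := perm block_fun_inj.
End BlockPerm.
End Blocks.

Section PermuteBlocks.
Variables (r N : nat) (l : 'I_r -> nat) (lN : (\sum_(a < r) l a)%N = N).
Variable tau : {perm 'I_r}.

Lemma sum_permute : (\sum_(a < r) l ((tau^-1)%g a))%N = N.
Proof.
by rewrite -lN [RHS](reindex_inj (h := (tau^-1)%g)) //; apply: perm_inj.
Qed.

Definition unpermute_fun (x : 'I_N) : 'I_N :=
  unblk lN (existT (fun a => 'I_(l a))
    ((tau^-1)%g (tag (blk sum_permute x))) (tagged (blk sum_permute x))).

Lemma unpermute_fun_inj : injective unpermute_fun.
Proof.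
move=> x y /(can_inj (unblkK lN)) e; apply: (can_inj (blkK sum_permute)).
move: e; case: (blk _ x) (blk _ y) => [a i] [b j] /= e.
have /perm_inj ab := congr1 tag e; rewrite /= in ab; subst b.
by have /eqP := e; rewrite eq_Tagged /= => /eqP ->.
Qed.

(* The permutation sending, for each [a], the [a]-th block of [l] increasingly
   to the [tau a]-th block of [l \o tau^-1]. *)
Definition permute_blocks : {perm 'I_N} := (perm unpermute_fun_inj)^-1%g.

Lemma permute_blocksE a (i : 'I_(l ((tau^-1)%g a))) :
  permute_blocks (unblk lN (existT _ ((tau^-1)%g a) i)) =
  unblk sum_permute (existT _ a i).
Proof.
apply: (@perm_inj _ (perm unpermute_fun_inj)); apply: etrans (permKV _ _) _.
rewrite permE /unpermute_fun.
pose F (p : {a : 'I_r & 'I_(l ((tau^-1)%g a))}) :=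
  unblk lN (existT (fun a => 'I_(l a)) ((tau^-1)%g (tag p)) (tagged p)).
exact: (congr1 F (esym (unblkK sum_permute (existT _ a i)))).
Qed.
End PermuteBlocks.

Inductive vslot (r s : nat) : Type :=
| SlotM | SlotP of 'I_r | SlotC | SlotQ of 'I_s | SlotN.
Arguments SlotM {r s}.
Arguments SlotP {r s}.
Arguments SlotC {r s}.
Arguments SlotQ {r s}.
Arguments SlotN {r s}.

HB.instance Definition _ r s := gen_eqMixin (vslot r s).

Section Slots.
Variables r s : nat.

Definition vslot_seq : seq (vslot r s) :=
  SlotM :: [seq SlotP a | a <- enum 'I_r] ++
  SlotC :: [seq SlotQ b | b <- enum 'I_s] ++ [:: SlotN].

Lemma vslot_uniq : uniq vslot_seq.
Proof.
have iP : injective (@SlotP r s) by move=> a b [].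
have iQ : injective (@SlotQ r s) by move=> a b [].
have uP : uniq [seq @SlotP r s a | a <- enum 'I_r] by rewrite map_inj_uniq ?enum_uniq.
have uQ : uniq [seq @SlotQ r s b | b <- enum 'I_s] by rewrite map_inj_uniq ?enum_uniq.
rewrite /vslot_seq cons_uniq cat_uniq cons_uniq cat_uniq uP uQ.
rewrite [has _ (_ :: _)]/= [has _ [:: _]]/= [uniq [:: _]]/= orbF.
rewrite !(mem_cat, inE) !andTb !andbT.
apply/and4P; split.
- apply/negP => /orP[/mapP[]|/orP[/eqP|/orP[/mapP[]|/eqP]]] //.
- rewrite negb_or; apply/andP; split; first by apply/mapP => -[].
  apply/hasPn => x; rewrite mem_cat inE => /orP[/mapP[b _ ->]|/eqP->];
  by apply/mapP => -[].
- by apply/negP => /orP[/mapP[]|/eqP].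
- by apply/mapP => -[].
Qed.

Lemma vslot_full a : a \in vslot_seq.
Proof.
rewrite /vslot_seq !(inE, mem_cat); case: a => [|a||b|]; rewrite ?eqxx ?orbT //.
- by rewrite [X in _ || (X || _)]map_f ?mem_enum ?orbT.
- by rewrite [X in _ || (_ || (_ || (X || _)))]map_f ?mem_enum ?orbT.
Qed.

Definition vslots : enumeration (vslot r s) := Enumeration vslot_uniq vslot_full.

End Slots.

Record vindex (m N n r s : nat) := Vindex {
  vl : 'I_r -> nat;
  vk : 'I_r -> nat;
  vj : 'I_s -> nat;
  vi : 'I_s -> nat;
  vl_gt0 : forall a, (0 < vl a)%N;
  vk_gt0 : forall a, (0 < vk a)%N;
  vj_gt0 : forall b, (0 < vj b)%N;
  vi_gt0 : forall b, (0 < vi b)%N;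
  vl_sum : (\sum_(a < r) vl a)%N = m;
  vk_sum : (\sum_(a < r) vk a)%N = N;
  vj_sum : (\sum_(b < s) vj b)%N = N;
  vi_sum : (\sum_(b < s) vi b)%N = n }.

Section VPermute.
Variables (m N n r s : nat) (d : vindex m N n r s).
Variables (tau : {perm 'I_r}) (ups : {perm 'I_s}).

Definition vpermute : vindex m N n r s :=
  @Vindex m N n r s
    (fun a => vl d ((tau^-1)%g a)) (fun a => vk d ((tau^-1)%g a))
    (fun b => vj d ((ups^-1)%g b)) (fun b => vi d ((ups^-1)%g b))
    (fun a => vl_gt0 d _) (fun a => vk_gt0 d _)
    (fun b => vj_gt0 d _) (fun b => vi_gt0 d _)
    (sum_permute (vl_sum d) tau) (sum_permute (vk_sum d) tau)
    (sum_permute (vj_sum d) ups) (sum_permute (vi_sum d) ups).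
End VPermute.

Section Connected.
Variables (m N n r s : nat) (d : vindex m N n r s).

(* The bipartite graph of [sigma], with vertices the blocks of k (outputs) and
   the blocks of j (inputs). *)
Definition vedge (sigma : {perm 'I_N}) : rel ('I_r + 'I_s) := fun u v =>
  match u, v with
  | inl a, inr b | inr b, inl a =>
      [exists i : 'I_N, (tag (blk (vj_sum d) i) == b)
                     && (tag (blk (vk_sum d) (sigma i)) == a)]
  | _, _ => false
  end.

Definition connected_perm (sigma : {perm 'I_N}) : bool :=
  [forall u, forall v, connect (vedge sigma) u v].

Definition sconn : finType := {sigma : {perm 'I_N} | connected_perm sigma}.
End Connected.

(* The Koszul sign of the passage from x_1, ..., x_r to
   x_(tau^-1 1), ..., x_(tau^-1 r). *)
Definition perm_koszul (k : fieldType) r (C : 'I_r -> complex k)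
    (tau : {perm 'I_r}) (x : forall a, helt (C a)) : k :=
  \prod_(a < r) \prod_(b < r | (a < b)%N && (tau b < tau a)%N)
     (-1) ^ (tag (x a) * tag (x b)).

Section Vallette.
Variables (k : fieldType) (P Q : bimodule k) (m n : nat).

Definition lact (R : bimodule k) (S E : finType) (g : {perm S}) (x : helt (R S E)) :
  helt (R S E) := hmap (bmap R (bij_perm g) (bij_id E)) x.
Definition ract (R : bimodule k) (S E : finType) (x : helt (R S E)) (g : {perm E}) :
  helt (R S E) := hmap (bmap R (bij_id S) (bij_perm g)) x.

Section Index.
Variables (N r s : nat).
Implicit Type d : vindex m N n r s.

Definition vfactor d (a : vslot r s) : complex k :=
  match a with
  | SlotM => kset k {perm 'I_m}
  | SlotP a => P 'I_(vl d a) 'I_(vk d a)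
  | SlotC => kset k (sconn d)
  | SlotQ b => Q 'I_(vj d b) 'I_(vi d b)
  | SlotN => kset k {perm 'I_n}
  end.

(* k[S_m] (x) P(l, k) (x) k[S_c^(k,j)] (x) Q(j, i) (x) k[S_n] is flattened to an
   ordered tensor product of r + s + 3 factors. *)
Definition vtens d : complex k := tens (vslots r s) (vfactor d).

Definition vpure d (theta : {perm 'I_m})
    (p : forall a, helt (P 'I_(vl d a) 'I_(vk d a))) (sigma : sconn d)
    (q : forall b, helt (Q 'I_(vj d b) 'I_(vi d b))) (omega : {perm 'I_n}) :
  tsym (vfactor d) := fun a =>
  match a with
  | SlotM => kdelta k theta
  | SlotP a => p a
  | SlotC => kdelta k sigma
  | SlotQ b => q b
  | SlotN => kdelta k omega
  end.

Definition vgen d D theta p sigma q omega : vtens d D :=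
  tgen (vslots r s) D (vpure theta p sigma q omega).

(* The relations defining the tensor products over the groups S_l, S_k, S_j
   and S_i. *)
Inductive bal_rel d (D : int) : vtens d D -> Prop :=
| BalL (g : forall a, {perm 'I_(vl d a)}) theta p sigma q omega :
    bal_rel (vgen D (pcomp theta (block_perm (vl_sum d) g)) p sigma q omega
             - vgen D theta (fun a => lact (g a) (p a)) sigma q omega)
| BalK (g : forall a, {perm 'I_(vk d a)}) theta p (sigma sigma' : sconn d) q omega :
    val sigma' = pcomp (block_perm (vk_sum d) g) (val sigma) ->
    bal_rel (vgen D theta (fun a => ract (p a) (g a)) sigma q omega
             - vgen D theta p sigma' q omega)
| BalJ (g : forall b, {perm 'I_(vj d b)}) theta p (sigma sigma' : sconn d) q omega :
    val sigma' = pcomp (val sigma) (block_perm (vj_sum d) g) ->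
    bal_rel (vgen D theta p sigma' q omega
             - vgen D theta p sigma (fun b => lact (g b) (q b)) omega)
| BalI (g : forall b, {perm 'I_(vi d b)}) theta p sigma q omega :
    bal_rel (vgen D theta p sigma (fun b => ract (q b) (g b)) omega
             - vgen D theta p sigma q (pcomp (block_perm (vi_sum d) g) omega)).

Definition vbal d : complex k := qcomplex (@bal_rel d).

Definition vsum : complex k := dsum vbal.

Definition vclass d D theta p sigma q omega : vsum D :=
  din vbal d D (qpi (@bal_rel d) D (vgen D theta p sigma q omega)).

(* The identification of an element with its image under (tau, ups) in
   S_r x S_s; [sigma'] is the image of [sigma], and it is connected whenever
   [sigma] is. *)
Inductive vcoinv_rel (D : int) : vsum D -> Prop :=
| Vcoinv d (tau : {perm 'I_r}) (ups : {perm 'I_s}) theta p (sigma : sconn d)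
    (sigma' : sconn (vpermute d tau ups)) q omega :
    val sigma' = pcomp (permute_blocks (vk_sum d) tau)
                   (pcomp (val sigma) (permute_blocks (vj_sum d) ups)^-1%g) ->
    vcoinv_rel
      (vclass D theta p sigma q omega
       - (perm_koszul tau p * perm_koszul ups q) *:
         vclass (d := vpermute d tau ups) D
           (pcomp theta (permute_blocks (vl_sum d) tau)^-1%g)
           (fun a => p ((tau^-1)%g a)) sigma' (fun b => q ((ups^-1)%g b))
           (pcomp (permute_blocks (vi_sum d) ups) omega)).

Definition vcoinv : complex k := qcomplex vcoinv_rel.

End Index.

Definition boxVal_obj : complex k :=
  dsum (fun N : posnat =>
    dsum (fun rs : posnat * posnat => vcoinv (val N) (val rs.1) (val rs.2))).

Lemma vcoinv_chext (D : complex k) (f g : chmap boxVal_obj D) :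
    (forall (N r s : posnat) (d : vindex m (val N) n (val r) (val s)) e
       (x : vtens d e),
      f e (din _ N e (din _ (r, s) e (qpi _ e (din _ d e (qpi _ e x))))) =
      g e (din _ N e (din _ (r, s) e (qpi _ e (din _ d e (qpi _ e x)))))) ->
  forall e, f e =1 g e.
Proof.
move=> fg; apply: dsum_chext => N.
apply: (dsum_chext (f := chmap_comp f (din _ N)) (g := chmap_comp g (din _ N))).
case=> r s; set iN := din _ N; set irs := din _ (r, s).
apply: (quot_chext (f := chmap_comp f (chmap_comp iN irs))
                   (g := chmap_comp g (chmap_comp iN irs))).
set p := qpi _.
apply: (dsum_chext (f := chmap_comp f (chmap_comp iN (chmap_comp irs p)))
                   (g := chmap_comp g (chmap_comp iN (chmap_comp irs p)))).
move=> d; set i := din _ d.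
apply: (quot_chext
  (f := chmap_comp f (chmap_comp iN (chmap_comp irs (chmap_comp p i))))
  (g := chmap_comp g (chmap_comp iN (chmap_comp irs (chmap_comp p i))))).
by move=> e x; apply: fg.
Qed.

Definition lmul_bij (T : finType) (s : {perm T}) : bij {perm T} {perm T} :=
  Bij (fun t => mulgK s t) (fun t => mulgKV s t).
Definition rmul_bij (T : finType) (s : {perm T}) : bij {perm T} {perm T} :=
  Bij (fun t => mulKg s t) (fun t => mulKVg s t).

Section Action.
Variables (s : {perm 'I_m}) (t : {perm 'I_n}).

(* s.theta (x) ... (x) omega.t *)
Definition vslot_act N q r (d : vindex m N n q r) (a : vslot q r) :
    chmap (vfactor d a) (vfactor d a) :=
  match a with
  | SlotM => kset_map k (lmul_bij s)
  | SlotN => kset_map k (rmul_bij t)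
  | a => chmap_id (vfactor d a)
  end.

Definition vtens_act N q r (d : vindex m N n q r) : chmap (vtens d) (vtens d) :=
  tens_map (e := bij_id _) (map_id _) (vslot_act d).

Lemma vtens_actE N q r (d : vindex m N n q r) D theta p sigma x omega :
  vtens_act d D (vgen D theta p sigma x omega) =
  vgen D (pcomp s theta) p sigma x (pcomp omega t).
Proof.
rewrite /vtens_act /vgen tens_mapE; congr tgen.
apply: functional_extensionality_dep => -[|a||b|]; rewrite /tsym_map /=.
- exact: kset_mapE.
- by case: (p a).
- by rewrite /kdelta.
- by case: (x b).
- exact: kset_mapE.
Qed.

Lemma vtens_actB N q r (d : vindex m N n q r) D
    theta p sigma x omega theta' p' sigma' x' omega' :
  vtens_act d D (vgen (d := d) D theta p sigma x omega
                 - vgen D theta' p' sigma' x' omega') =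
  vgen D (pcomp s theta) p sigma x (pcomp omega t)
  - vgen D (pcomp s theta') p' sigma' x' (pcomp omega' t).
Proof. by rewrite (chmapB (vtens_act d)) 2!vtens_actE. Qed.

Lemma vbal_act_rel N q r (d : vindex m N n q r) D (x : vtens d D) :
  bal_rel x -> qpi (@bal_rel N q r d) D (vtens_act d D x) = 0.
Proof.
case=> [g theta p sigma y omega|g theta p sigma sigma' y omega e
       |g theta p sigma sigma' y omega e|g theta p sigma y omega];
rewrite vtens_actB.
- have -> : pcomp s (pcomp theta (block_perm (vl_sum d) g)) =
            pcomp (pcomp s theta) (block_perm (vl_sum d) g) by rewrite /pcomp mulgA.
  exact: (qpi_rel (BalL _ _ _ _ _ _ _)).
- exact: (qpi_rel (BalK _ _ _ _ _ e)).
- exact: (qpi_rel (BalJ _ _ _ _ _ e)).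
- have -> : pcomp (pcomp (block_perm (vi_sum d) g) omega) t =
            pcomp (block_perm (vi_sum d) g) (pcomp omega t) by rewrite /pcomp mulgA.
  exact: (qpi_rel (BalI _ _ _ _ _ _ _)).
Qed.

Definition vbal_act N q r (d : vindex m N n q r) : chmap (vbal d) (vbal d) :=
  quot_map (@vbal_act_rel N q r d).

Definition vsum_act N q r : chmap (vsum N q r) (vsum N q r) :=
  dsum_map (phi := id) (@vbal_act N q r).

Lemma vsum_actE N q r (d : vindex m N n q r) D theta p sigma x omega :
  vsum_act N q r D (vclass D theta p sigma x omega) =
  vclass (d := d) D (pcomp s theta) p sigma x (pcomp omega t).
Proof. by rewrite /vsum_act /vclass dsum_mapE quot_mapE vtens_actE. Qed.

Lemma vcoinv_act_rel N q r D (x : vsum N q r D) :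
  vcoinv_rel x -> qpi (@vcoinv_rel N q r) D (vsum_act N q r D x) = 0.
Proof.
case=> d tau ups theta p sigma sigma' y omega e.
rewrite (chmapB (vsum_act N q r)) chmapZ 2!vsum_actE.
have -> : pcomp s (pcomp theta (permute_blocks (vl_sum d) tau)^-1%g) =
          pcomp (pcomp s theta) (permute_blocks (vl_sum d) tau)^-1%g.
  by rewrite /pcomp mulgA.
have -> : pcomp (pcomp (permute_blocks (vi_sum d) ups) omega) t =
          pcomp (permute_blocks (vi_sum d) ups) (pcomp omega t).
  by rewrite /pcomp mulgA.
exact: (qpi_rel (Vcoinv _ _ _ _ _ e)).
Qed.

Definition vcoinv_act N q r : chmap (vcoinv N q r) (vcoinv N q r) :=
  quot_map (@vcoinv_act_rel N q r).

Definition boxVal_act : chmap boxVal_obj boxVal_obj :=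
  dsum_map (phi := id) (fun N =>
    dsum_map (phi := id) (fun rs => vcoinv_act (val N) (val rs.1) (val rs.2))).

Lemma boxVal_actE (N q r : posnat) (d : vindex m (val N) n (val q) (val r)) e
    (x : vtens d e) :
  boxVal_act e (din _ N e (din _ (q, r) e (qpi _ e (din _ d e (qpi _ e x))))) =
  din _ N e (din _ (q, r) e (qpi _ e (din _ d e (qpi _ e (vtens_act d e x))))).
Proof.
rewrite /boxVal_act !dsum_mapE /vcoinv_act quot_mapE /vsum_act dsum_mapE.
by rewrite /vbal_act quot_mapE.
Qed.

End Action.

Lemma hmap_id (C : complex k) (w : helt C) : hmap (chmap_id C) w = w.
Proof. by case: w. Qed.

Lemma hel_eq (C : complex k) (i : int) (x y : C i) : x = y -> hel x = hel y.
Proof. by move->. Qed.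

Lemma kset_map_eq (X : finType) (f g : bij X X) (w : helt (kset k X)) :
  f =1 g -> hmap (kset_map k f) w = hmap (kset_map k g) w.
Proof. by move=> /bij_ext ->. Qed.

Lemma kset_map_comp (X : finType) (f g : bij X X) (w : helt (kset k X)) :
  hmap (kset_map k f) (hmap (kset_map k g) w) = hmap (kset_map k (bij_comp f g)) w.
Proof.
case: w => i w; apply: hel_eq; apply/ffunP => y; rewrite !ffunE /=.
by congr (w _); apply: val_inj.
Qed.

Lemma kset_map_id (X : finType) (f : bij X X) (w : helt (kset k X)) :
  f =1 id -> hmap (kset_map k f) w = w.
Proof.
move=> fi; rewrite (kset_map_eq (g := bij_id X)) //; case: w => i w.
apply: hel_eq; apply/ffunP => y; rewrite !ffunE /=.
by congr (w _); apply: val_inj.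
Qed.

Lemma vtens_act1 N q r (d : vindex m N n q r) D (x : vtens d D) :
  vtens_act 1 1 d D x = x.
Proof.
move: D x; apply: (tens_chext (g := chmap_id _)) => D x.
rewrite /vtens_act tens_mapE; congr tgen.
apply: functional_extensionality_dep => -[|a||b|]; rewrite /tsym_map /= ?hmap_id //.
- by apply: kset_map_id => a /=; rewrite mulg1.
- by apply: kset_map_id => a /=; rewrite mul1g.
Qed.

Lemma vtens_actM s s' t t' N q r (d : vindex m N n q r) D (x : vtens d D) :
  vtens_act (pcomp s' s) (pcomp t t') d D x =
  vtens_act s' t' d D (vtens_act s t d D x).
Proof.
move: D x.
apply: (tens_chext (g := chmap_comp (vtens_act s' t' d) (vtens_act s t d))) => D x.
rewrite chmap_compE /vtens_act !tens_mapE; congr tgen.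
apply: functional_extensionality_dep => -[|a||b|]; rewrite /tsym_map /= ?hmap_id //.
- by rewrite kset_map_comp; apply: kset_map_eq => a /=; rewrite /pcomp mulgA.
- by rewrite kset_map_comp; apply: kset_map_eq => a /=; rewrite /pcomp mulgA.
Qed.

Lemma boxVal_act1 D (x : boxVal_obj D) : boxVal_act 1 1 D x = x.
Proof.
move: D x; apply: (vcoinv_chext (g := chmap_id _)) => N q r d D x.
by rewrite boxVal_actE vtens_act1.
Qed.

Lemma boxVal_actM s s' t t' D (x : boxVal_obj D) :
  boxVal_act (pcomp s' s) (pcomp t t') D x = boxVal_act s' t' D (boxVal_act s t D x).
Proof.
move: D x.
apply: (vcoinv_chext (g := chmap_comp (boxVal_act s' t') (boxVal_act s t))).
by move=> N q r d D x; rewrite chmap_compE 3!boxVal_actE vtens_actM.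
Qed.

Definition boxVal : smodule k m n := Smodule boxVal_act1 boxVal_actM.

End Vallette.

(* Main.v *)
(* A generator of Vallette's product is a pure tensor together with permutations
   theta, sigma, omega that assemble consecutive blocks.  It determines a
   connected family: the blocks are the images of the consecutive blocks under
   theta and omega^-1 and, in {1, ..., N}, under permutations kappa and lambda
   with sigma = kappa^-1 lambda.  Conversely, an ordering of the two lists of
   blocks of a connected family F and a numbering of every block (a
   [presentation] of F) turn an unordered tensor over F into such a generator.
   Renumbering the blocks is exactly balancing over S_l, S_k, S_j and S_i;
   reordering them is the S_r x S_s-action, with the Koszul sign of the unordered
   tensor product; and (kappa, lambda) is determined by sigma up to left
   multiplication, which is the S_N-action.  Hence both maps are well defined, and
   they are mutually inverse. *)
Require Import Defs.
From HB Require Import structures.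
From mathcomp Require Import all_boot all_order all_algebra all_fingroup.
From mathcomp Require Import boolp.

Set Implicit Arguments.
Unset Strict Implicit.
Unset Printing Implicit Defensive.

Import GRing.Theory.
Local Open Scope ring_scope.

(** * Tensor products of complexes *)

(** Everything rests on one formula: for every presentation p of a family, the class of [pgen p D x]
    in Vallette's product corresponds to the class of [cgen (porder p) D x] in the other product. To
    have actual chain maps, [psi] is defined with one presentation chosen for each family, and [phi]
    with one family built from each generator, normalised by kappa = 1. That the formula
    nevertheless holds for all presentations is [psi_connE] and [phi_vgen]; balancing, coinvariants,
    equivariance and inverseness then come from choosing suitable presentations. Two obstacles shape
    the rest. The slots k[S_m], k[S_c] and k[S_n] hold arbitrary vectors, while a presentation
    yields basis elements only, so [vtens] is split into a direct sum over triples of basis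
    elements. And tensors over families that are equal without being convertible cannot be compared
    directly; [cgen_rigid] reduces such comparisons to equalities of permutations. *)

Lemma qpi_eq (k : fieldType) (C : complex k) (R : forall n, C n -> Prop) n (x y : C n) :
  R n (x - y) -> qpi R n x = qpi R n y.
Proof.
by move/(qpi_rel (R := R)); rewrite chmapB => /eqP; rewrite subr_eq0 => /eqP.
Qed.

Section TensChLift.
Variables (k : fieldType) (A : eqType) (o : enumeration A) (C : A -> complex k).
Variables (D : complex k) (F : forall n, tsym C -> D n).
Hypothesis F_lin : forall n x a i c (u v : C a i),
  F n (tset x (hel (c *: u + v))) =
  c *: F n (tset x (hel u)) + F n (tset x (hel v)).
Hypothesis F_deg : forall n x, tdeg o x <> n -> F n x = 0.
Hypothesis F_diff : forall n x,
  \sum_(a <- o) tsgn o x a *: F (n - 1) (tset x (hdiff (x a))) =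
  cdiff D n (F n x).

Lemma tens_chlift_diff n (x : tens o C n) :
  tens_lift (@F_lin (n - 1)) (@F_deg (n - 1)) (cdiff (tens o C) n x) =
  cdiff D n (tens_lift (@F_lin n) (@F_deg n) x).
Proof.
set f := tens_lift _ _; set g := tens_lift _ _.
rewrite -[LHS]/((f \o tdiff o C n) x) -[RHS]/((cdiff D n \o g) x).
apply: tens_ext => {}x; rewrite /= tdiffE tens_liftE -F_diff linear_sum /=.
by apply: eq_bigr => a _; rewrite linearZ /= tens_liftE.
Qed.

Definition tens_chlift : chmap (tens o C) D :=
  @Chmap k (tens o C) D (fun n => tens_lift (@F_lin n) (@F_deg n))
    tens_chlift_diff.

Lemma tens_chliftE n x : tens_chlift n (tgen o n x) = F n x.
Proof. exact: tens_liftE. Qed.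

End TensChLift.

Lemma tset_id (k : fieldType) (A : eqType) (C : A -> complex k) (x : tsym C) a :
  tset x (x a) = x.
Proof.
apply: functional_extensionality_dep => b.
by have [<-|ab] := eqVneq a b; rewrite ?tset_in ?tset_out.
Qed.

Lemma helE (k : fieldType) (C : complex k) (w : helt C) : hel (tagged w) = w.
Proof. by case: w. Qed.

(** * Koszul signs between two orders of the factors *)

Section Koszul.
Variables (k : fieldType) (A : eqType) (C : A -> complex k).
Implicit Types (o : enumeration A) (x : tsym C).

Lemma enum_ltn_total o a b :
  a != b -> (index b o < index a o)%N = ~~ (index a o < index b o)%N.
Proof.
move=> ab; rewrite ltn_neqAle -leqNgt andb_idl // => _.
by apply: contra_neq ab => e; rewrite -(nth_index a (efull o a)) -e nth_index ?efull.
Qed.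

Lemma big_enumeration o o' (T : Type) (idx : T) (op : Monoid.com_law idx)
    (p : pred A) F :
  \big[op/idx]_(a <- o | p a) F a = \big[op/idx]_(a <- o' | p a) F a.
Proof.
apply: perm_big; apply: uniq_perm; rewrite ?euniq // => a.
by rewrite !efull.
Qed.

(** A product over unordered pairs does not depend on the order used to list each pair once: the
    pairs on which the two orders agree occur identically on both sides, and the others occur
    reversed, which the symmetry of [f] absorbs. *)
Lemma big_pairs_enum o o' (f : A -> A -> k) : (forall a b, f a b = f b a) ->
  \prod_(a <- o) \prod_(b <- o | (index a o < index b o)%N) f a b =
  \prod_(a <- o') \prod_(b <- o' | (index a o' < index b o')%N) f a b.
Proof.
move=> fC.
pose G (u v : bool -> bool) := \prod_(a <- o) \prod_(b <- o |
  u (index a o < index b o)%N && v (index a o' < index b o')%N && (a != b)) f a b.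
have eo : \prod_(a <- o) \prod_(b <- o | (index a o < index b o)%N) f a b =
          G id id * G id negb.
  rewrite /G -big_split /=; apply: eq_bigr => a _.
  rewrite (bigID (fun b => index a o' < index b o')%N) /=.
  by congr (_ * _); apply: eq_bigl => b; have [->|] := eqVneq a b;
    rewrite ?ltnn ?andbF ?andbT.
have eo' : \prod_(a <- o') \prod_(b <- o' | (index a o' < index b o')%N) f a b =
           G id id * G negb id.
  rewrite (big_enumeration o' o) /G -big_split /=; apply: eq_bigr => a _.
  rewrite (big_enumeration o' o) (bigID (fun b => index a o < index b o)%N) /=.
  by congr (_ * _); apply: eq_bigl => b; have [->|] := eqVneq a b;
    rewrite ?ltnn ?andbF ?andbT // andbC.
rewrite eo eo'; congr (_ * _); rewrite /G.
rewrite (exchange_big_dep predT) //=; apply: eq_bigr => a _.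
apply: eq_big => [b|b _]; last exact: fC.
have [->|ab] := eqVneq a b; rewrite ?ltnn ?andbF //= !andbT.
by rewrite [X in X && _](enum_ltn_total o ab) (enum_ltn_total o' ab) negbK.
Qed.

(** Listing the pairs by a third order [o0] puts the signs for different pairs of orders over one
    common index set, where they can be multiplied termwise. *)
Lemma koszulE o o' o0 x :
  koszul o o' x = \prod_(a <- o0) \prod_(b <- o0 | (index a o0 < index b o0)%N)
    (if (index a o < index b o)%N != (index a o' < index b o')%N
     then (-1) ^ (tag (x a) * tag (x b)) else 1).
Proof.
rewrite (big_pairs_enum o0 o) => [|a b]; last first.
  have [->//|ab] := eqVneq a b.
  rewrite (enum_ltn_total o ab) (enum_ltn_total o' ab) mulrC.
  by rewrite (inj_eq negb_inj).
rewrite /koszul; apply: eq_bigr => a _; rewrite -big_mkcondr.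
apply: eq_bigl => b; have [->|ab] := eqVneq a b; first by rewrite !ltnn.
by rewrite (enum_ltn_total o' ab); case: ltnP.
Qed.

Lemma signz_sqr (i : int) : (-1 : k) ^ i * (-1) ^ i = 1.
Proof. by rewrite -expfzMl mulrNN mulr1 exp1rz. Qed.

(** For each pair of factors, [o] and [o''] disagree exactly when one of the two intermediate
    comparisons does, but not both; if both do, the sign occurs squared. *)
Lemma koszul_trans o o' o'' x : koszul o o'' x = koszul o o' x * koszul o' o'' x.
Proof.
rewrite (koszulE o o'' o) (koszulE o o' o) (koszulE o' o'' o) -big_split /=.
apply: eq_bigr => a _; rewrite -big_split /=; apply: eq_bigr => b _.
by do 3 case: (index a _ < _)%N; rewrite /= ?mul1r ?mulr1 ?signz_sqr.
Qed.

Lemma koszul_refl o x : koszul o o x = 1.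
Proof.
rewrite (koszulE o o o); apply: big1 => a _; apply: big1 => b _.
by rewrite eqxx.
Qed.

Lemma koszul_eq_tag o o' (x y : tsym C) :
  (forall a, tag (x a) = tag (y a)) -> koszul o o' x = koszul o o' y.
Proof.
move=> xy; rewrite /koszul; apply: eq_bigr => a _; apply: eq_bigr => b _.
by rewrite !xy.
Qed.

Lemma tag_tset x a i (u v : C a i) b :
  tag (tset x (hel u) b) = tag (tset x (hel v) b).
Proof. by have [<-|ab] := eqVneq a b; rewrite ?tset_in ?tset_out. Qed.

Lemma tsgnE o x a :
  tsgn o x a = \prod_(b <- o | (index b o < index a o)%N) (-1) ^ tag (x b).
Proof.
rewrite /tsgn; elim/big_rec2: _ => [|b p q _ <-]; first by rewrite expr0z.
by rewrite expfzDr // oppr_eq0 oner_eq0.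
Qed.

(** Lowering the degree of the factor [a] by one changes the Koszul sign by the signs of the factors
    that cross [a] between the two orders. The signs of the differential at [a] differ by those same
    factors, so reordering commutes with the differential. *)
Lemma koszul_diff o o' x a :
  koszul o o' (tset x (hdiff (x a))) * tsgn o x a = koszul o o' x * tsgn o' x a.
Proof.
pose s b : k := (-1) ^ tag (x b).
pose inv b c := (index b o < index c o)%N && (index c o' < index b o')%N.
(* Only the inversions that involve [a] feel the change of degree, and each contributes the sign of
   its other member. *)
have -> : koszul o o' (tset x (hdiff (x a))) =
   koszul o o' x * (\prod_(b <- o | inv a b) s b * \prod_(b <- o | inv b a) s b).
  have -> : \prod_(b <- o | inv a b) s b =
     \prod_(c <- o) \prod_(b <- o | inv c b) if c == a then s b else 1.
    rewrite [RHS](bigD1_seq a) ?efull ?euniq //= eqxx [X in _ * X]big1 ?mulr1 //.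
    by move=> c /negbTE->; apply: big1.
  have -> : \prod_(b <- o | inv b a) s b =
     \prod_(c <- o) \prod_(b <- o | inv c b) if b == a then s c else 1.
    rewrite [LHS]big_mkcond /=; apply: eq_bigr => c _.
    rewrite big_mkcond (bigD1_seq a) ?efull ?euniq //= eqxx [X in _ * X]big1 ?mulr1 //.
    by move=> b /negbTE->; case: ifP.
  rewrite /koszul -!big_split /=; apply: eq_bigr => c _.
  rewrite -!big_split /=; apply: eq_bigr => b /andP[cb _].
  have n0 : (-1 : k) != 0 by rewrite oppr_eq0 oner_eq0.
  have [ca|ca] := eqVneq c a; have [ba|ba] := eqVneq b a.
  - by move: cb; rewrite ca ba ltnn.
  - rewrite ca tset_in tset_out 1?eq_sym //= mulrDl expfzDr // mulN1r.
    by rewrite -exprz_inv invrN1 mulr1.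
  - rewrite ba tset_in tset_out 1?eq_sym //= mulrDr expfzDr // mulrN1.
    by rewrite -exprz_inv invrN1 mul1r.
  - by rewrite !tset_out 1?eq_sym // !mulr1.
rewrite -!mulrA; congr (_ * _); rewrite !tsgnE -/(s _).
rewrite (big_enumeration o' o).
rewrite [X in _ * (_ * X)](bigID (fun b => index b o' < index a o')%N) /=.
rewrite [RHS](bigID (fun b => index b o < index a o)%N) /=.
set c := (X in _ * (_ * (X * _))); set q := (X in _ * (_ * (_ * X))).
set p := (X in _ * (X * _)).
(* Both products run over the factors that precede [a] in [o] but not in [o'], so their signs cancel
   in squares. *)
have pq : p * q = 1.
  rewrite /p /q [X in X * _](eq_bigl (fun b => (index b o < index a o)%N
                                 && ~~ (index b o' < index a o')%N)) => [|b].
    by rewrite -big_split; apply: big1 => b _; apply: signz_sqr.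
  rewrite /inv; have [->|ba] := eqVneq b a; first by rewrite !ltnn.
  by rewrite (enum_ltn_total o' ba).
rewrite [p * _]mulrCA pq mulr1 /c.
rewrite mulrC; congr (_ * _); first by apply: eq_bigl => b; rewrite andbC.
apply: eq_bigl => b; rewrite /inv; have [->|ba] := eqVneq b a; first by rewrite !ltnn.
by rewrite (enum_ltn_total o ba) andbC.
Qed.

(** This chain map between two ordered tensor products extends a map known in one fixed order to all
    orders, as a map out of [utens] requires. *)
Definition reord_fun o o' n x : tens o' C n := koszul o o' x *: tgen o' n x.

Lemma reord_lin o o' n x a i c (u v : C a i) :
  reord_fun o o' n (tset x (hel (c *: u + v))) =
  c *: reord_fun o o' n (tset x (hel u)) + reord_fun o o' n (tset x (hel v)).
Proof.
rewrite /reord_fun tgen_lin scalerDr !scalerA mulrC.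
rewrite (koszul_eq_tag _ _ (tag_tset x (c *: u + v) u)).
by rewrite (koszul_eq_tag _ _ (tag_tset x v u)).
Qed.

Lemma reord_deg o o' n x : tdeg o x <> n -> reord_fun o o' n x = 0.
Proof.
move=> xn; rewrite /reord_fun tgen_deg ?scaler0 // => e; apply: xn.
by rewrite -e /tdeg (big_enumeration o o').
Qed.

Lemma reord_diff o o' n x :
  \sum_(a <- o) tsgn o x a *: reord_fun o o' (n - 1) (tset x (hdiff (x a))) =
  cdiff (tens o' C) n (reord_fun o o' n x).
Proof.
rewrite /reord_fun linearZ /= tdiffE /tdiff_fun scaler_sumr.
rewrite (big_enumeration o o'); apply: eq_bigr => a _.
by rewrite !scalerA mulrC koszul_diff.
Qed.

Definition reord o o' : chmap (tens o C) (tens o' C) :=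
  tens_chlift (@reord_lin o o') (@reord_deg o o') (@reord_diff o o').

Lemma reordE o o' n x : reord o o' n (tgen o n x) = koszul o o' x *: tgen o' n x.
Proof. exact: tens_chliftE. Qed.

End Koszul.

Section TsymUnmap.
Variables (k : fieldType) (A B : eqType) (C : A -> complex k) (D : B -> complex k).
Variables (e : bij B A).
Variables (f : forall b, chmap (C (e b)) (D b)) (g : forall b, chmap (D b) (C (e b))).

(** Needed because inverting [tsym_map] lands in [C (e (binv e a))], which equals [C a] only
    propositionally. *)
Definition chmap_cast a a' (E : a = a') : chmap (C a) (C a') :=
  match E with erefl => chmap_id (C a) end.

Definition unmap_factor a : chmap (D (bij_inv e a)) (C a) :=
  chmap_comp (chmap_cast (binvK e a)) (g (binv e a)).

Definition tsym_unmap : tsym D -> tsym C := tsym_map (e := bij_inv e) unmap_factor.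

Hypothesis gfK : forall b w, hmap (g b) (hmap (f b) w) = w.
Hypothesis fgK : forall b w, hmap (f b) (hmap (g b) w) = w.

Lemma hmap_comp (X Y Z : complex k) (u : chmap Y Z) (v : chmap X Y) w :
  hmap (chmap_comp u v) w = hmap u (hmap v w).
Proof. by []. Qed.

Lemma chmap_castE (x : tsym C) a a' (E : a = a') : hmap (chmap_cast E) (x a) = x a'.
Proof. by case: a' / E; case: (x a). Qed.

Lemma tsym_mapK x : tsym_unmap (tsym_map f x) = x.
Proof.
apply: functional_extensionality_dep => a; rewrite /tsym_unmap /tsym_map.
by rewrite hmap_comp gfK chmap_castE.
Qed.

Lemma tsym_unmapK y : tsym_map f (tsym_unmap y) = y.
Proof.
apply: functional_extensionality_dep => b; rewrite /tsym_unmap /tsym_map.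
rewrite /unmap_factor hmap_comp /=.
(* Once [binv e (e b)] is rewritten to [b], the cast runs along a loop at [e b], which proof
   irrelevance replaces by [erefl]. *)
move: (binvK e (e b)); rewrite (bfunK e b) => E.
rewrite (Prop_irrelevance E erefl) /=.
by rewrite -[RHS]fgK; congr hmap; case: (hmap _ _).
Qed.

Lemma enum_mapK (oB : enumeration B) :
  [seq bij_inv e a | a <- enum_map e oB] = oB.
Proof. by rewrite /= -map_comp (eq_map (bfunK e)) map_id. Qed.

Definition tens_unmap (oB : enumeration B) :
  chmap (tens oB D) (tens (enum_map e oB) C) :=
  tens_map (e := bij_inv e) (enum_mapK oB) unmap_factor.

Lemma tens_unmapE oB n y :
  tens_unmap oB n (tgen oB n y) = tgen (enum_map e oB) n (tsym_unmap y).
Proof. exact: tens_mapE. Qed.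

End TsymUnmap.

Section ChmapSum.
Variables (k : fieldType) (C D : complex k) (I : finType) (f : I -> chmap C D).

Definition chsum_fun n (x : C n) : D n := \sum_i f i n x.

Lemma chsum_linear n : linear (@chsum_fun n).
Proof.
move=> c u v; rewrite /chsum_fun scaler_sumr -big_split /=.
by apply: eq_bigr => i _; rewrite linearP.
Qed.

HB.instance Definition _ n :=
  GRing.isLinear.Build k (C n) (D n) *:%R (@chsum_fun n) (@chsum_linear n).

Lemma chsum_diff n (x : C n) :
  chsum_fun (cdiff C n x) = cdiff D n (chsum_fun x).
Proof.
by rewrite /chsum_fun linear_sum; apply: eq_bigr => i _; apply: cmap_diff.
Qed.

Definition chsum : chmap C D :=
  @Chmap k C D (fun n => @chsum_fun n : {linear _ -> _}) chsum_diff.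

Lemma chsumE n (x : C n) : chsum n x = \sum_i f i n x.
Proof. by []. Qed.

End ChmapSum.

(** * Block decompositions and connectedness *)

Section BijOnto.
Variables (A B : finType) (f : A -> B) (f_inj : injective f).

Lemma bij_onto_ex (y : sub [set f a | a : A]) : exists a, f a == val y.
Proof. by case: y => _ /= /imsetP[a _ ->]; exists a. Qed.

Lemma bij_onto_in a : f a \in [set f a | a : A].
Proof. exact: imset_f. Qed.

Definition bij_onto_fun a : sub [set f a | a : A] := exist _ (f a) (bij_onto_in a).
Definition bij_onto_inv (y : sub [set f a | a : A]) : A := xchoose (bij_onto_ex y).

Lemma bij_onto_invK : cancel bij_onto_inv bij_onto_fun.
Proof. by move=> y; apply/val_inj/eqP/(xchooseP (bij_onto_ex y)). Qed.

Lemma bij_onto_funK : cancel bij_onto_fun bij_onto_inv.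
Proof.
by move=> a; apply: f_inj; have := congr1 val (bij_onto_invK (bij_onto_fun a)).
Qed.

Definition bij_onto : bij A (sub [set f a | a : A]) :=
  Bij bij_onto_funK bij_onto_invK.
End BijOnto.

Definition bij_enum (T : finType) : bij 'I_#|T| T :=
  Bij (@enum_valK T) (@enum_rankK T).

Section IPartition.
Variables (J T : finType) (A : {set J}) (f : J -> {set T}).
Hypothesis fA : ipartition A f.

Lemma ipart_cover x : exists a : sub A, x \in f (val a).
Proof.
case/and3P: fA => _ _ /eqP fT.
have : x \in \bigcup_(a in A) f a by rewrite fT in_setT.
by case/bigcupP => a aA xa; exists (exist _ a aA).
Qed.

Lemma ipart_inj x (a b : sub A) : x \in f (val a) -> x \in f (val b) -> a = b.
Proof.
case/and3P: fA => _ /forall_inP fd _; move=> xa xb; apply/val_inj/eqP.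
have /forall_inP/(_ _ (valP b))/implyP := fd _ (valP a).
by case: eqP => // _ /(_ isT)/disjointFr/(_ xa); rewrite xb.
Qed.

Lemma ipart_neq0 (a : sub A) : f (val a) != set0.
Proof. by case/and3P: fA => /forall_inP f0 _ _; apply/f0/(valP a). Qed.

Lemma ipart_gt0 (a : sub A) : (0 < #|sub (f (val a))|)%N.
Proof. by rewrite card_sig card_gt0; have := ipart_neq0 a. Qed.

Lemma ipart_card r (e : bij 'I_r (sub A)) :
  (\sum_(a < r) #|sub (f (val (e a)))| = #|T|)%N.
Proof.
rewrite -sum1_card (eq_bigr (fun a => \sum_(x : T) (x \in f (val (e a))))%N).
  rewrite exchange_big /=; apply: eq_bigr => x _.
  have [b xb] := ipart_cover x; rewrite (bigD1 (binv e b)) //= binvK xb.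
  rewrite big1 // => a ab; apply/eqP; rewrite eqb0; apply: contraNN ab => xa.
  by apply/eqP; rewrite -[a](bfunK e) (ipart_inj xb xa).
by move=> a _; rewrite card_sig -sum1_card big_mkcond.
Qed.

Lemma ipart_size_gt0 : (0 < #|T|)%N -> (0 < #|sub A|)%N.
Proof.
by case/card_gt0P => x _; have [a _] := ipart_cover x; apply/card_gt0P; exists a.
Qed.

End IPartition.

Section Flat.
Variables (J : finType) (N : nat) (A : {set J}) (f : J -> {set 'I_N}).
Hypothesis fA : ipartition A f.
Variables (r : nat) (e : bij 'I_r (sub A)) (l : 'I_r -> nat).
Hypothesis lN : (\sum_(a < r) l a)%N = N.
Variable c : forall a, bij 'I_(l a) (sub (f (val (e a)))).

(** Glues numberings of the single blocks into one permutation: the i-th element of the a-th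
    consecutive block goes to the i-th element of the block labelled [e a]. All four permutations of
    a presentation arise in this way. *)
Definition flat_fun (x : 'I_N) : 'I_N :=
  val (c (tag (blk lN x)) (tagged (blk lN x))).

Lemma flat_fun_inj : injective flat_fun.
Proof.
move=> x y; rewrite /flat_fun => E; apply: (can_inj (blkK lN)); move: E.
case: (blk lN x) (blk lN y) => [a i] [b j] /= E.
have ab : a = b.
  apply: (can_inj (bfunK e)); apply: (ipart_inj fA (x := val (c a i))).
    exact: valP.
  by have := valP (c b j); rewrite /= -E.
by subst b; rewrite (can_inj (bfunK (c a)) (val_inj E)).
Qed.

Definition flat : {perm 'I_N} := perm flat_fun_inj.

Lemma flatE a i : flat (unblk lN (existT (fun a => 'I_(l a)) a i)) = val (c a i).
Proof. by rewrite permE /flat_fun unblkK. Qed.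

Definition blkset (g : {perm 'I_N}) a :=
  [set g (unblk lN (existT (fun a => 'I_(l a)) a i)) | i : 'I_(l a)].

Lemma flat_blkset a : f (val (e a)) = blkset flat a.
Proof.
apply/setP => x; apply/idP/imsetP => [xa|[i _ ->]]; last first.
  by rewrite flatE; apply: valP.
by exists (binv (c a) (exist _ x xa)); rewrite ?flatE ?binvK.
Qed.

Lemma flat_eq (g : {perm 'I_N}) :
  (forall a i, val (c a i) = g (unblk lN (existT (fun a => 'I_(l a)) a i))) ->
  flat = g.
Proof.
move=> cg; apply/permP => x; rewrite -(blkK lN x); case: (blk lN x) => a i.
by rewrite flatE cg.
Qed.

End Flat.

Section BlkSet.
Variables (N r : nat) (l : 'I_r -> nat) (lN : (\sum_(a < r) l a)%N = N).
Hypothesis l_gt0 : forall a, (0 < l a)%N.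
Variable g : {perm 'I_N}.

Lemma mem_blkset x a : (x \in blkset lN g a) = (tag (blk lN ((g^-1)%g x)) == a).
Proof.
apply/imsetP/eqP => [[i _ ->]|<-]; first by rewrite permK unblkK.
exists (tagged (blk lN ((g^-1)%g x))) => //.
have eta (w : {a : 'I_r & 'I_(l a)}) : existT _ (tag w) (tagged w) = w by case: w.
by rewrite eta blkK permKV.
Qed.

Lemma blkset_neq0 a : blkset lN g a != set0.
Proof.
apply/set0Pn; exists (g (unblk lN (existT _ a (Ordinal (l_gt0 a))))).
exact: imset_f.
Qed.

Lemma blkset_inj : injective (blkset lN g).
Proof.
move=> a b ab; have /set0Pn[x xa] := blkset_neq0 a.
have xb : x \in blkset lN g b by rewrite -ab.
by move: xa xb; rewrite !mem_blkset => /eqP <- /eqP.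
Qed.

Lemma blkset_ipartition (J : finType) (h : 'I_r -> J) (f : J -> {set 'I_N}) :
  (forall a, f (h a) = blkset lN g a) -> ipartition [set h a | a : 'I_r] f.
Proof.
move=> fh; apply/and3P; split.
- by apply/forall_inP => _ /imsetP[a _ ->]; rewrite fh blkset_neq0.
- apply/forall_inP => _ /imsetP[a _ ->]; apply/forall_inP => _ /imsetP[b _ ->].
  apply/implyP => ab; rewrite !fh; apply/pred0P => x /=; rewrite !mem_blkset.
  have [ta|] //= := eqVneq (tag _) a; apply/eqP => tb.
  by move: ab; rewrite -ta tb eqxx.
- apply/eqP/setP => x; rewrite in_setT; apply/bigcupP.
  exists (h (tag (blk lN ((g^-1)%g x)))); first exact: imset_f.
  by rewrite fh mem_blkset.
Qed.

Definition blkset_fun a (i : 'I_(l a)) := g (unblk lN (existT (fun a => 'I_(l a)) a i)).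

Lemma blkset_fun_inj a : injective (@blkset_fun a).
Proof.
move=> i j /perm_inj/(can_inj (unblkK lN))/eqP; rewrite eq_Tagged /=.
by move/eqP.
Qed.

Definition bij_blkset a : bij 'I_(l a) (sub (blkset lN g a)) :=
  bij_onto (@blkset_fun_inj a).

End BlkSet.

(** * Joins of partitions and connectedness of bipartite graphs *)

Section JoinConnected.
Variables (T A B : finType) (p : T -> A) (q : T -> B).
Hypothesis p_surj : forall a, exists x, p x = a.
Hypothesis q_surj : forall b, exists x, q x = b.

Definition fiber_edge : rel (A + B) := fun u v =>
  match u, v with
  | inl a, inr b | inr b, inl a => [exists x, (q x == b) && (p x == a)]
  | _, _ => false
  end.

Lemma fiber_edge_sym : symmetric fiber_edge.
Proof. by move=> [a|a] [b|b]. Qed.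

Lemma fiber_edge_pq x : fiber_edge (inl (p x)) (inr (q x)).
Proof. by apply/existsP; exists x; rewrite !eqxx. Qed.

Lemma fiber_connect_sym : connect_sym fiber_edge.
Proof. exact: sym_connect_sym fiber_edge_sym. Qed.

Definition fibers (I : finType) (h : T -> I) : {set {set T}} :=
  [set [set x | h x == i] | i : I].

Lemma fibers_in (I : finType) (h : T -> I) i : [set x | h x == i] \in fibers h.
Proof. exact: imset_f. Qed.

(** Points of T are the edges of the graph. Edges in the same component form the classes of a common
    coarsening; the one-block partition refines it, so there is only one class, and by surjectivity
    every vertex lies on an edge. *)
Lemma join_connected : is_join (fibers p) (fibers q) [set setT] ->
  forall u v, connect fiber_edge u v.
Proof.
case/andP=> _ /forallP jmin.
pose R x y := connect fiber_edge (inl (p x)) (inl (p y)).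
have Req : {in setT & &, equivalence_rel R}.
  move=> x y z _ _ _; split; first exact: connect0.
  by move=> xy; apply: same_connect xy _; apply: fiber_connect_sym.
have cJ : common_coarsening (fibers p) (fibers q) (equivalence_partition R setT).
  have ep := equivalence_partitionP Req.
  have mem x : [set y in setT | R x y] \in equivalence_partition R setT.
    exact: imset_f.
  apply/and3P; split=> //.
  - apply/forall_inP => _ /imsetP[a _ ->]; have [x xa] := p_surj a.
    apply/exists_inP; exists [set y in setT | R x y] => //.
    apply/subsetP => y; rewrite !inE => /eqP ya /=.
    by rewrite /R xa ya connect0.
  - apply/forall_inP => _ /imsetP[b _ ->]; have [x xb] := q_surj b.
    apply/exists_inP; exists [set y in setT | R x y] => //.
    apply/subsetP => y; rewrite !inE => /eqP yb /=; rewrite /R.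
    apply: connect_trans (connect1 (fiber_edge_pq x)) _.
    rewrite xb -yb; apply: connect1; rewrite fiber_edge_sym; exact: fiber_edge_pq.
have := implyP (jmin _) cJ.
move/forall_inP/(_ setT); rewrite set11 => /(_ isT)/exists_inP[c].
case/imsetP => z _ -> /subsetP all.
have zx x : connect fiber_edge (inl (p z)) (inl (p x)).
  by have := all x; rewrite !inE => /(_ isT).
have zu u : connect fiber_edge (inl (p z)) u.
  case: u => [a|b]; first by have [x <-] := p_surj a.
  have [x <-] := q_surj b; apply: connect_trans (zx x) _.
  exact/connect1/fiber_edge_pq.
move=> u v; apply: connect_trans (zu v); rewrite fiber_connect_sym; exact: zu.
Qed.

(** In any common coarsening, the block of [x0] absorbs the fibers met along a path, one after
    another, hence all of T. The point [x0] also guarantees that [[set setT]] is a partition, whose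
    blocks must be non-empty. *)
Lemma connected_join (x0 : T) : (forall u v, connect fiber_edge u v) ->
  is_join (fibers p) (fibers q) [set setT].
Proof.
move=> conn; apply/andP; split.
  apply/and3P; split.
  - apply/and3P; split; first by rewrite /cover big_set1.
      by apply/trivIsetP => a b; rewrite !inE => /eqP-> /eqP->; rewrite eqxx.
    by rewrite inE eq_sym; apply/set0Pn; exists x0; rewrite inE.
  - apply/forall_inP => a _; apply/exists_inP; exists setT; rewrite ?set11 ?subsetT //.
  - apply/forall_inP => a _; apply/exists_inP; exists setT; rewrite ?set11 ?subsetT //.
apply/forallP => J; apply/implyP => /and3P[pJ /forall_inP rp /forall_inP rq].
have /and3P[/eqP cJ tJ _] := pJ.
have x0J : x0 \in cover J by rewrite cJ in_setT.
apply/forall_inP => b; rewrite inE => /eqP ->.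
apply/exists_inP; exists (pblock J x0); first exact: pblock_mem.
pose fib u := match u with
  | inl a => [set x | p x == a] | inr b => [set x | q x == b] end.
(* Each fiber lies inside a single block of J, so a fiber that meets the block of [x0] is contained
   in it. *)
have fib_in u x : x \in fib u -> x \in pblock J x0 -> fib u \subset pblock J x0.
  have sub c : c \in J -> fib u \subset c -> x \in fib u -> x \in pblock J x0 ->
      fib u \subset pblock J x0.
    move=> cJ' uc xu; rewrite -eq_pblock ?cJ ?in_setT // => /eqP ->.
    by rewrite (def_pblock tJ cJ') // (subsetP uc).
  move=> xu xJ; case: u sub xu => [a|a] sub xu.
    have /exists_inP[c cJ' uc] := rp _ (fibers_in p a).
    exact: (sub c).
  have /exists_inP[c cJ' uc] := rq _ (fibers_in q a).
  exact: (sub c).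
have step u : connect fiber_edge (inl (p x0)) u -> fib u \subset pblock J x0.
  case/connectP => s; elim/last_ind: s u => [|s v IHs] u /=.
    move=> _ ->; apply: (fib_in _ x0); first by rewrite inE.
    by rewrite mem_pblock.
  rewrite rcons_path last_rcons => /andP[/IHs{}IHs uv] ->.
  have {IHs} /subsetP sJ := IHs _ erefl.
  (* An edge of the graph is a common point of the two fibers, through which containment
     propagates. *)
  have [x xv xu] : exists2 x, x \in fib v & x \in fib (last (inl (p x0)) s).
    case: (last _ _) v uv => [a|a] [b'|b'] //= /existsP[x /andP[xb xa]]; exists x;
    by rewrite inE.
  exact: fib_in xv (sJ _ xu).
apply/subsetP => x _; apply: (subsetP (step (inl (p x)) (conn _ _))).
by rewrite inE.
Qed.

End JoinConnected.

(** * Splitting off the factors k[S_m], k[S_c] and k[S_n] *)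

Section KsetCoef.
Variables (k : fieldType) (X : finType).

(** The index type [{x : X | tag w == 0}] depends on the degree of [w]. Summing over it gives one
    term in degree 0 and none in other degrees, without a cast along [tag w = 0]. *)
Definition kcoef (w : helt (kset k X)) (x : X) : k :=
  \sum_(y : {x : X | tag w == 0} | val y == x) tagged w y.

Lemma kcoef_linear i c (u v : kset k X i) x :
  kcoef (hel (c *: u + v)) x = c * kcoef (hel u) x + kcoef (hel v) x.
Proof.
rewrite /kcoef /= mulr_sumr -big_split /=.
by apply: eq_bigr => y _; rewrite !ffunE.
Qed.

Lemma kcoef_deg w x : tag w != 0 -> kcoef w x = 0.
Proof. by move=> w0; apply: big1 => -[y /= yw]; rewrite yw in w0. Qed.

Lemma kcoef_delta x y : kcoef (kdelta k x) y = (y == x)%:R.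
Proof.
rewrite /kcoef /= (big_pred1 (exist _ y isT)) ?ffunE // => z.
Qed.

Lemma kset_expand (M : lmodType k) (L : forall i, kset k X i -> M) :
    (forall i c u v, L i (c *: u + v) = c *: L i u + L i v) ->
  forall w, L (tag w) (tagged w) = \sum_x kcoef w x *: L 0 (tagged (kdelta k x)).
Proof.
move=> Llin.
have L0 i : L i 0 = 0.
  have := Llin i 1 0 0; rewrite !scale1r addr0 => /eqP.
  by rewrite -subr_eq0 opprD addNKr oppr_eq0 => /eqP.
have Lsum i (I : finType) (c : I -> k) (u : I -> kset k X i) :
    L i (\sum_j c j *: u j) = \sum_j c j *: L i (u j).
  by elim/big_rec2: _ => [|j y z _ <-]; rewrite ?L0 // Llin.
case=> i w /=; have [i0|i0] := eqVneq i 0.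
  subst i; rewrite -Lsum; congr L; apply/ffunP => y.
  rewrite sum_ffunE (bigD1 (val y)) //= big1 => [|x xy]; rewrite !ffunE /=.
    rewrite (eqxx (sval y)) [_ *: _]mulr1 addr0 /kcoef (big_pred1 y) //.
  by rewrite eq_sym (negbTE xy) [_ *: _]mulr0.
rewrite big1 => [|x _]; last by rewrite kcoef_deg ?scale0r.
have -> : w = 0 by apply/ffunP => -[y yi]; exfalso; rewrite (negbTE i0) in yi.
exact: L0.
Qed.

End KsetCoef.

Lemma big_enum_law (T : Type) (idx : T) (op : Monoid.law idx) (I : finType) p
    (F : I -> T) :
  \big[op/idx]_(i <- enum I | p i) F i = \big[op/idx]_(i | p i) F i.
Proof. by rewrite enumT [index_enum _]unlock. Qed.

Section Core.
Variables (k : fieldType) (P Q : bimodule k) (m n N r s : nat).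
Variable d : vindex m N n r s.

Definition core (c : 'I_r + 'I_s) : complex k :=
  match c with
  | inl a => P 'I_(vl d a) 'I_(vk d a)
  | inr b => Q 'I_(vj d b) 'I_(vi d b)
  end.

Definition core_seq : seq ('I_r + 'I_s) :=
  [seq inl a | a <- enum 'I_r] ++ [seq inr b | b <- enum 'I_s].

Lemma core_uniq : uniq core_seq.
Proof.
have il : injective (@inl 'I_r 'I_s) by move=> a b [].
have ir : injective (@inr 'I_r 'I_s) by move=> a b [].
rewrite cat_uniq (map_inj_uniq il) (map_inj_uniq ir) !enum_uniq.
by rewrite andbT /=; apply/hasPn => _ /mapP[b _ ->]; apply/mapP => -[].
Qed.

Lemma core_full c : c \in core_seq.
Proof.
rewrite mem_cat; case: c => a; first by rewrite map_f ?mem_enum.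
by rewrite (map_f inr) ?orbT ?mem_enum.
Qed.

Definition core_enum : enumeration ('I_r + 'I_s)%type :=
  Enumeration core_uniq core_full.

Lemma big_core_enum (T : Type) (idx : T) (op : Monoid.law idx) p F :
  \big[op/idx]_(c <- core_enum | p c) F c =
  op (\big[op/idx]_(a < r | p (inl a)) F (inl a))
     (\big[op/idx]_(b < s | p (inr b)) F (inr b)).
Proof.
by rewrite big_cat (big_map inl) (big_map inr) !big_enum_law.
Qed.

Lemma big_vslots (T : Type) (idx : T) (op : Monoid.law idx) p F :
  \big[op/idx]_(c <- vslots r s | p c) F c =
  op (if p SlotM then F SlotM else idx)
  (op (\big[op/idx]_(a < r | p (SlotP a)) F (SlotP a))
  (op (if p SlotC then F SlotC else idx)
  (op (\big[op/idx]_(b < s | p (SlotQ b)) F (SlotQ b))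
      (if p SlotN then F SlotN else idx)))).
Proof.
have e : eseq (vslots r s) = vslot_seq r s by [].
rewrite {}e /vslot_seq big_cons big_cat big_cons big_cat big_cons big_nil /=.
rewrite (big_map SlotP) (big_map SlotQ).
rewrite !big_enum_law.
by do 3 case: (p _); rewrite ?Monoid.mul1m ?Monoid.mulm1.
Qed.

Lemma index_core_inl a : index (inl a) core_seq = a.
Proof.
rewrite index_cat map_f ?mem_enum // index_map ?index_enum_ord //.
by move=> b c [].
Qed.

Lemma index_core_inr b : index (inr b) core_seq = (r + b)%N.
Proof.
rewrite index_cat; case: ifP => [/mapP[] //|_].
rewrite size_map size_enum_ord (index_map (f := inr)) ?index_enum_ord //.
by move=> a c [].
Qed.

Lemma index_vslotP a : index (SlotP a) (vslot_seq r s) = a.+1.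
Proof.
rewrite /vslot_seq /= ifN; last by apply/eqP.
rewrite index_cat map_f ?mem_enum // index_map ?index_enum_ord //.
by move=> b c [].
Qed.

Lemma index_vslotQ b : index (SlotQ b) (vslot_seq r s) = (r + b).+2.
Proof.
rewrite /vslot_seq /= ifN; last by apply/eqP.
rewrite index_cat; case: ifP => [/mapP[] //|_].
rewrite size_map size_enum_ord /= ifN; last by apply/eqP.
rewrite index_cat map_f ?mem_enum // index_map ?index_enum_ord // ?addnS //.
by move=> a c [].
Qed.

Definition vslot_of (c : 'I_r + 'I_s) : vslot r s :=
  match c with inl a => SlotP a | inr b => SlotQ b end.

(** The extra slots shift positions but keep the relative order of the P and Q factors. As those
    slots have degree 0 in [core_pure], the signs of the differential agree with those of the
    core. *)
Lemma index_vslot_of c c' :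
  (index (vslot_of c) (vslots r s) < index (vslot_of c') (vslots r s))%N =
  (index c core_enum < index c' core_enum)%N.
Proof.
have -> : eseq (vslots r s) = vslot_seq r s by [].
have -> : eseq core_enum = core_seq by [].
case: c c' => [a|a] [b|b];
rewrite ?index_vslotP ?index_vslotQ ?index_core_inl ?index_core_inr //.
- have lt_ab : (a < r + b)%N by rewrite (leq_trans (ltn_ord a)) ?leq_addr.
  by rewrite ltnS ltnS lt_ab ltnW.
- have lt_ba : (b < r + a)%N by rewrite (leq_trans (ltn_ord b)) ?leq_addr.
  by rewrite ltnS !ltnNge (ltnW lt_ba) (leqW (ltnW lt_ba)).
Qed.

Section Insert.
Variables (theta : {perm 'I_m}) (sigma : sconn d) (omega : {perm 'I_n}).

Definition core_pure (x : tsym core) : tsym (vfactor P Q d) :=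
  vpure theta (fun a => x (inl a)) sigma (fun b => x (inr b)) omega.

Definition core_set x c (w : helt (core c)) : tsym (vfactor P Q d) :=
  match c return helt (core c) -> tsym (vfactor P Q d) with
  | inl a => fun w => tset (core_pure x) (a := SlotP a) w
  | inr b => fun w => tset (core_pure x) (a := SlotQ b) w
  end w.

Lemma core_pure_set x c (w : helt (core c)) :
  core_pure (tset x w) = core_set x w.
Proof.
case: c w => c w; apply: functional_extensionality_dep => -[|a||b|] /=.
- by rewrite tset_out //; apply/eqP.
- have [<-|ca] := eqVneq c a; first by rewrite !tset_in.
  by rewrite !tset_out //; apply: contra_neq ca => -[].
- by rewrite tset_out //; apply/eqP.
- by rewrite !tset_out //; apply/eqP.
- by rewrite tset_out //; apply/eqP.
- by rewrite tset_out //; apply/eqP.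
- by rewrite !tset_out //; apply/eqP.
- by rewrite tset_out //; apply/eqP.
- have [<-|cb] := eqVneq c b; first by rewrite !tset_in.
  by rewrite !tset_out //; apply: contra_neq cb => -[].
- by rewrite tset_out //; apply/eqP.
Qed.

Definition ins_fun D (x : tsym core) : vtens P Q d D :=
  tgen (vslots r s) D (core_pure x).

Lemma ins_lin D x a i c (u v : core a i) :
  ins_fun D (tset x (hel (c *: u + v))) =
  c *: ins_fun D (tset x (hel u)) + ins_fun D (tset x (hel v)).
Proof.
rewrite /ins_fun !core_pure_set; case: a u v => a u v; exact: tgen_lin.
Qed.

Lemma tdeg_core x : tdeg (vslots r s) (core_pure x) = tdeg core_enum x.
Proof.
by rewrite /tdeg big_core_enum big_vslots /= !add0r !addr0.
Qed.

Lemma ins_deg D x : tdeg core_enum x <> D -> ins_fun D x = 0.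
Proof. by move=> xD; apply: tgen_deg; rewrite tdeg_core. Qed.

Lemma tsgn_core x c :
  tsgn (vslots r s) (core_pure x) (vslot_of c) = tsgn core_enum x c.
Proof.
rewrite /tsgn big_core_enum big_vslots /= !if_same !add0r addr0.
congr (_ ^ (_ + _)); apply: eq_bigl => a.
  exact: (index_vslot_of (inl a)).
exact: (index_vslot_of (inr a)).
Qed.

(** The inserted basis elements have zero differential and degree 0, hence contribute neither terms
    nor signs. *)
Lemma ins_diff D x :
  \sum_(a <- core_enum) tsgn core_enum x a *: ins_fun (D - 1) (tset x (hdiff (x a))) =
  cdiff (vtens P Q d) D (ins_fun D x).
Proof.
rewrite [RHS]tdiffE /tdiff_fun big_core_enum big_vslots /=.
rewrite !(tgen_set0 (vslots r s) (D - 1) (core_pure x)) !scaler0 !add0r addr0.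
congr (_ + _); apply: eq_bigr => a _; rewrite /ins_fun core_pure_set.
  by rewrite -(tsgn_core x (inl a)).
by rewrite -(tsgn_core x (inr a)).
Qed.

Definition ins : chmap (tens core_enum core) (vtens P Q d) :=
  tens_chlift ins_lin ins_deg ins_diff.

Lemma insE D x : ins D (tgen core_enum D x) =
  vgen D theta (fun a => x (inl a)) sigma (fun b => x (inr b)) omega.
Proof. exact: tens_chliftE. Qed.

End Insert.

Definition core_of (y : tsym (vfactor P Q d)) : tsym core := fun c =>
  match c with inl a => y (SlotP a) | inr b => y (SlotQ b) end.

Lemma core_of_setP y a w : core_of (tset y (a := SlotP a) w) =
  tset (core_of y) (a := inl a) w.
Proof.
apply: functional_extensionality_dep => -[b|b] /=; last first.
  by rewrite !tset_out //; apply/eqP.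
have [<-|ab] := eqVneq a b; first by rewrite !tset_in.
by rewrite !tset_out //; apply: contra_neq ab => -[].
Qed.

Lemma core_of_setQ y b w : core_of (tset y (a := SlotQ b) w) =
  tset (core_of y) (a := inr b) w.
Proof.
apply: functional_extensionality_dep => -[a|a] /=.
  by rewrite !tset_out //; apply/eqP.
have [<-|ab] := eqVneq b a; first by rewrite !tset_in.
by rewrite !tset_out //; apply: contra_neq ab => -[].
Qed.

Lemma core_of_set y a w : (forall c, vslot_of c != a) ->
  core_of (tset y (a := a) w) = core_of y.
Proof.
move=> ca; apply: functional_extensionality_dep => -[b|b] /=.
  by rewrite tset_out // eq_sym; apply: (ca (inl b)).
by rewrite tset_out // eq_sym; apply: (ca (inr b)).
Qed.

Definition vdelta : Type := ({perm 'I_m} * sconn d * {perm 'I_n})%type.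

Definition vcoef (t : vdelta) (y : tsym (vfactor P Q d)) : k :=
  kcoef (y SlotM) t.1.1 * kcoef (y SlotC) t.1.2 * kcoef (y SlotN) t.2.

Definition contr_fun t D (y : tsym (vfactor P Q d)) : tens core_enum core D :=
  vcoef t y *: tgen core_enum D (core_of y).

Lemma contr_lin t D y a i c (u v : vfactor P Q d a i) :
  contr_fun t D (tset y (hel (c *: u + v))) =
  c *: contr_fun t D (tset y (hel u)) + contr_fun t D (tset y (hel v)).
Proof.
rewrite /contr_fun /vcoef; case: a u v => [|a||a|] u v.
- rewrite !core_of_set => [|[]|[]|[]] //; try by move=> ?; apply/eqP.
  rewrite !tset_in !(tset_out y (a := SlotM)); try by apply/eqP.
  by rewrite kcoef_linear !mulrDl scalerDl scalerA !mulrA.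
- rewrite !core_of_setP tgen_lin !(tset_out y (a := SlotP a)); try by apply/eqP.
  by rewrite scalerDr !scalerA mulrC.
- rewrite !core_of_set => [|[]|[]|[]] //; try by move=> ?; apply/eqP.
  rewrite !tset_in !(tset_out y (a := SlotC)); try by apply/eqP.
  by rewrite kcoef_linear mulrDr !mulrDl scalerDl scalerA mulrCA !mulrA.
- rewrite !core_of_setQ tgen_lin !(tset_out y (a := SlotQ a)); try by apply/eqP.
  by rewrite scalerDr !scalerA mulrC.
- rewrite !core_of_set => [|[]|[]|[]] //; try by move=> ?; apply/eqP.
  rewrite !tset_in !(tset_out y (a := SlotN)); try by apply/eqP.
  by rewrite kcoef_linear mulrDr scalerDl scalerA mulrCA.
Qed.

(** The degree of [y] can differ from that of its core only if one of the three group slots has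
    nonzero degree, and there [kcoef] vanishes. *)
Lemma contr_deg t D y : tdeg (vslots r s) y <> D -> contr_fun t D y = 0.
Proof.
move=> yD; rewrite /contr_fun /vcoef.
have [yM|/kcoef_deg->] := eqVneq (tag (y SlotM)) 0; last by rewrite !mul0r scale0r.
have [yC|/kcoef_deg->] := eqVneq (tag (y SlotC)) 0; last by rewrite mulr0 mul0r scale0r.
have [yN|/kcoef_deg->] := eqVneq (tag (y SlotN)) 0; last by rewrite mulr0 scale0r.
rewrite tgen_deg ?scaler0 // => e; apply: yD; rewrite -e /tdeg.
by rewrite big_core_enum big_vslots /= yM yC yN !add0r !addr0.
Qed.

Definition contr t D : {linear vtens P Q d D -> tens core_enum core D} :=
  tens_lift (@contr_lin t D) (@contr_deg t D).

Lemma contrE t D y : contr t D (tgen (vslots r s) D y) = contr_fun t D y.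
Proof. exact: tens_liftE. Qed.

Lemma contr_ins t t' D z :
  contr t D (ins t'.1.1 t'.1.2 t'.2 D z) = (t == t')%:R *: z.
Proof.
pose f := contr t D \o ins t'.1.1 t'.1.2 t'.2 D.
rewrite -[LHS]/(f z) -[RHS]/(((t == t')%:R \*: idfun) z); move: z.
apply: tens_ext => x; rewrite /f /= insE contrE /contr_fun /vcoef /= !kcoef_delta.
rewrite -!natrM !mulnb; congr (_ *: tgen _ _ _).
by apply: functional_extensionality_dep => -[].
Qed.

Lemma tgen_expand D y :
  tgen (vslots r s) D y =
  \sum_(t : vdelta) vcoef t y *: ins t.1.1 t.1.2 t.2 D (tgen core_enum D (core_of y)).
Proof.
pose tg (y : tsym (vfactor P Q d)) : vtens P Q d D := tgen (vslots r s) D y.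
(* The identification of the slot with [kset k X] is an explicit equality, so that one statement
   serves all three slots; in each use below it is [erefl]. *)
have expand X (a : vslot r s) (E : vfactor P Q d a = kset k X)
      (z : tsym (vfactor P Q d)) :
  tg z = \sum_(x : X) kcoef (eq_rect _ (fun C => helt C) (z a) _ E) x *:
    tg (tset z (eq_rect _ (fun C => helt C) (kdelta k x) _ (esym E))).
  rewrite -[X in tg X = _](tset_id z a).
  have L (C : complex k) (E' : C = kset k X) (h : helt C -> vtens P Q d D) w :
    (forall i c (u v : C i), h (hel (c *: u + v)) = c *: h (hel u) + h (hel v)) ->
    h w = \sum_(x : X) kcoef (eq_rect _ (fun C => helt C) w _ E') x *:
      h (eq_rect _ (fun C => helt C) (kdelta k x) _ (esym E')).
    subst C => /= hlin.
    by have /= := kset_expand (L := fun i u => h (hel u)) hlin w; rewrite helE.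
  by apply: (L _ E (fun w => tg (tset z w))) => i c u v; apply: tgen_lin.
transitivity (\sum_th \sum_si \sum_om
    vcoef (th, si, om) y *: ins th si om D (tgen core_enum D (core_of y))); last first.
  by rewrite pair_bigA pair_bigA /=; apply: eq_bigr => -[[]].
rewrite -/(tg y) (expand _ SlotM erefl) /=.
apply: eq_bigr => th _; rewrite (expand _ SlotC erefl) /= scaler_sumr.
apply: eq_bigr => si _; rewrite (expand _ SlotN erefl) /= !scaler_sumr.
apply: eq_bigr => om _; rewrite !scalerA /vcoef /=.
rewrite !tset_out; try by apply/eqP.
congr (_ *: _); rewrite insE; congr tgen.
apply: functional_extensionality_dep => -[|a||b|] /=.
- by rewrite 2?tset_out ?tset_in //; apply/eqP.
- by rewrite !tset_out //; apply/eqP.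
- by rewrite tset_out ?tset_in //; apply/eqP.
- by rewrite !tset_out //; apply/eqP.
- by rewrite tset_in.
Qed.

Lemma vtens_expand D (x : vtens P Q d D) :
  x = \sum_(t : vdelta) ins t.1.1 t.1.2 t.2 D (contr t D x).
Proof.
elim/pmod_ind: x => [|c u v {1}-> {1}->|y].
- by rewrite big1 // => t _; rewrite !raddf0.
- by rewrite scaler_sumr -big_split /=; apply: eq_bigr => t _; rewrite !linearP.
rewrite -/(tgen (vslots r s) D y) {1}tgen_expand; apply: eq_bigr => t _.
by rewrite contrE /contr_fun linearZ.
Qed.

Lemma vtens_ext D (M : lmodType k) (f g : {linear vtens P Q d D -> M}) :
    (forall theta sigma omega (x : tsym core),
      f (vgen D theta (fun a => x (inl a)) sigma (fun b => x (inr b)) omega) =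
      g (vgen D theta (fun a => x (inl a)) sigma (fun b => x (inr b)) omega)) ->
  f =1 g.
Proof.
move=> fg x; rewrite (vtens_expand x) !linear_sum; apply: eq_bigr => t _.
have {}fg : f \o ins t.1.1 t.1.2 t.2 D =1 g \o ins t.1.1 t.1.2 t.2 D.
  by apply: tens_ext => y; rewrite /= insE.
exact: fg.
Qed.

(** Deduced from [ins] being a chain map: the images of the [ins] span [vtens], and [contr] is dual
    to them, so no sign has to be computed again. *)
Lemma contr_diff t D (x : vtens P Q d D) :
  contr t (D - 1) (cdiff (vtens P Q d) D x) = cdiff (tens core_enum core) D (contr t D x).
Proof.
have ins_d t' z : contr t (D - 1) (cdiff (vtens P Q d) D (ins t'.1.1 t'.1.2 t'.2 D z))
    = (t == t')%:R *: cdiff (tens core_enum core) D z.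
  by rewrite -(contr_ins t t'); apply: congr1; exact: esym (cmap_diff _ _).
rewrite [in LHS](vtens_expand x) linear_sum linear_sum.
rewrite (bigD1 t) //= big1 ?addr0 => [|t' tt'].
  by apply: etrans (ins_d _ _) _; rewrite eqxx scale1r.
by apply: etrans (ins_d _ _) _; rewrite eq_sym (negbTE tt') scale0r.
Qed.

Definition vcontr t : chmap (vtens P Q d) (tens core_enum core) :=
  @Chmap k (vtens P Q d) (tens core_enum core) (fun D => contr t D : {linear _ -> _})
    (fun D x => contr_diff t x).

Section VtensLift.
Variables (Y : complex k) (G : vdelta -> chmap (tens core_enum core) Y).

Definition vtens_lift : chmap (vtens P Q d) Y :=
  chsum (fun t => chmap_comp (G t) (vcontr t)).

Lemma vtens_liftE t D x :
  vtens_lift D (ins t.1.1 t.1.2 t.2 D x) = G t D x.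
Proof.
rewrite chsumE (bigD1 t) //= contr_ins eqxx scale1r big1 ?addr0 // => t' tt'.
by rewrite contr_ins (negbTE tt') scale0r raddf0.
Qed.
End VtensLift.

End Core.

(** * Presentations of connected families *)

Section Presentation.
Variables (m N n : nat) (F : cfamily 'I_m 'I_N 'I_n).

Lemma cfamily_partS : ipartition (val F).1 fst.
Proof. by case/and5P: (valP F). Qed.
Lemma cfamily_partK : ipartition (val F).1 snd.
Proof. by case/and5P: (valP F). Qed.
Lemma cfamily_partK' : ipartition (val F).2 fst.
Proof. by case/and5P: (valP F). Qed.
Lemma cfamily_partE : ipartition (val F).2 snd.
Proof. by case/and5P: (valP F). Qed.
Lemma cfamily_join :
  is_join [set a.2 | a in (val F).1] [set b.1 | b in (val F).2] [set setT].
Proof. by case/and5P: (valP F). Qed.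

Variables (r s : nat) (d : vindex m N n r s).

(* An ordering of each of the two families of blocks of [F], together with a
   numbering of the elements of every block. *)
Record presentation := Presentation {
  plab1 : bij 'I_r (sub (val F).1);
  plab2 : bij 'I_s (sub (val F).2);
  numl : forall a, bij 'I_(vl d a) (sub (val (plab1 a)).1);
  numk : forall a, bij 'I_(vk d a) (sub (val (plab1 a)).2);
  numj : forall b, bij 'I_(vj d b) (sub (val (plab2 b)).1);
  numi : forall b, bij 'I_(vi d b) (sub (val (plab2 b)).2) }.

Variable p : presentation.

Definition ptheta : {perm 'I_m} := flat cfamily_partS (vl_sum d) (numl p).
Definition pkappa : {perm 'I_N} := flat cfamily_partK (vk_sum d) (numk p).
Definition plambda : {perm 'I_N} := flat cfamily_partK' (vj_sum d) (numj p).
Definition piota : {perm 'I_n} := flat cfamily_partE (vi_sum d) (numi p).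

Definition plabel : bij ('I_r + 'I_s) (label F) := sum_bij (plab1 p) (plab2 p).

Definition pkblock x := tag (blk (vk_sum d) ((pkappa^-1)%g x)).
Definition pjblock x := tag (blk (vj_sum d) ((plambda^-1)%g x)).

Lemma fibers_pkblock : [set a.2 | a in (val F).1] = fibers pkblock.
Proof.
have fE a : (val (plab1 p a)).2 = [set x | pkblock x == a].
  rewrite (flat_blkset cfamily_partK (vk_sum d) (numk p)).
  by apply/setP => x; rewrite mem_blkset inE.
apply/setP => b; apply/imsetP/imsetP => [[a aF ->]|[a _ ->]].
  exists (binv (plab1 p) (exist _ a aF)) => //.
  by rewrite -fE binvK.
by exists (val (plab1 p a)); [apply: valP|rewrite fE].
Qed.

Lemma fibers_pjblock : [set b.1 | b in (val F).2] = fibers pjblock.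
Proof.
have fE a : (val (plab2 p a)).1 = [set x | pjblock x == a].
  rewrite (flat_blkset cfamily_partK' (vj_sum d) (numj p)).
  by apply/setP => x; rewrite mem_blkset inE.
apply/setP => b; apply/imsetP/imsetP => [[a aF ->]|[a _ ->]].
  exists (binv (plab2 p) (exist _ a aF)) => //.
  by rewrite -fE binvK.
by exists (val (plab2 p a)); [apply: valP|rewrite fE].
Qed.

Lemma pkblock_surj a : exists x, pkblock x = a.
Proof.
exists (pkappa (unblk (vk_sum d) (existT _ a (Ordinal (vk_gt0 d a))))).
by rewrite /pkblock permK unblkK.
Qed.

Lemma pjblock_surj b : exists x, pjblock x = b.
Proof.
exists (plambda (unblk (vj_sum d) (existT _ b (Ordinal (vj_gt0 d b))))).
by rewrite /pjblock permK unblkK.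
Qed.

(** Substituting x = lambda i turns the edge i of the graph of sigma into the point x lying in a
    K''-block and a K'-block. Stated for arbitrary kappa and lambda, it serves both for a given
    presentation and for the family built from sigma with kappa = 1. *)
Lemma vedge_fiber (kappa lambda sigma : {perm 'I_N}) :
  sigma = Defs.pcomp kappa^-1%g lambda ->
  vedge d sigma =2 fiber_edge (fun x => tag (blk (vk_sum d) ((kappa^-1)%g x)))
                              (fun x => tag (blk (vj_sum d) ((lambda^-1)%g x))).
Proof.
move=> ->.
have E a b : [exists i, (tag (blk (vj_sum d) i) == b)
                   && (tag (blk (vk_sum d) (Defs.pcomp kappa^-1%g lambda i)) == a)] =
  [exists x, (tag (blk (vj_sum d) ((lambda^-1)%g x)) == b)
          && (tag (blk (vk_sum d) ((kappa^-1)%g x)) == a)].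
  apply/existsP/existsP => -[x xab]; last first.
    by exists ((lambda^-1)%g x); rewrite pcompE permKV.
  by exists (lambda x); rewrite permK -pcompE.
by move=> [a|a] [b|b] //=; rewrite E.
Qed.

Lemma psigma_connected : connected_perm d (Defs.pcomp pkappa^-1%g plambda).
Proof.
apply/forallP => u; apply/forallP => v.
rewrite (eq_connect (vedge_fiber erefl)).
apply: join_connected pkblock_surj pjblock_surj _ u v.
by have := cfamily_join; rewrite fibers_pkblock fibers_pjblock.
Qed.

Definition psigma : sconn d := exist _ (Defs.pcomp pkappa^-1%g plambda) psigma_connected.

Definition porder : enumeration (label F) := enum_map plabel (core_enum r s).

Section Data.
Variables (k : fieldType) (P Q : bimodule k).

Definition pfmap (c : 'I_r + 'I_s) :
    chmap (factor P Q (plabel c)) (core P Q d c) :=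
  match c with
  | inl a => bmap P (bij_inv (numl p a)) (numk p a)
  | inr b => bmap Q (bij_inv (numj p b)) (numi p b)
  end.

Definition pfunmap (c : 'I_r + 'I_s) :
    chmap (core P Q d c) (factor P Q (plabel c)) :=
  match c with
  | inl a => bmap P (numl p a) (bij_inv (numk p a))
  | inr b => bmap Q (numj p b) (bij_inv (numi p b))
  end.

Lemma pfmapK c w : hmap (pfunmap c) (hmap (pfmap c) w) = w.
Proof.
case: c w => a w; rewrite /= hbmap_comp hbmap_id // => x /=;
by rewrite ?bfunK ?binvK.
Qed.

Lemma pfunmapK c w : hmap (pfmap c) (hmap (pfunmap c) w) = w.
Proof.
case: c w => a w; rewrite /= hbmap_comp hbmap_id // => x /=;
by rewrite ?bfunK ?binvK.
Qed.

Definition pdata (x : tsym (@factor k P Q _ _ _ F)) : tsym (core P Q d) :=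
  tsym_map (e := plabel) pfmap x.
Definition pundata (y : tsym (core P Q d)) : tsym (@factor k P Q _ _ _ F) :=
  tsym_unmap (e := plabel) pfunmap y.

Lemma pdataK x : pundata (pdata x) = x.
Proof. exact: tsym_mapK pfmapK x. Qed.

Lemma pundataK y : pdata (pundata y) = y.
Proof. exact: tsym_unmapK pfunmapK y. Qed.

Definition pgen D x : vtens P Q d D :=
  ins P Q ptheta psigma piota^-1%g D (tgen (core_enum r s) D (pdata x)).

End Data.
End Presentation.

(** * Dependence on the presentation *)

Lemma hbmap_congr (k : fieldType) (R : bimodule k) (S S' E E' : finType)
    (f f' : bij S S') (g g' : bij E' E) w :
  f =1 f' -> g =1 g' -> hmap (bmap R f g) w = hmap (bmap R f' g') w.
Proof. by move=> /bij_ext -> /bij_ext ->. Qed.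

Section BijDiff.
Variables (A : finType) (B : Type) (f g : bij A B).

Lemma bij_diff_inj : injective (binv g \o f).
Proof. by apply: inj_comp; [apply: can_inj (binvK g)|apply: can_inj (bfunK f)]. Qed.

Definition bij_diff : {perm A} := perm bij_diff_inj.

Lemma bij_diffE x : g (bij_diff x) = f x.
Proof. by rewrite permE /= binvK. Qed.

Lemma bij_diff_inv y : bij_diff (binv f y) = binv g y.
Proof. by rewrite permE /= binvK. Qed.
End BijDiff.

Lemma flat_renumber (J : finType) (N : nat) (A : {set J}) (f : J -> {set 'I_N})
    (fA : ipartition A f) r (e : bij 'I_r (sub A)) (l : 'I_r -> nat)
    (lN : (\sum_(a < r) l a)%N = N) (c : forall a, bij 'I_(l a) (sub (f (val (e a)))))
    (g : forall a, {perm 'I_(l a)}) :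
  flat fA lN (fun a => Defs.bij_comp (c a) (bij_perm (g a))) =
  Defs.pcomp (flat fA lN c) (block_perm lN g).
Proof.
apply: flat_eq => a i; rewrite pcompE [block_perm _ _ _]permE /block_fun unblkK /=.
by rewrite flatE.
Qed.

(** Two numberings of the same ordered blocks differ inside each block only, hence by an element of
    the Young subgroup acting on the right. *)
Lemma flat_diff (J : finType) (N : nat) (A : {set J}) (f : J -> {set 'I_N})
    (fA : ipartition A f) r (e : bij 'I_r (sub A)) (l : 'I_r -> nat)
    (lN : (\sum_(a < r) l a)%N = N)
    (c c' : forall a, bij 'I_(l a) (sub (f (val (e a))))) :
  flat fA lN c = Defs.pcomp (flat fA lN c')
    (block_perm lN (fun a => bij_diff (c a) (c' a))).
Proof.
apply: flat_eq => a i; rewrite pcompE [block_perm _ _ _]permE /block_fun unblkK /=.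
by rewrite flatE bij_diffE.
Qed.

Section Independence.
Variables (k : fieldType) (P Q : bimodule k) (m N n : nat).
Variable F : cfamily 'I_m 'I_N 'I_n.
Variables (r s : nat).
Implicit Types (d : vindex m N n r s) (x : tsym (@factor k P Q _ _ _ F)).

Lemma pgenE d (p : presentation F d) D x :
  pgen p D x = vgen D (ptheta p) (fun a => pdata p x (inl a)) (psigma p)
    (fun b => pdata p x (inr b)) (piota p)^-1%g.
Proof. exact: insE. Qed.

Lemma vgen_congr d D theta theta' p p' (sigma sigma' : sconn d) q q' omega omega' :
    theta = theta' -> (forall a, p a = p' a) -> val sigma = val sigma' ->
    (forall b, q b = q' b) -> omega = omega' ->
  @vgen k P Q m n N r s d D theta p sigma q omega =
  vgen D theta' p' sigma' q' omega'.
Proof.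
move=> -> pp /val_inj -> qq ->; congr vgen; exact: functional_extensionality_dep.
Qed.

Section Numbering.
Variables (d : vindex m N n r s).
Variables (e1 : bij 'I_r (sub (val F).1)) (e2 : bij 'I_s (sub (val F).2)).
Variables (cl cl' : forall a, bij 'I_(vl d a) (sub (val (e1 a)).1)).
Variables (ck ck' : forall a, bij 'I_(vk d a) (sub (val (e1 a)).2)).
Variables (cj cj' : forall b, bij 'I_(vj d b) (sub (val (e2 b)).1)).
Variables (ci ci' : forall b, bij 'I_(vi d b) (sub (val (e2 b)).2)).

Let qp D := qpi (@bal_rel k P Q m n N r s d) D.

(** This lemma and the next three vary one numbering at a time, since each balancing relation moves
    a single Young subgroup. The change of numbering is split between the permutation and the tensor
    data, which is what the relation equates. *)
Lemma pgen_pl D x : qp D (pgen (Presentation cl ck cj ci) D x) =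
                    qp D (pgen (Presentation cl' ck cj ci) D x).
Proof.
set p := Presentation cl _ _ _; set p' := Presentation cl' _ _ _.
pose g a := bij_diff (cl a) (cl' a).
have E := qpi_eq (R := @bal_rel k P Q m n N r s d)
  (BalL D g (ptheta p') (fun a => pdata p x (inl a)) (psigma p)
  (fun b => pdata p x (inr b)) (piota p)^-1%g).
rewrite !pgenE; apply: etrans (etrans _ E) _.
  by apply: congr1; apply: vgen_congr => //; apply: flat_diff.
apply: congr1; apply: vgen_congr; [by []| |by []|by []|by []] => a.
rewrite /pdata /tsym_map /Defs.lact /= hbmap_comp.
by apply: hbmap_congr => // y /=; apply: bij_diff_inv.
Qed.

Lemma pgen_pk D x : qp D (pgen (Presentation cl ck cj ci) D x) =
                    qp D (pgen (Presentation cl ck' cj ci) D x).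
Proof.
set p := Presentation _ ck _ _; set p' := Presentation _ ck' _ _.
pose g a := bij_diff (ck a) (ck' a).
(* The block permutation multiplies kappa on the right, hence appears inverted on the left of
   kappa^-1 lambda; so it is [psigma p'] that is the multiple of [psigma p]. *)
have sE : val (psigma p') = Defs.pcomp (block_perm (vk_sum d) g) (val (psigma p)).
  rewrite /= -[plambda p]/(plambda p').
  have -> : pkappa p = Defs.pcomp (pkappa p') (block_perm (vk_sum d) g).
    by apply: flat_diff.
  by rewrite /Defs.pcomp invMg -!mulgA mulVg mulg1.
have E := qpi_eq (R := @bal_rel k P Q m n N r s d)
  (BalK D (ptheta p) (fun a => pdata p' x (inl a))
  (fun b => pdata p x (inr b)) (piota p)^-1%g sE).
rewrite !pgenE; apply: etrans (etrans _ E) _.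
  apply: congr1; apply: vgen_congr; [by []| |by []|by []|by []] => a.
  rewrite /pdata /tsym_map /Defs.ract /= hbmap_comp.

  by apply: hbmap_congr => [//|y]; apply: esym (bij_diffE (ck a) (ck' a) y).
by apply: congr1; apply: vgen_congr.
Qed.

Lemma pgen_pj D x : qp D (pgen (Presentation cl ck cj ci) D x) =
                    qp D (pgen (Presentation cl ck cj' ci) D x).
Proof.
set p := Presentation _ _ cj _; set p' := Presentation _ _ cj' _.
pose g a := bij_diff (cj a) (cj' a).
have sE : val (psigma p) = Defs.pcomp (val (psigma p')) (block_perm (vj_sum d) g).
  rewrite /= -[pkappa p]/(pkappa p').
  have -> : plambda p = Defs.pcomp (plambda p') (block_perm (vj_sum d) g).
    by apply: flat_diff.
  by rewrite /Defs.pcomp mulgA.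
have E := qpi_eq (R := @bal_rel k P Q m n N r s d)
  (BalJ D (ptheta p) (fun a => pdata p x (inl a))
  (fun b => pdata p x (inr b)) (piota p)^-1%g sE).
rewrite !pgenE; apply: etrans (etrans _ E) _.
  by apply: congr1; apply: vgen_congr.
apply: congr1; apply: vgen_congr; [by []|by []|by []| |by []] => a.
rewrite /pdata /tsym_map /Defs.lact /= hbmap_comp.
by apply: hbmap_congr => // y /=; apply: bij_diff_inv.
Qed.

Lemma pgen_pi D x : qp D (pgen (Presentation cl ck cj ci) D x) =
                    qp D (pgen (Presentation cl ck cj ci') D x).
Proof.
set p := Presentation _ _ _ ci; set p' := Presentation _ _ _ ci'.
pose g a := bij_diff (ci a) (ci' a).
have iE : (piota p')^-1%g = Defs.pcomp (block_perm (vi_sum d) g) (piota p)^-1%g.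
  have -> : piota p = Defs.pcomp (piota p') (block_perm (vi_sum d) g).
    by apply: flat_diff.
  by rewrite /Defs.pcomp invMg -!mulgA mulVg mulg1.
have E := qpi_eq (R := @bal_rel k P Q m n N r s d)
  (BalI D g (ptheta p) (fun a => pdata p x (inl a)) (psigma p)
  (fun b => pdata p' x (inr b)) (piota p)^-1%g).
rewrite !pgenE; apply: etrans (etrans _ E) _.
  apply: congr1; apply: vgen_congr; [by []|by []|by []| |by []] => a.
  rewrite /pdata /tsym_map /Defs.ract /= hbmap_comp.
  by apply: hbmap_congr => [//|y]; apply: esym (bij_diffE (ci a) (ci' a) y).
by apply: congr1; apply: vgen_congr.
Qed.

End Numbering.

Lemma pgen_numbering d D e1 e2 cl cl' ck ck' cj cj' ci ci' x :
  qpi (@bal_rel k P Q m n N r s d) D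
    (pgen (@Presentation _ _ _ F _ _ d e1 e2 cl ck cj ci) D x) =
  qpi (@bal_rel k P Q m n N r s d) D
    (pgen (@Presentation _ _ _ F _ _ d e1 e2 cl' ck' cj' ci') D x).
Proof.
apply: etrans (pgen_pl cl cl' ck cj ci D x) _.
apply: etrans (pgen_pk cl' ck ck' cj ci D x) _.
apply: etrans (pgen_pj cl' ck' cj cj' ci D x) _.
exact: (pgen_pi cl' ck' cj' ci ci' D x).
Qed.

Lemma flat_permute (J : finType) (M : nat) (A : {set J}) (f : J -> {set 'I_M})
    (fA : ipartition A f) q (e : bij 'I_q (sub A)) (l : 'I_q -> nat)
    (lM : (\sum_(a < q) l a)%N = M) (tau : {perm 'I_q})
    (c : forall a, bij 'I_(l a) (sub (f (val (e a))))) :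
  flat fA (e := Defs.bij_comp e (bij_perm tau^-1%g)) (sum_permute lM tau)
    (fun a => c ((tau^-1)%g a)) =
  Defs.pcomp (flat fA lM c) (permute_blocks lM tau)^-1%g.
Proof.
apply: flat_eq => a i; rewrite pcompE -(permute_blocksE lM) permK.
by rewrite flatE.
Qed.

(** The a-th block of [p] becomes the [tau a]-th, as in [vpermute]; the sizes then match by
    conversion and the numberings are reused without casts. *)
Definition ppermute d (p : presentation F d) tau ups :
    presentation F (vpermute d tau ups) :=
  @Presentation _ _ _ F _ _ (vpermute d tau ups)
    (Defs.bij_comp (plab1 p) (bij_perm tau^-1%g))
    (Defs.bij_comp (plab2 p) (bij_perm ups^-1%g))
    (fun a => numl p ((tau^-1)%g a)) (fun a => numk p ((tau^-1)%g a))
    (fun b => numj p ((ups^-1)%g b)) (fun b => numi p ((ups^-1)%g b)).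

Definition vcl d : chmap (vtens P Q d) (vcoinv P Q m n N r s) :=
  chmap_comp (qpi (@vcoinv_rel k P Q m n N r s))
    (chmap_comp (din (@vbal k P Q m n N r s) d) (qpi (@bal_rel k P Q m n N r s d))).

Lemma psigma_permute d (p : presentation F d) tau ups :
  val (psigma (ppermute p tau ups)) =
  Defs.pcomp (permute_blocks (vk_sum d) tau)
    (Defs.pcomp (val (psigma p)) (permute_blocks (vj_sum d) ups)^-1%g).
Proof.
have kE := flat_permute (cfamily_partK F) (vk_sum d) tau (numk p).
have jE := flat_permute (cfamily_partK' F) (vj_sum d) ups (numj p).
rewrite /= /pkappa /plambda kE jE /Defs.pcomp invMg !mulgA.
by congr (_ * _)%g; apply: invgK.
Qed.

Lemma pgen_permute d (p : presentation F d) tau ups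
    (sigma' : sconn (vpermute d tau ups)) D x :
    val sigma' = Defs.pcomp (permute_blocks (vk_sum d) tau)
      (Defs.pcomp (val (psigma p)) (permute_blocks (vj_sum d) ups)^-1%g) ->
  pgen (ppermute p tau ups) D x =
  vgen (d := vpermute d tau ups) D
    (Defs.pcomp (ptheta p) (permute_blocks (vl_sum d) tau)^-1%g)
    (fun a => pdata p x (inl ((tau^-1)%g a))) sigma'
    (fun b => pdata p x (inr ((ups^-1)%g b)))
    (Defs.pcomp (permute_blocks (vi_sum d) ups) (piota p)^-1%g).
Proof.
move=> sE; rewrite pgenE; apply: vgen_congr => //.
- exact: flat_permute.
- exact: etrans (psigma_permute p tau ups) (esym sE).
have iE := flat_permute (cfamily_partE F) (vi_sum d) ups (numi p).
by rewrite /piota iE /Defs.pcomp invMg; congr (_ * _)%g; apply: invgK.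
Qed.

Lemma vcl_permute d (p : presentation F d) tau ups D x :
  vcl d D (pgen p D x) =
  (perm_koszul tau (fun a => pdata p x (inl a)) *
   perm_koszul ups (fun b => pdata p x (inr b))) *:
  vcl _ D (pgen (ppermute p tau ups) D x).
Proof.
have sE := psigma_permute p tau ups.
have := qpi_rel (Vcoinv D (ptheta p) (fun a => pdata p x (inl a))
  (fun b => pdata p x (inr b)) (piota p)^-1%g sE).
rewrite chmapB chmapZ => /eqP; rewrite subr_eq0 => /eqP E.
by rewrite (pgen_permute D x sE) pgenE; apply: E.
Qed.

Lemma index_porder d (p : presentation F d) c :
  index (plabel p c) (porder p) = index c (core_enum r s).
Proof. by rewrite /porder /= index_map //; apply: can_inj (bfunK (plabel p)). Qed.

Lemma index_ppermute d (p : presentation F d) tau ups c :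
  index (plabel p c) (porder (ppermute p tau ups)) =
  index (sum_bij (bij_perm tau) (bij_perm ups) c) (core_enum r s).
Proof.
rewrite -(index_porder (ppermute p tau ups)); congr index.
by case: c => a; rewrite /= permK.
Qed.

Lemma prod_core_enum (p : pred ('I_r + 'I_s)) (f : 'I_r + 'I_s -> k) :
  \prod_(c <- core_enum r s | p c) f c =
  (\prod_(a < r | p (inl a)) f (inl a)) * (\prod_(b < s | p (inr b)) f (inr b)).
Proof. exact: big_core_enum. Qed.

(** Both orders list all P-blocks before all Q-blocks, so no P-block is inverted with a Q-block and
    the sign splits into the signs of [tau] and [ups]. *)
Lemma koszul_permute d (p : presentation F d) tau ups x :
  koszul (porder p) (porder (ppermute p tau ups)) x =
  perm_koszul tau (fun a => pdata p x (inl a)) *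
  perm_koszul ups (fun b => pdata p x (inr b)).
Proof.
pose rho := sum_bij (bij_perm tau) (bij_perm ups).
have -> : koszul (porder p) (porder (ppermute p tau ups)) x =
  \prod_(c <- core_enum r s) \prod_(c' <- core_enum r s |
     (index c (core_enum r s) < index c' (core_enum r s))%N
     && (index (rho c') (core_enum r s) < index (rho c) (core_enum r s))%N)
    (-1) ^ (tag (x (plabel p c)) * tag (x (plabel p c'))).
  rewrite /koszul {1}/porder big_map; apply: eq_bigr => c _.
  rewrite {1}/porder big_map; apply: eq_bigl => c'.
  by rewrite !index_porder !index_ppermute.
have il a : index (inl a) (core_enum r s) = a by apply: index_core_inl.
have ir b : index (inr b) (core_enum r s) = (r + b)%N by apply: index_core_inr.
have lr (a : 'I_r) b : (r + b < a)%N = false.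
  by rewrite ltnNge (leq_trans (ltnW (ltn_ord a))) ?leq_addr.
rewrite prod_core_enum; congr (_ * _); apply: eq_bigr => c _.
  rewrite prod_core_enum [X in _ * X]big1 ?mulr1 => [|c']; last by rewrite /= !ir !il lr andbF.
  by apply: eq_bigl => c'; rewrite /= !il.
rewrite prod_core_enum big1 ?mul1r => [|c']; last by rewrite /= !ir !il lr.
by apply: eq_bigl => c'; rewrite /= !ir !ltn_add2l.
Qed.

Lemma vindex_eq d d' : vl d = vl d' -> vk d = vk d' -> vj d = vj d' ->
  vi d = vi d' -> d = d'.
Proof.
case: d d' => [l k0 j i p1 p2 p3 p4 q1 q2 q3 q4].
case=> [l' k' j' i' p1' p2' p3' p4' q1' q2' q3' q4'] /= el ek ej ei.
by subst l' k' j' i'; congr Vindex; apply: Prop_irrelevance.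
Qed.

Lemma bij_card (A B : finType) (f : bij A B) : #|A| = #|B|.
Proof. exact: bij_eq_card (Bijective (bfunK f) (binvK f)). Qed.

(** Two presentations of one family differ by permutations of its two lists of blocks followed by a
    renumbering: the first costs the Koszul sign, the second nothing. *)
Lemma vcl_indep d d' (p : presentation F d) (p' : presentation F d') D x :
  vcl d D (pgen p D x) = koszul (porder p) (porder p') x *: vcl d' D (pgen p' D x).
Proof.
have [tau tauE] : {tau : {perm 'I_r} | forall a, plab1 p' (tau a) = plab1 p a}.
  by exists (bij_diff (plab1 p) (plab1 p')) => a; apply: bij_diffE.
have [ups upsE] : {ups : {perm 'I_s} | forall b, plab2 p' (ups b) = plab2 p b}.
  by exists (bij_diff (plab2 p) (plab2 p')) => b; apply: bij_diffE.
have e1 : plab1 p' = Defs.bij_comp (plab1 p) (bij_perm tau^-1%g).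
  by apply: bij_ext => a; rewrite /= -tauE permKV.
have e2 : plab2 p' = Defs.bij_comp (plab2 p) (bij_perm ups^-1%g).
  by apply: bij_ext => a; rewrite /= -upsE permKV.
case: p' e1 e2 {tauE upsE} => e1 e2 cl ck cj ci E1 E2; rewrite /= in E1 E2; subst e1 e2.
(* The sizes recorded in an index are the cardinalities of the blocks, so [d'] is forced by the
   order of the blocks. *)
have ed : d' = vpermute d tau ups.
  apply: vindex_eq; apply/funext => a /=; rewrite -[LHS]card_ord -[RHS]card_ord.
  - by rewrite (bij_card (cl a)) (bij_card (numl p _)).
  - by rewrite (bij_card (ck a)) (bij_card (numk p _)).
  - by rewrite (bij_card (cj a)) (bij_card (numj p _)).
  - by rewrite (bij_card (ci a)) (bij_card (numi p _)).
subst d'; apply: etrans (vcl_permute p tau ups D x) _.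
rewrite -koszul_permute; congr (_ *: _).
pose p0 := ppermute p tau ups.
have E := @pgen_numbering (vpermute d tau ups) D _ _
  (numl p0) cl (numk p0) ck (numj p0) cj (numi p0) ci x.
by rewrite /vcl !chmap_compE; apply: congr1; apply: congr1; apply: E.
Qed.

End Independence.

(** * Transport and existence of presentations *)

Lemma hbmap_transport (k : fieldType) (R : bimodule k) (S S' X X' : finType)
    (A : {set {set S} * {set X}})
    (x : forall a : sub A, helt (R (sub (val a).1) (sub (val a).2))) (a b : sub A)
    (f : bij (sub (val a).1) S') (f' : bij (sub (val b).1) S')
    (g : bij X' (sub (val a).2)) (g' : bij X' (sub (val b).2)) :
    val a = val b ->
    (forall y z, val y = val z -> f y = f' z) ->
    (forall y, val (g y) = val (g' y)) ->
  hmap (bmap R f g) (x a) = hmap (bmap R f' g') (x b).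
Proof.
move=> /val_inj ab; subst b => ff gg.
by apply: hbmap_congr => y; [apply: ff|apply/val_inj/gg].
Qed.

Definition bperm (T : finType) (u : bij T T) : {perm T} := perm (@Defs.bij_inj _ _ u).

Section Move.
Variables (k : fieldType) (P Q : bimodule k) (m N n : nat).
Variables (u : bij 'I_m 'I_m) (h : bij 'I_N 'I_N) (v : bij 'I_n 'I_n).
Variable F : cfamily 'I_m 'I_N 'I_n.
Variables (r s : nat) (d : vindex m N n r s) (p : presentation F d).

Definition pmove : presentation (family_map u h v F) d :=
  @Presentation _ _ _ (family_map u h v F) _ _ d
    (Defs.bij_comp (restr (f := pairsl u h) erefl) (plab1 p))
    (Defs.bij_comp (restr (f := pairsr h v) erefl) (plab2 p))
    (fun a => Defs.bij_comp (restr (f := u) erefl) (numl p a))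
    (fun a => Defs.bij_comp (restr (f := h) erefl) (numk p a))
    (fun b => Defs.bij_comp (restr (f := h) erefl) (numj p b))
    (fun b => Defs.bij_comp (restr (f := v) erefl) (numi p b)).

Lemma ptheta_move : ptheta pmove = Defs.pcomp (bperm u) (ptheta p).
Proof.
apply: flat_eq => a i; rewrite pcompE permE.
by congr (u _); rewrite [ptheta p _]flatE.
Qed.

Lemma pkappa_move : pkappa pmove = Defs.pcomp (bperm h) (pkappa p).
Proof.
apply: flat_eq => a i; rewrite pcompE permE.
by congr (h _); rewrite [pkappa p _]flatE.
Qed.

Lemma plambda_move : plambda pmove = Defs.pcomp (bperm h) (plambda p).
Proof.
apply: flat_eq => a i; rewrite pcompE permE.
by congr (h _); rewrite [plambda p _]flatE.
Qed.

Lemma piota_move : piota pmove = Defs.pcomp (bperm v) (piota p).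
Proof.
apply: flat_eq => a i; rewrite pcompE permE.
by congr (v _); rewrite [piota p _]flatE.
Qed.

(** [h] multiplies both kappa and lambda on the left and cancels in kappa^-1 lambda, so relabelling
    {1, ..., N} is invisible to Vallette's product. *)
Lemma psigma_move : val (psigma pmove) = val (psigma p).
Proof.
rewrite /= pkappa_move plambda_move /Defs.pcomp invMg mulgA.
by rewrite -[(_ * _ * (bperm h)^-1)%g]mulgA mulgV mulg1.
Qed.

Definition tsym_move (x : tsym (@factor k P Q _ _ _ F)) :
    tsym (@factor k P Q _ _ _ (family_map u h v F)) :=
  tsym_map (e := bij_inv (label_map u h v F)) (@factor_map k P Q _ _ _ _ _ _ u h v F) x.

Lemma porder_move :
  porder pmove = enum_pull (bij_inv (label_map u h v F)) (porder p).
Proof. by apply: enumeration_eq; rewrite /= -map_comp; apply: eq_map => -[]. Qed.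

(** The numberings travel with the blocks, so the factors read in coordinates do not change. *)
Lemma pdata_move x : pdata pmove (tsym_move x) = pdata p x.
Proof.
apply: functional_extensionality_dep => -[a|b].
  rewrite /pdata /tsym_move /tsym_map /= hbmap_comp.
  apply: (hbmap_transport (fun a => x (inl a))) => [|y z yz|y] /=.
  - by rewrite !imset_bijK -surjective_pairing.
  - by congr (binv _ _); apply: val_inj; rewrite /= bfunK.
  - by rewrite bfunK.
rewrite /pdata /tsym_move /tsym_map /= hbmap_comp.
apply: (hbmap_transport (fun a => x (inr a))) => [|y z yz|y] /=.
- by rewrite !imset_bijK -surjective_pairing.
- by congr (binv _ _); apply: val_inj; rewrite /= bfunK.
- by rewrite bfunK.
Qed.

Lemma cgen_move D x :
  conn_map P Q u h v D (cgen (porder p) D x) = cgen (porder pmove) D (tsym_move x).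
Proof. by rewrite conn_mapE -porder_move. Qed.

Lemma pgen_move D x :
  pgen pmove D (tsym_move x) =
  vgen D (Defs.pcomp (bperm u) (ptheta p)) (fun a => pdata p x (inl a)) (psigma p)
    (fun b => pdata p x (inr b)) (Defs.pcomp (piota p)^-1%g (bperm v)^-1%g).
Proof.
rewrite pgenE pdata_move; apply: vgen_congr => //; first exact: ptheta_move.
  exact: psigma_move.
by rewrite piota_move /Defs.pcomp invMg.
Qed.

End Move.

Section Rigid.
Variables (k : fieldType) (P Q : bimodule k) (m N n r s : nat).
Variable d : vindex m N n r s.

Lemma family_presE (F : cfamily 'I_m 'I_N 'I_n) (p : presentation F d) :
  val F = ([set (blkset (vl_sum d) (ptheta p) a, blkset (vk_sum d) (pkappa p) a)
             | a : 'I_r],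
           [set (blkset (vj_sum d) (plambda p) b, blkset (vi_sum d) (piota p) b)
             | b : 'I_s]).
Proof.
rewrite [LHS]surjective_pairing; congr (_, _); apply/setP => c.
  apply/idP/imsetP => [cF|[a _ ->]].
    exists (binv (plab1 p) (exist _ c cF)) => //.
    by rewrite -!flat_blkset binvK /= -surjective_pairing.
  by rewrite -!flat_blkset -surjective_pairing; apply: (valP (plab1 p a)).
apply/idP/imsetP => [cF|[a _ ->]].
  exists (binv (plab2 p) (exist _ c cF)) => //.
  by rewrite -!flat_blkset binvK /= -surjective_pairing.
by rewrite -!flat_blkset -surjective_pairing; apply: (valP (plab2 p a)).
Qed.

(** The blocks are images of consecutive blocks, so the four permutations determine the family, the
    order of its blocks and every numbering; then [pdata] determines the tensor. Equality of tensors
    over two families thus becomes equality of permutations. *)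
Lemma cgen_rigid (F F' : cfamily 'I_m 'I_N 'I_n) (p : presentation F d)
    (p' : presentation F' d) (x : tsym (@factor k P Q _ _ _ F)) x' D :
    ptheta p = ptheta p' -> pkappa p = pkappa p' ->
    plambda p = plambda p' -> piota p = piota p' -> pdata p x = pdata p' x' ->
  cgen (porder p) D x = cgen (porder p') D x'.
Proof.
move=> et ek ej ei ex.
have FF : F = F'.
  by apply: val_inj; rewrite (family_presE p) (family_presE p') et ek ej ei.
subst F'; suff pp : p = p'.
  by subst p'; rewrite -(pdataK p x) ex pdataK.
have e1 : plab1 p = plab1 p'.
  apply: bij_ext => a; apply: val_inj.
  rewrite [LHS]surjective_pairing [RHS]surjective_pairing.
  rewrite (flat_blkset (cfamily_partS F) (vl_sum d) (numl p)).
  rewrite (flat_blkset (cfamily_partK F) (vk_sum d) (numk p)).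
  rewrite (flat_blkset (cfamily_partS F) (vl_sum d) (numl p')).
  rewrite (flat_blkset (cfamily_partK F) (vk_sum d) (numk p')).
  by rewrite -/(ptheta p) -/(pkappa p) -/(ptheta p') -/(pkappa p') et ek.
have e2 : plab2 p = plab2 p'.
  apply: bij_ext => a; apply: val_inj.
  rewrite [LHS]surjective_pairing [RHS]surjective_pairing.
  rewrite (flat_blkset (cfamily_partK' F) (vj_sum d) (numj p)).
  rewrite (flat_blkset (cfamily_partE F) (vi_sum d) (numi p)).
  rewrite (flat_blkset (cfamily_partK' F) (vj_sum d) (numj p')).
  rewrite (flat_blkset (cfamily_partE F) (vi_sum d) (numi p')).
  by rewrite -/(plambda p) -/(piota p) -/(plambda p') -/(piota p') ej ei.
case: p p' e1 e2 {ex} et ek ej ei => [e1 e2 cl ck cj ci] [e1' e2' cl' ck' cj' ci'].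
move=> E1 E2; rewrite /= in E1 E2; subst e1' e2' => et ek ej ei.
(* With the order of the blocks fixed, each numbering can be read off the assembled permutation. *)
have flat_numE J M (A : {set J}) (f : J -> {set 'I_M}) (fA : ipartition A f) q
    (e : bij 'I_q (sub A)) (l : 'I_q -> nat) (lM : (\sum_(a < q) l a)%N = M)
    (c c' : forall a, bij 'I_(l a) (sub (f (val (e a))))) :
    flat fA lM c = flat fA lM c' -> c = c'.
  move=> cc; apply: functional_extensionality_dep => a; apply: bij_ext => i.
  by apply: val_inj; rewrite -(flatE fA lM) cc flatE.
have El : cl = cl' := flat_numE _ _ _ _ _ _ _ _ _ _ _ et.
have Ek : ck = ck' := flat_numE _ _ _ _ _ _ _ _ _ _ _ ek.
have Ej : cj = cj' := flat_numE _ _ _ _ _ _ _ _ _ _ _ ej.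
have Ei : ci = ci' := flat_numE _ _ _ _ _ _ _ _ _ _ _ ei.
by clear et ek ej ei; subst cl' ck' cj' ci'.
Qed.

End Rigid.

Section Canonical.
Variables (m N n : nat) (F : cfamily 'I_m 'I_N 'I_n).

Let r := #|sub (val F).1|.
Let s := #|sub (val F).2|.
Let e1 := bij_enum (sub (val F).1).
Let e2 := bij_enum (sub (val F).2).

Lemma ipart_ord_card (J : finType) M (A : {set J}) (f : J -> {set 'I_M})
    (fA : ipartition A f) q (e : bij 'I_q (sub A)) :
  (\sum_(a < q) #|sub (f (val (e a)))| = M)%N.
Proof. by rewrite (ipart_card fA) card_ord. Qed.

Definition cindex : vindex m N n r s :=
  @Vindex m N n r s
    (fun a => #|sub (val (e1 a)).1|) (fun a => #|sub (val (e1 a)).2|)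
    (fun b => #|sub (val (e2 b)).1|) (fun b => #|sub (val (e2 b)).2|)
    (fun a => ipart_gt0 (cfamily_partS F) (e1 a))
    (fun a => ipart_gt0 (cfamily_partK F) (e1 a))
    (fun b => ipart_gt0 (cfamily_partK' F) (e2 b))
    (fun b => ipart_gt0 (cfamily_partE F) (e2 b))
    (ipart_ord_card (cfamily_partS F) e1) (ipart_ord_card (cfamily_partK F) e1)
    (ipart_ord_card (cfamily_partK' F) e2) (ipart_ord_card (cfamily_partE F) e2).

Definition cpres : presentation F cindex :=
  @Presentation m N n F r s cindex e1 e2
    (fun a => bij_enum (sub (val (e1 a)).1)) (fun a => bij_enum (sub (val (e1 a)).2))
    (fun b => bij_enum (sub (val (e2 b)).1)) (fun b => bij_enum (sub (val (e2 b)).2)).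

End Canonical.

Section Built.
Variables (m N n r s : nat) (d : vindex m N n r s) (N_gt0 : (0 < N)%N).
Variables (theta : {perm 'I_m}) (sigma : sconn d) (omega : {perm 'I_n}).

(** Taking kappa = 1 and lambda = sigma here and in [bblock2] selects one point in the S_N-orbit of
    pairs (kappa, lambda) with kappa^-1 lambda = sigma. *)
Definition bblock1 (a : 'I_r) : {set 'I_m} * {set 'I_N} :=
  (blkset (vl_sum d) theta a, blkset (vk_sum d) 1%g a).
Definition bblock2 (b : 'I_s) : {set 'I_N} * {set 'I_n} :=
  (blkset (vj_sum d) (val sigma) b, blkset (vi_sum d) omega^-1%g b).

Definition bpairs : pairs 'I_m 'I_N 'I_n :=
  ([set bblock1 a | a : 'I_r], [set bblock2 b | b : 'I_s]).

Lemma bblock1_inj : injective bblock1.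
Proof. by move=> a b [/(blkset_inj (vl_gt0 d))]. Qed.

Lemma bblock2_inj : injective bblock2.
Proof. by move=> a b [/(blkset_inj (vj_gt0 d))]. Qed.

Lemma bpairs_connected : connected_family bpairs.
Proof.
pose kb x := tag (blk (vk_sum d) (((1%g : {perm 'I_N})^-1)%g x)).
pose jb x := tag (blk (vj_sum d) (((val sigma)^-1)%g x)).
apply/and5P; split.
- by apply: (@blkset_ipartition _ _ _ (vl_sum d) (vl_gt0 d) theta).
- by apply: (@blkset_ipartition _ _ _ (vk_sum d) (vk_gt0 d) 1%g).
- by apply: (@blkset_ipartition _ _ _ (vj_sum d) (vj_gt0 d) (val sigma)).
- by apply: (@blkset_ipartition _ _ _ (vi_sum d) (vi_gt0 d) omega^-1%g).
have -> : [set a.2 | a in bpairs.1] = fibers kb.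
  rewrite -imset_comp; apply: eq_imset => a; apply/setP => x.
  by rewrite mem_blkset inE.
have -> : [set b.1 | b in bpairs.2] = fibers jb.
  rewrite -imset_comp; apply: eq_imset => a; apply/setP => x.
  by rewrite mem_blkset inE.
apply: (connected_join (Ordinal N_gt0)) => x y.
have sE : val sigma = Defs.pcomp (1%g : {perm 'I_N})^-1%g (val sigma).
  by rewrite /Defs.pcomp invg1 mulg1.
rewrite -(eq_connect (vedge_fiber d sE)).
by have /forallP/(_ x)/forallP/(_ y) := valP sigma.
Qed.

Definition bfamily : cfamily 'I_m 'I_N 'I_n := exist _ bpairs bpairs_connected.

Definition bpres : presentation bfamily d :=
  @Presentation m N n bfamily r s d (bij_onto bblock1_inj) (bij_onto bblock2_inj)
    (bij_blkset (vl_sum d) theta) (bij_blkset (vk_sum d) 1%g)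
    (bij_blkset (vj_sum d) (val sigma)) (bij_blkset (vi_sum d) omega^-1%g).

Lemma ptheta_bpres : ptheta bpres = theta.
Proof. exact: flat_eq. Qed.

Lemma pkappa_bpres : pkappa bpres = 1%g.
Proof. exact: flat_eq. Qed.

Lemma plambda_bpres : plambda bpres = val sigma.
Proof. exact: flat_eq. Qed.

Lemma piota_bpres : piota bpres = omega^-1%g.
Proof. exact: flat_eq. Qed.

Lemma psigma_bpres : psigma bpres = sigma.
Proof.
apply: val_inj; rewrite /= pkappa_bpres plambda_bpres.
by rewrite /Defs.pcomp invg1 mulg1.
Qed.

End Built.

(** * From the product over families to Vallette's product *)

Section Psi.
Variables (k : fieldType) (P Q : bimodule k) (m n : nat).

Definition preVal (N r s : posnat) :
    chmap (vcoinv P Q m n (val N) (val r) (val s)) (boxVal_obj P Q m n) :=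
  chmap_comp (din (fun N : posnat => dsum (fun rs : posnat * posnat =>
      vcoinv P Q m n (val N) (val rs.1) (val rs.2))) N)
    (din (fun rs : posnat * posnat =>
      vcoinv P Q m n (val N) (val rs.1) (val rs.2)) (r, s)).

Definition inVal (N r s : posnat) (d : vindex m (val N) n (val r) (val s)) :
    chmap (vtens P Q d) (boxVal_obj P Q m n) :=
  chmap_comp (preVal N r s) (vcl P Q d).

Definition inB (N : posnat) :
    chmap (conn P Q 'I_m 'I_(val N) 'I_n) (boxb_obj P Q 'I_m 'I_n) :=
  chmap_comp (din (fun N : posnat => conn_coinv P Q 'I_m (val N) 'I_n) N)
    (qpi (@coinv_rel k P Q 'I_m (val N) 'I_n)).

Section Family.
Variables (N : posnat).
Implicit Types F : cfamily 'I_m 'I_(val N) 'I_n.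

Definition pchain F r s (d : vindex m (val N) n r s) (p : presentation F d) :
    chmap (tens (porder p) (@factor k P Q _ _ _ F)) (vtens P Q d) :=
  chmap_comp (ins P Q (ptheta p) (psigma p) (piota p)^-1%g)
    (tens_map (oA := porder p) (oB := core_enum r s) (e := plabel p) erefl (pfmap p P Q)).

Lemma pchainE F r s (d : vindex m (val N) n r s) (p : presentation F d) D x :
  pchain p D (tgen (porder p) D x) = pgen p D x.
Proof. by rewrite chmap_compE tens_mapE. Qed.

Lemma card_posnat : (0 < #|'I_(val N)|)%N.
Proof. by rewrite card_ord; apply: (valP N). Qed.

(** Vallette's sum runs over r, s at least 1; a partition of the non-empty set {1, ..., N} has at
    least one block. *)
Definition csize1 F : posnat :=
  exist _ #|sub (val F).1| (ipart_size_gt0 (cfamily_partK F) card_posnat).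
Definition csize2 F : posnat :=
  exist _ #|sub (val F).2| (ipart_size_gt0 (cfamily_partK' F) card_posnat).

Definition cval F : chmap (tens (porder (cpres F)) (@factor k P Q _ _ _ F))
    (boxVal_obj P Q m n) :=
  chmap_comp (@inVal N (csize1 F) (csize2 F) (cindex F)) (pchain (cpres F)).

Definition psi_otens F : chmap (otens (@factor k P Q _ _ _ F)) (boxVal_obj P Q m n) :=
  dsum_chlift (fun o => chmap_comp (cval F) (reord _ o (porder (cpres F)))).

Lemma psi_otensE F o D x :
  psi_otens F D (ogen o D x) =
  koszul o (porder (cpres F)) x *:
  @inVal N (csize1 F) (csize2 F) _ D (pgen (cpres F) D x).
Proof.
rewrite dsum_chliftE chmap_compE reordE chmapZ; congr (_ *: _).
by rewrite chmap_compE; apply: congr1; apply: pchainE.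
Qed.

Lemma psi_utens_rel F D (x : otens (@factor k P Q _ _ _ F) D) :
  utens_rel x -> psi_otens F D x = 0.
Proof.
case=> o o' {}x; rewrite chmapB chmapZ.
apply/eqP; rewrite subr_eq0; apply/eqP; apply: etrans (psi_otensE o D x) _.
rewrite (koszul_trans o o' (porder (cpres F)) x) -scalerA; congr (_ *: _).
exact: esym (psi_otensE o' D x).
Qed.

Definition psi_conn : chmap (conn P Q 'I_m 'I_(val N) 'I_n) (boxVal_obj P Q m n) :=
  dsum_chlift (fun F => quot_chlift (@psi_utens_rel F)).

Lemma psi_conn_cpres F o D x :
  psi_conn D (@cgen k P Q _ _ _ F o D x) =
  koszul o (porder (cpres F)) x *:
  @inVal N (csize1 F) (csize2 F) _ D (pgen (cpres F) D x).
Proof. by rewrite dsum_chliftE quot_chliftE psi_otensE. Qed.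

(** The canonical presentation used to define [psi_conn] may be replaced by any other: r and s are
    forced as numbers of blocks, and the sign of [vcl_indep] combines with the reordering sign by
    [koszul_trans]. *)
Lemma psi_connE F (r s : posnat) (d : vindex m (val N) n (val r) (val s))
    (p : presentation F d) o D x :
  psi_conn D (@cgen k P Q _ _ _ F o D x) =
  koszul o (porder p) x *: @inVal N r s d D (pgen p D x).
Proof.
have er : r = csize1 F.
  by apply: val_inj; rewrite /= -(bij_card (plab1 p)) card_ord.
have es : s = csize2 F.
  by apply: val_inj; rewrite /= -(bij_card (plab2 p)) card_ord.
subst r s; rewrite psi_conn_cpres (koszul_trans o (porder p)) -scalerA.
congr (_ *: _); apply: esym.
apply: etrans (congr1 (preVal N _ _ D) (vcl_indep p (cpres F) D x)) _.
exact: chmapZ.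
Qed.

End Family.

Lemma boxVal_act_inVal (N r s : posnat) (d : vindex m (val N) n (val r) (val s))
    g h D x :
  boxVal_act P Q g h D (@inVal N r s d D x) = inVal d D (vtens_act P Q g h d D x).
Proof. exact: boxVal_actE. Qed.

Lemma bperm_perm (T : finType) (g : {perm T}) : bperm (bij_perm g) = g.
Proof. by apply/permP => x; rewrite permE. Qed.

(** The image family is evaluated at the transport [pmove] of the canonical presentation of F. The
    right-hand side does not depend on [h]: identities for [u] and [v] give the descent to
    S_N-coinvariants, the identity for [h] gives equivariance. *)
Lemma psi_conn_map (N : posnat) (u : bij 'I_m 'I_m) (h : bij 'I_(val N) 'I_(val N))
    (v : bij 'I_n 'I_n) D (y : conn P Q 'I_m 'I_(val N) 'I_n D) :
  psi_conn N D (conn_map P Q u h v D y) =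
  boxVal_act P Q (bperm u) (bperm v)^-1%g D (psi_conn N D y).
Proof.
move: D y; apply: (conn_chext (f := chmap_comp (psi_conn N) (conn_map P Q u h v))
  (g := chmap_comp (boxVal_act P Q (bperm u) (bperm v)^-1%g) (psi_conn N))).
move=> F o D x; rewrite [LHS]chmap_compE [RHS]chmap_compE conn_mapE.
rewrite [in RHS]psi_conn_cpres chmapZ.
rewrite (psi_connE (r := csize1 F) (s := csize2 F) (pmove u h v (cpres F))).
rewrite porder_move koszul_map; congr (_ *: _).
rewrite boxVal_act_inVal; apply: congr1.
by rewrite pgen_move pgenE vtens_actE.
Qed.

Lemma psi_coinv_rel (N : posnat) D (x : conn P Q 'I_m 'I_(val N) 'I_n D) :
  coinv_rel x -> psi_conn N D x = 0.
Proof.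
case=> g {}x; rewrite chmapB psi_conn_map.
have -> : bperm (bij_id 'I_m) = 1%g by apply/permP => y; rewrite permE perm1.
have -> : bperm (bij_id 'I_n) = 1%g by apply/permP => y; rewrite permE perm1.
by rewrite invg1 boxVal_act1 subrr.
Qed.

Definition psi : chmap (boxb_obj P Q 'I_m 'I_n) (boxVal_obj P Q m n) :=
  dsum_chlift (fun N : posnat => quot_chlift (@psi_coinv_rel N)).

Lemma psi_inB (N : posnat) D x : psi D (inB N D x) = psi_conn N D x.
Proof. by rewrite [LHS]dsum_chliftE quot_chliftE. Qed.

Lemma psi_act (g : {perm 'I_m}) (h : {perm 'I_n}) D (x : boxb_obj P Q 'I_m 'I_n D) :
  psi D (boxb_map P Q (bij_perm g) (bij_perm h) D x) =
  boxVal_act P Q g h D (psi D x).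
Proof.
move: D x; apply: (boxb_chext
  (f := chmap_comp psi (boxb_map P Q (bij_perm g) (bij_perm h)))
  (g := chmap_comp (boxVal_act P Q g h) psi)) => N D x.
rewrite [LHS]chmap_compE [RHS]chmap_compE boxb_mapE.
set y := conn_map _ _ _ _ _ D x.
rewrite -[LHS]/(psi D (inB N D y)) -[X in boxVal_act _ _ _ _ _ X]/(psi D (inB N D x)).
rewrite !psi_inB /y psi_conn_map.
rewrite bperm_perm.
have -> : bperm (bij_inv (bij_perm h)) = h^-1%g.
  by apply/permP => z; rewrite permE.
by rewrite invgK.
Qed.

End Psi.

(** * The inverse *)

Section Acts.
Variables (k : fieldType) (R : bimodule k) (S S' E E' : finType).

Lemma hbmap_lact (c : bij S' S) (f : bij E' E) (g : {perm S'}) w :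
  hmap (bmap R (bij_inv (Defs.bij_comp c (bij_perm g))) f) w =
  Defs.lact g^-1%g (hmap (bmap R (bij_inv c) f) w).
Proof.
by rewrite /Defs.lact hbmap_comp; apply: hbmap_congr.
Qed.

Lemma hbmap_ract (f : bij S S') (c : bij E' E) (g : {perm E'}) w :
  hmap (bmap R f (Defs.bij_comp c (bij_perm g))) w =
  Defs.ract (hmap (bmap R f c) w) g.
Proof. by rewrite /Defs.ract hbmap_comp; apply: hbmap_congr. Qed.

Lemma lactK (g : {perm S}) (w : helt (R S E)) : Defs.lact g^-1%g (Defs.lact g w) = w.
Proof. by rewrite /Defs.lact hbmap_comp hbmap_id // => y; apply: permK. Qed.

End Acts.

Section Phi.
Variables (k : fieldType) (P Q : bimodule k) (m n : nat).

Lemma inB_perm (N : posnat) (g : {perm 'I_(val N)}) D y :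
  inB P Q m n N D (conn_map P Q (bij_id _) (bij_perm g) (bij_id _) D y) =
  inB P Q m n N D y.
Proof.
rewrite [LHS]chmap_compE [RHS]chmap_compE; apply: congr1.
by apply: (qpi_eq (R := @coinv_rel k P Q _ _ _)); apply: Coinv.
Qed.

Section Fixed.
Variables (N : posnat) (r s : nat) (d : vindex m (val N) n r s).

Definition connin F (p : presentation F d) :
    chmap (tens (porder p) (@factor k P Q _ _ _ F)) (conn P Q 'I_m 'I_(val N) 'I_n) :=
  chmap_comp (din (fun F : cfamily 'I_m 'I_(val N) 'I_n => utens (@factor k P Q _ _ _ F)) F)
    (chmap_comp (qpi (@utens_rel k _ (@factor k P Q _ _ _ F)))
       (din (fun o => tens o (@factor k P Q _ _ _ F)) (porder p))).

Let bp (t : vdelta d) := bpres (valP N) t.1.1 t.1.2 t.2.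

(** For each basis triple [t], the core tensor is read as a tensor over the family built from [t];
    the splitting of [vtens] assembles these chain maps. *)
Definition phi_vtens : chmap (vtens P Q d) (boxb_obj P Q 'I_m 'I_n) :=
  vtens_lift (fun t => chmap_comp (inB P Q m n N)
    (chmap_comp (connin (bp t))
      (tens_unmap (e := plabel (bp t)) (pfunmap (bp t) P Q) (core_enum r s)))).

Definition mkcore (p : forall a, helt (P 'I_(vl d a) 'I_(vk d a)))
    (q : forall b, helt (Q 'I_(vj d b) 'I_(vi d b))) : tsym (core P Q d) :=
  fun c => match c with inl a => p a | inr b => q b end.

Lemma phi_vgen_bpres D theta p sigma q omega :
  phi_vtens D (vgen D theta p sigma q omega) =
  inB P Q m n N D (cgen (porder (bpres (valP N) theta sigma omega)) D
    (pundata (bpres (valP N) theta sigma omega) (mkcore p q))).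
Proof.
have -> : vgen D theta p sigma q omega =
    ins P Q theta sigma omega D (tgen (core_enum r s) D (mkcore p q)).
  by rewrite insE.
rewrite (vtens_liftE _ (theta, sigma, omega)).
by rewrite [LHS]chmap_compE; apply: congr1; rewrite [LHS]chmap_compE tens_unmapE.
Qed.

(** Relabelling by kappa^-1, which is free in the coinvariants, brings an arbitrary presentation to
    kappa = 1; by rigidity it then agrees with the built one. *)
Lemma phi_vgen F (p : presentation F d) D x :
  phi_vtens D (pgen p D x) = inB P Q m n N D (cgen (porder p) D x).
Proof.
rewrite pgenE phi_vgen_bpres.
rewrite -[RHS](inB_perm (pkappa p)^-1%g) cgen_move; apply: congr1.
have bid (T : finType) : bperm (bij_id T) = 1%g.
  by apply/permP => y; rewrite permE perm1.
apply: cgen_rigid.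
- by rewrite ptheta_bpres ptheta_move bid /Defs.pcomp mulg1.
- by rewrite pkappa_bpres pkappa_move bperm_perm /Defs.pcomp mulgV.
- by rewrite plambda_bpres plambda_move bperm_perm.
- by rewrite piota_bpres piota_move bid /Defs.pcomp mulg1 invgK.
rewrite pundataK pdata_move; apply: functional_extensionality_dep => -[a|b] //.
Qed.

Lemma vgen_bpres D theta p sigma q omega :
  vgen D theta p sigma q omega =
  pgen (bpres (valP N) theta sigma omega) D
    (pundata (bpres (valP N) theta sigma omega) (mkcore p q)).
Proof.
rewrite pgenE pundataK; apply: vgen_congr => //; first exact: esym (ptheta_bpres _ _ _ _).
  by rewrite psigma_bpres.
by rewrite piota_bpres invgK.
Qed.

(** In each case the two sides are [pgen] of the same tensor for two presentations [b] and [b'] that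
    differ in one numbering. By [phi_vgen] only the order of the blocks matters, and [b] and [b']
    share it. *)
Lemma phi_bal_rel D (x : vtens P Q d D) : bal_rel x -> phi_vtens D x = 0.
Proof.
case=> [g theta p sigma q omega|g theta p sigma sigma' q omega e
       |g theta p sigma sigma' q omega e|g theta p sigma q omega];
rewrite chmapB; apply/eqP; rewrite subr_eq0; apply/eqP.
- set b := bpres (valP N) theta sigma omega.
  set y := pundata b (mkcore (fun a => Defs.lact (g a) (p a)) q).
  pose b' := @Presentation _ _ _ _ _ _ d (plab1 b) (plab2 b)
    (fun a => Defs.bij_comp (numl b a) (bij_perm (g a))) (numk b) (numj b) (numi b).
  have yE : pdata b y = mkcore (fun a => Defs.lact (g a) (p a)) q by apply: pundataK.
  have -> : vgen D (Defs.pcomp theta (block_perm (vl_sum d) g)) p sigma q omega =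
            pgen b' D y.
    rewrite pgenE; apply: vgen_congr.
    + by rewrite [RHS]flat_renumber -/(ptheta b) ptheta_bpres.
    + move=> a; have ya : pdata b y (inl a) = Defs.lact (g a) (p a) by rewrite yE.
      by rewrite -[LHS](lactK (g a)) -ya; apply: esym; apply: hbmap_lact.
    + by rewrite -[in LHS](psigma_bpres (valP N) theta sigma omega).
    + by move=> c; rewrite -[LHS]/(mkcore (fun a => Defs.lact (g a) (p a)) q (inr c)) -yE.
    + by rewrite -[piota b']/(piota b) piota_bpres invgK.
  apply: etrans (phi_vgen b' D y) _; rewrite vgen_bpres.
  exact: esym (phi_vgen b D y).
(* The family is built from [sigma']: renumbering changes kappa from 1 to the block permutation, and
   its inverse times [sigma'] is [sigma]. *)
- set b := bpres (valP N) theta sigma' omega.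
  set y := pundata b (mkcore p q).
  pose b' := @Presentation _ _ _ _ _ _ d (plab1 b) (plab2 b) (numl b)
    (fun a => Defs.bij_comp (numk b a) (bij_perm (g a))) (numj b) (numi b).
  have yE : pdata b y = mkcore p q by apply: pundataK.
  have -> : vgen D theta (fun a => Defs.ract (p a) (g a)) sigma q omega = pgen b' D y.
    rewrite pgenE; apply: vgen_congr.
    + by rewrite -[ptheta b']/(ptheta b) ptheta_bpres.
    + move=> a; rewrite -[p a]/(mkcore p q (inl a)) -yE.
      by apply: esym; apply: hbmap_ract.
    + have kE : pkappa b' = block_perm (vk_sum d) g.
        rewrite [LHS]flat_renumber -/(pkappa b) pkappa_bpres.
        by rewrite /Defs.pcomp mulg1.
      rewrite /= kE -[plambda b']/(plambda b) plambda_bpres e /Defs.pcomp.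
      by rewrite -mulgA mulgV mulg1.
    + by move=> c; rewrite -[LHS]/(mkcore p q (inr c)) -yE.
    + by rewrite -[piota b']/(piota b) piota_bpres invgK.
  apply: etrans (phi_vgen b' D y) _; rewrite vgen_bpres.
  exact: esym (phi_vgen b D y).
- set b := bpres (valP N) theta sigma omega.
  set y := pundata b (mkcore p (fun b => Defs.lact (g b) (q b))).
  pose b' := @Presentation _ _ _ _ _ _ d (plab1 b) (plab2 b) (numl b) (numk b)
    (fun a => Defs.bij_comp (numj b a) (bij_perm (g a))) (numi b).
  have yE : pdata b y = mkcore p (fun b => Defs.lact (g b) (q b)) by apply: pundataK.
  have -> : vgen D theta p sigma' q omega = pgen b' D y.
    rewrite pgenE; apply: vgen_congr.
    + by rewrite -[ptheta b']/(ptheta b) ptheta_bpres.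
    + by move=> a; rewrite -[LHS]/(mkcore p (fun b => Defs.lact (g b) (q b)) (inl a)) -yE.
    + have jE : plambda b' = Defs.pcomp (val sigma) (block_perm (vj_sum d) g).
        by rewrite [LHS]flat_renumber -/(plambda b) plambda_bpres.
      rewrite /= jE -[pkappa b']/(pkappa b) pkappa_bpres e.
      by rewrite /Defs.pcomp invg1 mulg1.
    + move=> a; have ya : pdata b y (inr a) = Defs.lact (g a) (q a) by rewrite yE.
      by rewrite -[LHS](lactK (g a)) -ya; apply: esym; apply: hbmap_lact.
    + by rewrite -[piota b']/(piota b) piota_bpres invgK.
  apply: etrans (phi_vgen b' D y) _; rewrite vgen_bpres.
  exact: esym (phi_vgen b D y).
(* Here iota is the inverse of block permutation times omega; renumbering multiplies it on the right
   by the block permutation and leaves [omega^-1]. *)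
- set b := bpres (valP N) theta sigma (Defs.pcomp (block_perm (vi_sum d) g) omega).
  set y := pundata b (mkcore p q).
  pose b' := @Presentation _ _ _ _ _ _ d (plab1 b) (plab2 b) (numl b) (numk b) (numj b)
    (fun a => Defs.bij_comp (numi b a) (bij_perm (g a))).
  have yE : pdata b y = mkcore p q by apply: pundataK.
  have -> : vgen D theta p sigma (fun b => Defs.ract (q b) (g b)) omega = pgen b' D y.
    rewrite pgenE; apply: vgen_congr.
    + by rewrite -[ptheta b']/(ptheta b) ptheta_bpres.
    + by move=> a; rewrite -[LHS]/(mkcore p q (inl a)) -yE.
    + by rewrite -[in LHS](psigma_bpres (valP N) theta sigma
        (Defs.pcomp (block_perm (vi_sum d) g) omega)).
    + move=> a; rewrite -[q a]/(mkcore p q (inr a)) -yE.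
      by apply: esym; apply: hbmap_ract.
    + have iE : piota b' = omega^-1%g.
        rewrite [LHS]flat_renumber -/(piota b) piota_bpres /Defs.pcomp.
        by rewrite invMg mulgA mulgV mul1g.
      by rewrite iE invgK.
  apply: etrans (phi_vgen b' D y) _; rewrite vgen_bpres.
  exact: esym (phi_vgen b D y).
Qed.

Definition phi_vbal : chmap (@vbal k P Q m n (val N) r s d) (boxb_obj P Q 'I_m 'I_n) :=
  quot_chlift phi_bal_rel.

End Fixed.

Definition phi_vsum (N : posnat) r s :
    chmap (vsum P Q m n (val N) r s) (boxb_obj P Q 'I_m 'I_n) :=
  dsum_chlift (fun d => phi_vbal d).

Lemma phi_vsumE (N : posnat) r s (d : vindex m (val N) n r s) D x :
  phi_vsum N r s D (din _ d D (qpi _ D x)) = phi_vtens d D x.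
Proof. by rewrite [LHS]dsum_chliftE quot_chliftE. Qed.

(** Both generators come from one tensor over one family, with its blocks listed in two orders, so
    the sign in the relation is the one in the definition of the unordered tensor product. *)
Lemma phi_vcoinv_rel (N : posnat) r s D (x : vsum P Q m n (val N) r s D) :
  vcoinv_rel x -> phi_vsum N r s D x = 0.
Proof.
case=> d tau ups theta p sigma sigma' q omega e.
rewrite chmapB chmapZ; apply/eqP; rewrite subr_eq0; apply/eqP.
set b := bpres (valP N) theta sigma omega.
set y := pundata b (mkcore p q).
have yE : pdata b y = mkcore p q by apply: pundataK.
have e' : val sigma' = Defs.pcomp (permute_blocks (vk_sum d) tau)
    (Defs.pcomp (val (psigma b)) (permute_blocks (vj_sum d) ups)^-1%g).
  by rewrite (psigma_bpres (valP N) theta sigma omega).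
have pE := pgen_permute D y e'.
have {}pE : vgen (d := vpermute d tau ups) D
    (Defs.pcomp theta (permute_blocks (vl_sum d) tau)^-1%g)
    (fun a => p ((tau^-1)%g a)) sigma' (fun b => q ((ups^-1)%g b))
    (Defs.pcomp (permute_blocks (vi_sum d) ups) omega) =
    pgen (ppermute b tau ups) D y.
  rewrite pE; apply: vgen_congr.
  - by rewrite ptheta_bpres.
  - by move=> a; rewrite yE.
  - by [].
  - by move=> a; rewrite yE.
  - by rewrite piota_bpres invgK.
apply: etrans (phi_vsumE _) _; apply: esym; apply: etrans (congr1 _ (phi_vsumE _)) _.
rewrite pE phi_vgen (vgen_bpres D theta p sigma q omega) phi_vgen -/b -/y.
rewrite -chmapZ; apply: congr1; apply: esym.
have kE : koszul (porder b) (porder (ppermute b tau ups)) y =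
    perm_koszul tau p * perm_koszul ups q by rewrite koszul_permute yE.
rewrite -kE /cgen (ugen_swap (porder b) (porder (ppermute b tau ups))).
exact: chmapZ.
Qed.

Definition phi_vcoinv (N : posnat) r s :
    chmap (vcoinv P Q m n (val N) r s) (boxb_obj P Q 'I_m 'I_n) :=
  quot_chlift (@phi_vcoinv_rel N r s).

Definition phi : chmap (boxVal_obj P Q m n) (boxb_obj P Q 'I_m 'I_n) :=
  dsum_chlift (fun N : posnat => dsum_chlift (fun rs : posnat * posnat =>
    phi_vcoinv N (val rs.1) (val rs.2))).

Lemma phi_inVal (N r s : posnat) (d : vindex m (val N) n (val r) (val s)) D x :
  phi D (inVal P Q d D x) = phi_vtens d D x.
Proof.
rewrite [LHS]dsum_chliftE [LHS]dsum_chliftE [LHS]quot_chliftE.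
exact: phi_vsumE.
Qed.

(** [phi_vgen] applies to the canonical presentation and returns the tensor in the order
    [porder (cpres F)]; the Koszul sign introduced by [psi] restores the given order. *)
Lemma psiK D (x : boxb_obj P Q 'I_m 'I_n D) : phi D (psi P Q m n D x) = x.
Proof.
move: D x; apply: (boxb_chext (f := chmap_comp phi (psi P Q m n)) (g := chmap_id _)).
move=> N; apply: (conn_chext
  (f := chmap_comp (chmap_comp phi (psi P Q m n)) (inB P Q m n N)) (g := inB P Q m n N)).
move=> F o D x.
rewrite -[LHS]/(phi D (psi P Q m n D (inB P Q m n N D (cgen o D x)))) psi_inB.
rewrite psi_conn_cpres chmapZ phi_inVal phi_vgen -chmapZ; apply: congr1.
by rewrite /cgen (ugen_swap o (porder (cpres F))) chmapZ.
Qed.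

(** Every [vgen] is [pgen] of its built presentation [b]; evaluating [psi_connE] at [b], in the
    order of [b] itself, leaves no sign. *)
Lemma phiK D (x : boxVal_obj P Q m n D) : psi P Q m n D (phi D x) = x.
Proof.
move: D x; apply: (vcoinv_chext (f := chmap_comp (psi P Q m n) phi) (g := chmap_id _)).
move=> N r s d D x.
rewrite -[LHS]/(psi P Q m n D (phi D (inVal P Q d D x))) -[RHS]/(inVal P Q d D x).
rewrite phi_inVal; move: x.
apply: (vtens_ext (f := psi P Q m n D \o phi_vtens d D) (g := inVal P Q d D)).
move=> theta sigma omega x; rewrite vgen_bpres.
set b := bpres _ _ _ _; set y := pundata b _.
rewrite -[LHS]/(psi P Q m n D (phi_vtens d D (pgen b D y))).
apply: etrans (congr1 (psi P Q m n D) (phi_vgen b D y)) _.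
rewrite psi_inB; apply: etrans (psi_connE (r := r) (s := s) b _ D y) _.
by rewrite koszul_refl scale1r.
Qed.

End Phi.

Unset Implicit Arguments.

Theorem proposition3p16 (k : fieldType) (P Q : bimodule k)
    (hP : reduced P) (hQ : reduced Q) (m n : nat) (hm : (1 <= m)%N) (hn : (1 <= n)%N) :
  smodule_iso (arity (boxb P Q) m n) (boxVal P Q m n).
Proof.
exists (psi P Q m n); split=> [D|g h D x]; last exact: psi_act.
by exists (phi P Q m n D) => x; [apply: psiK|apply: phiK].
Qed.
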